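(* Let $\alpha>0$ and let $D\subset\mathbb{R}^d$ be a bounded Lipschitz domain. Then the Wiener integral $$u(t,x)=\int_0^t\int_D P_{t-r}(x,y)\,W_\alpha(\mathrm{d}r,\mathrm{d}y)$$ is well defined (that is, $p_{t,x}\in\mathcal{H}_\alpha(D)$) for every $(t,x)\in(0,\infty)\times D$ if and only if $\alpha>d/2-1$.
   Context: A domain is a nonempty open connected set. Let $0<\lambda_1<\lambda_2\le\lambda_3\le\cdots$ be the eigenvalues (with multiplicity) of the Dirichlet Laplacian $-\Delta$ on $D$ and $\{f_n\}_{n\ge1}$ an orthonormal basis of $L^2(D)$ of eigenfunctions: $-\Delta f_n=\lambda_n f_n$ in $D$, $f_n=0$ on $\partial D$. The Dirichlet heat kernel is $P_t(x,y)=\sum_{n\ge1}e^{-\lambda_n t}f_n(x)f_n(y)$, $t>0$, $x,y\in D$. Let $\mathcal{S}(D)=\{\phi\in C_0(D):\ \forall k\ge0,\ \lim_{n\to\infty}n^k|\langle\phi,f_n\rangle_{L^2(D)}|=0\}$. Let $\mathcal{H}^\alpha(D)$ be the completion of $\mathcal{S}(D)$ under the inner product $\langle\phi,\psi\rangle_\alpha=\sum_{n\ge1}\lambda_n^{-\alpha}\langle\phi,f_n\rangle_{L^2(D)}\langle\psi,f_n\rangle_{L^2(D)}$, with norm $\|\cdot\|_\alpha$, and let $\mathcal{H}_\alpha(D)=L^2((0,\infty);\mathcal{H}^\alpha(D))$, i.e. functions $f:(0,\infty)\to\mathcal{H}^\alpha(D)$ with $\int_0^\infty\|f(s,\cdot)\|_\alpha^2\,\mathrm{d}s<\infty$.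 The noise $W_\alpha=\{W_\alpha(f)\}_{f\in\mathcal{H}_\alpha(D)}$ is a centered isonormal Gaussian process with $\mathbb{E}[W_\alpha(f)W_\alpha(g)]=\int_0^\infty\langle f(s,\cdot),g(s,\cdot)\rangle_\alpha\,\mathrm{d}s$. For $t>0$, $x\in D$ put $p_{t,x}(s,y)=P_{t-s}(x,y)\mathbf{1}_{(0,t)}(s)$; for each $s\in(0,t)$ one has $p_{t,x}(s,\cdot)\in\mathcal{S}(D)$. The Wiener integral in the claim means $W_\alpha(p_{t,x})$; it is well defined exactly when $p_{t,x}\in\mathcal{H}_\alpha(D)$, i.e. when $\int_0^t\|P_{t-s}(x,\cdot)\|_\alpha^2\,\mathrm{d}s<\infty$. When defined for all $(t,x)$, $u$ is the mild solution of $\partial_tu=\Delta u+\dot W_\alpha$ on $D$ with zero Dirichlet boundary condition and zero initial condition. *)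

(* Defs.v *)
From HB Require Import structures.
From mathcomp Require Import all_boot all_order all_algebra.
From mathcomp Require Import all_classical all_reals all_analysis.
Set Implicit Arguments.
Unset Strict Implicit.
Unset Printing Implicit Defensive.
Import Order.TTheory GRing.Theory Num.Theory.
Import numFieldNormedType.Exports.
Local Open Scope classical_set_scope.
Local Open Scope ring_scope.

(* R^d is 'rV[R]_d, with the sigma-algebra generated by the coordinates; since
   R is second countable this is the Borel sigma-algebra of R^d. *)

Definition row_display : measure_display. Proof. exact: default_measure_display. Qed.

Section row_measurable.
Context {R : realType} (d : nat).

Let coord : 'I_d -> 'rV[R]_d -> R := fun i x => x ord0 i.

Let row_set0 : g_sigma_preimage coord set0.
Proof. exact: sigma_algebra0. Qed.

Let row_setC A : g_sigma_preimage coord A -> g_sigma_preimage coord (~` A).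
Proof. exact: sigma_algebraC. Qed.

Let row_bigcup (F : (set 'rV[R]_d)^nat) : (forall i, g_sigma_preimage coord (F i)) ->
  g_sigma_preimage coord (\bigcup_i (F i)).
Proof. exact: sigma_algebra_bigcup. Qed.

HB.instance Definition _ := @isMeasurable.Build row_display
  'rV[R]_d (g_sigma_preimage coord) row_set0 row_setC row_bigcup.

Lemma measurable_coord (i : 'I_d) :
  measurable_fun [set: 'rV[R]_d] (fun x : 'rV[R]_d => x ord0 i).
Proof.
move=> _ Y mY; rewrite setTI; apply: sub_sigma_algebra => /=.
rewrite -bigcup_seq/=; exists i => /=; first by rewrite mem_index_enum.
by exists Y => //; rewrite setTI.
Qed.

Lemma measurable_fun_row d1 (T1 : measurableType d1) (f : T1 -> 'rV[R]_d) :
  (forall i, measurable_fun [set: T1] (fun t => f t ord0 i)) ->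
  measurable_fun [set: T1] f.
Proof.
move=> mf _ A mA; rewrite setTI.
suff : g_sigma_preimage coord `<=` [set A | measurable (f @^-1` A)] by exact.
apply: smallest_sub.
- split => /=.
  + by rewrite preimage_set0.
  + by move=> B mB; rewrite setTD preimage_setC; exact: measurableC.
  + by move=> F mF; rewrite preimage_bigcup; exact: bigcup_measurable.
- rewrite -bigcup_seq => B [i _] [C mC <-] /=.
  rewrite setTI -[X in measurable X]setTI.
  exact: (mf i measurableT C mC).
Qed.

End row_measurable.

Section row_measure.
Context {R : realType}.

Definition row_cons (d : nat) (p : R * 'rV[R]_d) : 'rV[R]_d.+1 :=
  row_mx (const_mx p.1 : 'rV_1) p.2.

Definition row_uncons (d : nat) (x : 'rV[R]_d.+1) : R * 'rV[R]_d :=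
  (x ord0 ord0, rsubmx (x : 'rV_(1 + d))).

Lemma row_consK d : cancel (@row_cons d) (@row_uncons d).
Proof.
move=> [a x]; rewrite /row_uncons /row_cons /= row_mxKr; congr (_, _).
transitivity (row_mx (const_mx a : 'rV_1) x ord0 (lshift d ord0)).
  by congr (row_mx _ _ _ _); exact: val_inj.
by rewrite row_mxEl mxE.
Qed.

Lemma measurable_row_cons d : measurable_fun [set: R * 'rV[R]_d] (@row_cons d).
Proof.
apply: measurable_fun_row => i.
case: (@split_ordP 1 d i) => j ->.
- rewrite [X in measurable_fun _ X](_ : _ = fst); first exact: measurable_fst.
  apply/funext => p /=.
  transitivity (row_mx (const_mx p.1 : 'rV_1) p.2 ord0 (lshift d j)) => //.
  by rewrite row_mxEl mxE.
- rewrite [X in measurable_fun _ X](_ : _ = (fun x : 'rV[R]_d => x ord0 j) \o snd).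
    by apply: measurableT_comp; [exact: measurable_coord|exact: measurable_snd].
  apply/funext => p /=.
  transitivity (row_mx (const_mx p.1 : 'rV_1) p.2 ord0 (rshift 1 j)) => //.
  by rewrite row_mxEr.
Qed.

Lemma measurable_row_uncons d : measurable_fun [set: 'rV[R]_d.+1] (@row_uncons d).
Proof.
apply/measurable_fun_pairP; split; first exact: measurable_coord.
apply: measurable_fun_row => i /=.
rewrite [X in measurable_fun _ X](_ : _ =
  (fun x : 'rV[R]_d.+1 => x ord0 (rshift 1 i))); first exact: measurable_coord.
by apply/funext => x; rewrite /= mxE.
Qed.

Section cons_measure.
Variables (d : nat) (mu : {sigma_finite_measure set 'rV[R]_d -> \bar R}).

Definition leb_prod : {measure set (measurableTypeR R * 'rV[R]_d)%type -> \bar R} :=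
  (@lebesgue_measure R \x mu)%E.

Let sigma_finite_prod : sigma_finite setT leb_prod.
Proof.
have /sigma_finiteP[F [TF ndF Foo]] := sigma_finiteT (@lebesgue_measure R).
have /sigma_finiteP[G [TG ndG Goo]] := sigma_finiteT mu.
exists (fun n => F n `*` G n).
  rewrite -setXTT TF TG predeqE => -[x y]; split.
    move=> [/= [n _ Fnx] [k _ Gky]]; exists (maxn n k) => //; split.
    - by move: x Fnx; exact/subsetPset/ndF/leq_maxl.
    - by move: y Gky; exact/subsetPset/ndG/leq_maxr.
  by move=> [n _ []/= ? ?]; split; exists n.
move=> k; have [? ?] := Foo k; have [? ?] := Goo k.
split; first exact: measurableX.
by rewrite /leb_prod/= product_measure1E// lte_mul_pinfty// ge0_fin_numE.
Qed.

Definition cons_measure : set 'rV[R]_d.+1 -> \bar R :=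
  pushforward leb_prod (@row_cons d).

Let cons_measure0 : cons_measure set0 = 0%E.
Proof. by have mf := @measurable_row_cons d; exact: measure0. Qed.

Let cons_measure_ge0 A : (0 <= cons_measure A)%E.
Proof. by have mf := @measurable_row_cons d; exact: measure_ge0. Qed.

Let cons_measure_sigma_additive : semi_sigma_additive cons_measure.
Proof. by have mf := @measurable_row_cons d; exact: measure_semi_sigma_additive. Qed.

HB.instance Definition _ := isMeasure.Build _ _ _ cons_measure
  cons_measure0 cons_measure_ge0 cons_measure_sigma_additive.

Lemma sigma_finite_cons_measure : sigma_finite setT cons_measure.
Proof.
have [F FT Ffin] := sigma_finite_prod.
exists (fun n => @row_uncons d @^-1` F n).
  by rewrite -preimage_bigcup -FT preimage_setT.
move=> n; have [mF Fn] := Ffin n; split.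
  by rewrite -[X in measurable X]setTI; exact: measurable_row_uncons.
rewrite /cons_measure /pushforward -comp_preimage.
rewrite (_ : row_uncons (d:=d) \o _ = id) ?preimage_id//.
by apply/funext => p; exact: row_consK.
Qed.

HB.instance Definition _ := Measure_isSigmaFinite.Build _ _ _ cons_measure
  sigma_finite_cons_measure.

End cons_measure.

(* d-dimensional Lebesgue measure, as an iterated product *)
Fixpoint row_lebesgue (d : nat) : {sigma_finite_measure set 'rV[R]_d -> \bar R} :=
  if d is n.+1 then cons_measure (row_lebesgue n) else dirac (0 : 'rV[R]_0).

Lemma measurable_row_box (d : nat) (B : 'I_d -> set R) :
  (forall i, measurable (B i)) ->
  measurable [set x : 'rV[R]_d | forall i, B i (x ord0 i)].
Proof.
move=> mB.
rewrite (_ : [set x | _] =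
    \bigcap_(i in [set: 'I_d]) ((fun x : 'rV[R]_d => x ord0 i) @^-1` B i)).
  apply: fin_bigcap_measurable => // i _.
  by rewrite -[X in measurable X]setTI; exact: measurable_coord.
by apply/seteqP; split=> x /= => [Bx i _|Bx i]; exact: Bx.
Qed.

Lemma row_lebesgue_box (d : nat) (B : 'I_d -> set R) :
  (forall i, measurable (B i)) ->
  row_lebesgue d [set x : 'rV[R]_d | forall i, B i (x ord0 i)] =
  (\prod_(i < d) lebesgue_measure (B i))%E.
Proof.
elim: d B => [|d IH] B mB.
  by rewrite big_ord0 /= diracE mem_set//= => -[].
rewrite big_ord_recl -IH//= /cons_measure /pushforward -product_measure1E//.
  congr (product_measure1 _ _ _); apply/seteqP; split=> [[a x]|[a x]] /=.
    move=> Bax; split => [|i]/=.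
      by have := Bax ord0; rewrite -[X in B _ X]/((row_uncons (row_cons (a, x))).1) row_consK.
    have := Bax (lift ord0 i).
    rewrite (_ : row_cons _ _ _ = x ord0 i)//.
    transitivity (row_mx (const_mx a : 'rV_1) x ord0 (rshift 1 i)).
      by congr (row_mx _ _ _ _); exact: val_inj.
    by rewrite row_mxEr.
  move=> [/= Ba Bx] i.
  case: (@split_ordP 1 d i) => j ->.
    rewrite (_ : row_cons _ _ _ = a).
      rewrite (_ : lshift d j = ord0)//; apply: val_inj => /=.
      by rewrite [j]ord1.
    transitivity (row_mx (const_mx a : 'rV_1) x ord0 (lshift d j)) => //.
    by rewrite row_mxEl mxE.
  rewrite (_ : row_cons _ _ _ = x ord0 j).
    by rewrite (_ : rshift 1 j = lift ord0 j)//; exact: val_inj.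
  transitivity (row_mx (const_mx a : 'rV_1) x ord0 (rshift 1 j)) => //.
  by rewrite row_mxEr.
  exact: mB.
by apply: (@measurable_row_box d (fun i => B (lift ord0 i))) => i; exact: mB.
Qed.
End row_measure.

Section domains.
Context {R : realType} {d : nat}.
Local Notation Rd := 'rV[R]_d.
Implicit Types (D : set Rd) (g phi psi : Rd -> R) (x y z e : Rd).

Definition dot x y : R := \sum_(i < d) x ord0 i * y ord0 i.

(* Near z, D is the strict epigraph, in the direction of the unit vector e, of
   a Lipschitz function on the hyperplane orthogonal to e. Here gamma is defined
   on all of R^d but is evaluated only on that hyperplane; this loses nothing,
   as Lipschitz functions on the hyperplane extend to R^d. *)
Definition lipschitz_boundary_at D z : Prop :=
  exists (e : Rd) (gamma : Rd -> R),
    [/\ dot e e = 1,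
        exists k : R, forall x y, `|gamma x - gamma y| <= k * `|x - y| &
        \forall y \near z, D y <-> gamma (y - dot y e *: e) < dot y e].

Definition bounded_lipschitz_domain D : Prop :=
  [/\ D !=set0, open D, connected D, bounded_set D &
      forall z, (closure D `\` interior D) z -> lipschitz_boundary_at D z].

(* C_0(D) for D bounded and open. An element is represented by its extension by
   zero to R^d, which is continuous on R^d exactly when the given function is
   continuous on D and vanishes at the boundary. *)
Definition C0 D : set (Rd -> R) :=
  [set phi : Rd -> R | continuous phi /\ forall x, ~ D x -> phi x = 0].

Definition partial (i : 'I_d) g : Rd -> R := 'D_(delta_mx ord0 i : Rd) g.

Definition C2_on D g : Prop := forall x, D x ->
  [/\ {for x, continuous g},
      forall i, derivable g x (delta_mx ord0 i) /\ {for x, continuous (partial i g)} &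
      forall i j, derivable (partial i g) x (delta_mx ord0 j) /\
                  {for x, continuous (partial j (partial i g))}].

Definition laplacian g x : R := \sum_(i < d) partial i (partial i g) x.

Definition L2 D : set (Rd -> R) :=
  [set g : Rd -> R | measurable_fun D g /\
           (\int[row_lebesgue d]_(x in D) ((g x) ^+ 2)%:E < +oo)%E].

Definition dotL2 D g psi : R := \int[row_lebesgue d]_(x in D) (g x * psi x).

Definition orthonormal_basis D (f : nat -> Rd -> R) : Prop :=
  [/\ forall n, L2 D (f n),
      forall m n, dotL2 D (f m) (f n) = (m == n)%:R &
      forall g, L2 D g ->
        (\int[row_lebesgue d]_(x in D)
           ((g x - \sum_(n < N) dotL2 D g (f n) * f n x) ^+ 2)%:E)%E
        @[N --> \oo] --> 0%E].

(* lam n and f n are the (n+1)-st eigenvalue and eigenfunction of the Dirichlet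
   Laplacian. Since f is a basis, lam lists all the eigenvalues, each as often
   as its multiplicity. *)
Definition dirichlet_eigensystem D (lam : nat -> R) (f : nat -> Rd -> R) : Prop :=
  [/\ 0 < lam 0%N /\ lam 0%N < lam 1%N,
      forall n, (0 < n)%N -> lam n <= lam n.+1,
      orthonormal_basis D f &
      forall n, [/\ C2_on D (f n), C0 D (f n) &
                    forall x, D x -> - laplacian (f n) x = lam n * f n x]].

End domains.

Section noise.
Context {R : realType} {d : nat}.
Local Notation Rd := 'rV[R]_d.
Variables (D : set Rd) (lam : nat -> R) (f : nat -> Rd -> R).

Definition heat_kernel (t : R) (x y : Rd) : R :=
  limn [series expR (- lam n * t) * f n x * f n y]_n.

Definition S_space : set (Rd -> R) :=
  [set phi : Rd -> R | C0 D phi /\ forall k : nat,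
     (n.+1%:R ^+ k * `|dotL2 D phi (f n)|) @[n --> \oo] --> (0 : R)].

Definition dotH (alpha : R) (phi psi : Rd -> R) : R :=
  limn [series lam n `^ (- alpha) * dotL2 D phi (f n) * dotL2 D psi (f n)]_n.

(* (H, iota) is a completion of S_space for the norm of dotH alpha: a Banach space
   in which iota embeds S_space linearly, isometrically and densely. Such a pair
   exists and is unique up to isometry; the polarization identity carries
   dotH alpha to H. *)
Definition is_completion (alpha : R) (H : completeNormedModType R)
    (iota : (Rd -> R) -> H) : Prop :=
  [/\ forall (a : R) phi psi, S_space phi -> S_space psi ->
        iota (fun x => a * phi x + psi x) = a *: iota phi + iota psi,
      forall phi, S_space phi -> `|iota phi| = Num.sqrt (dotH alpha phi phi) &
      closure (iota @` S_space) = setT].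

Definition p_kernel (t : R) (x : Rd) (s : R) (y : Rd) : R :=
  heat_kernel (t - s) x y * \1_(`]0, t[) s.

End noise.

(* Borel measurability; for a separable H, such as the completion above, this is
   Bochner measurability. *)
Definition L2_halfline {R : realType} (H : completeNormedModType R) : set (R -> H) :=
  [set h : R -> H | measurable_fun (`]0, +oo[ : set R) (h : R -> g_sigma_algebraType (@open H)) /\
           (\int[lebesgue_measure]_(s in `]0%R, +oo[) (`|h s| ^+ 2)%:E < +oo)%E].

(* the H^alpha(D)-valued function s |-> p_{t,x}(s, .) belongs to H_alpha(D) *)
Definition p_in_Halpha {R : realType} {d : nat} (D : set 'rV[R]_d)
    (lam : nat -> R) (f : nat -> 'rV[R]_d -> R)
    (H : completeNormedModType R) (iota : ('rV[R]_d -> R) -> H)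
    (t : R) (x : 'rV[R]_d) : Prop :=
  (forall s, 0 < s -> S_space D f (p_kernel lam f t x s)) /\
  L2_halfline (fun s => iota (p_kernel lam f t x s)).

(* Main.v *)
Require Import Defs.
From mathcomp Require Import all_boot all_order all_algebra.
From mathcomp Require Import all_classical all_reals all_analysis.
From mathcomp Require Import measurable_realfun ring lra.

(** Writing out the norm of H^alpha and integrating in time, p_{t,x} belongs to
    H_alpha(D) iff S(x) = sum_n lam_n^-(1+alpha) f_n(x)^2 is finite.

    Upper bound.  For u = sum_n a_n e^(-lam_n t) f_n (a finite sum) and phi convex, the
    integral over D of G_{T-t}(x-y) phi(u(t,y)), with G the Gaussian kernel of R^d, does
    not increase in t; with phi close to the square this gives
    u(T,x)^2 <= C T^(-d/2) sum_n a_n^2.  The choice a_n = e^(-lam_n T) f_n(x) yields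
    sum_n e^(-2 lam_n T) f_n(x)^2 <= C T^(-d/2) uniformly in x, with C depending only
    on d.  Taking T = 1/lam_n controls the eigenvalues and the sup norms of the
    eigenfunctions polynomially, so P_t(x,.) lies in S(D), and summing over dyadic T
    bounds S(x) as soon as 1 + alpha > d/2.

    Lower bound.  Let g be a bump function of height 1 at x and width e, with
    coefficients c_n.  Green's identity and Bessel's inequality, applied to powers of
    the Laplacian of g, bound sum_n lam_n^b c_n^2 by C e^(d-2b).  For b = 1 + alpha <= d/2
    this stays bounded while c_n -> 0 as e -> 0, so 1 = sum_n c_n f_n(x) and
    Cauchy-Schwarz contradict S(x) < oo. *)

Set Implicit Arguments.
Unset Strict Implicit.
Unset Printing Implicit Defensive.
Import Order.TTheory GRing.Theory Num.Theory.
Import numFieldNormedType.Exports.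
Local Open Scope classical_set_scope.
Local Open Scope ring_scope.

(** * Lebesgue measure on open sets and cubes *)

(** The eigenfunctions are only known to be C^2 inside [D] and to vanish continuously at the
    boundary. No gradient is available up to the boundary, so Green's identity is used only when one
    factor has compact support in [D]. This dictates the convex function of the upper bound, which
    vanishes for [s <= k] so that only the compact set where [u >= k] contributes, and it dictates
    the bumps of the lower bound. The comparison runs on finite sums with estimates independent of
    the number of terms; convergence of the infinite series is then a consequence. In time, the
    integral of e^(-2 lam_n (t-s)) over (0,t) is (1 - e^(-2 lam_n t)) / (2 lam_n), which lies
    between two positive multiples of 1 / lam_n because lam_n >= lam_0 > 0: this is the extra 1 in 1
    + alpha. At the critical exponent the weighted norm of the bumps is bounded but need not tend to
    0, so the tail of S(x) has to be made small first, and only then the width e. *)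

Section row_measurability.
Context {R : realType} {d : nat}.
Local Notation Rd := 'rV[R]_d.
Implicit Types (D U : set Rd) (x y : Rd) (g : Rd -> R).

Lemma row_ballE x (e : R) : 0 < e ->
  ball x e = [set y : Rd | forall i, ball (x ord0 i) e (y ord0 i)].
Proof.
move=> e0; apply/seteqP; split => [y [_ xy] i|y xy]; first exact: xy.
by split => // i j; rewrite (ord1 i); exact: xy.
Qed.

Lemma measurable_row_ball x (e : R) : measurable (ball x e).
Proof.
have [e0|e0] := ltP 0 e; last first.
  by rewrite (_ : ball x e = set0)// -subset0 => y [] /lt_geF; rewrite e0.
rewrite row_ballE//; apply: (@measurable_row_box R d (fun i => ball (x ord0 i) e)) => i.
by apply: open_measurable; exact: ball_open.
Qed.

(** Balls of the sup norm are boxes, hence measurable for the sigma-algebra of the coordinates, and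
    [U] is the countable union of the balls inside it with rational centre and radius
    [1 / (n + 1)]. *)
Lemma open_row_measurable U : open U -> measurable U.
Proof.
move=> oU.
pose B (q : 'rV[rat]_d * nat) : set Rd :=
  let b := ball (map_mx ratr q.1 : Rd) (q.2.+1%:R^-1 : R) in
  if `[< b `<=` U >] then b else set0.
rewrite (_ : U = \bigcup_q B q).
  apply: countable_bigcupT_measurable => [|q]; first exact: countableP.
  by rewrite /B; case: asboolP => _ //; exact: measurable_row_ball.
apply/seteqP; split => [x Ux|x [q _]]; last first.
  by rewrite /B; case: asboolP => // + bx; exact.
have /nbhs_ballP[e /= e0 xeU] : nbhs x U by exact: open_nbhs_nbhs.
have [n ne] : exists n : nat, (n.+1%:R^-1 : R) < e / 2.
  have e20 : 0 < e / 2 by rewrite divr_gt0.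
  have [n _ nP] := near_infty_natSinv_lt (PosNum e20).
  by exists n; exact: (nP n (leqnn n)).
have /choice[q qx] : forall i, exists q : rat, `|x ord0 i - ratr q| < n.+1%:R^-1.
  move=> i.
  have : x ord0 i - n.+1%:R^-1 < x ord0 i by rewrite ltrBlDr ltrDl invr_gt0.
  move=> /rat_in_itvoo[q]; rewrite in_itv/= => /andP[q1 q2]; exists q.
  by rewrite gtr0_norm ?subr_gt0// ltrBlDr -ltrBlDl.
exists (\row_i q i, n) => //; rewrite /B/=.
set b := ball _ _.
have bx : b x.
  by rewrite /b row_ballE// => i /=; rewrite !mxE -ball_normE/= distrC; exact: qx.
case: asboolP => // bU; exfalso; apply: bU => y yb; apply: xeU.
have : ball x (n.+1%:R^-1 + n.+1%:R^-1) y by apply: ball_triangle yb; exact: ball_sym.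
by apply: le_ball; rewrite ltW// [ltRHS]splitr ltrD.
Qed.

Lemma continuous_row_measurable g D : open D ->
  (forall x, D x -> {for x, continuous g}) -> measurable_fun D g.
Proof.
move=> oD cg; apply: (measurability _ (RGenOInfty.measurableE R)) => _ [_ [a ->] <-].
apply: open_row_measurable.
rewrite openE => x /= [Dx gx]; near=> y; split; near: y.
  exact: open_nbhs_nbhs.
by apply: (cg x Dx); apply: open_nbhs_nbhs; split => //; exact: itv_open.
Unshelve. all: by end_near. Qed.

Lemma row_norm_le x (r : R) : 0 <= r ->
  (`|x| <= r) <-> (forall i, `|x ord0 i| <= r).
Proof.
move=> r0; rewrite [`|x|]mx_normrE; split=> [xr i|xr].
  by apply: le_trans xr; apply: (le_bigmax _ (fun ij => `|x ij.1 ij.2|) (ord0, i)).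
by apply: bigmax_le => //= -[i j] _ /=; rewrite (ord1 i).
Qed.

(** The norm of ['rV[R]_d] is the sup norm, so this closed ball is a product of intervals and its
    Lebesgue measure is explicit. *)
Definition cube x (r : R) : set Rd := [set y | `|y - x| <= r].

Lemma cubeE x (r : R) : 0 <= r ->
  cube x r = [set y : Rd | forall i, `[x ord0 i - r, x ord0 i + r]%classic (y ord0 i)].
Proof.
move=> r0; apply/seteqP; split => y /=.
  move=> /row_norm_le-/(_ r0) + i => /(_ i).
  by rewrite !mxE /= in_itv/= ler_distl.
move=> yr; apply/row_norm_le => // i; have := yr i.
by rewrite !mxE /= in_itv/= ler_distl.
Qed.

Lemma measurable_cube x (r : R) : 0 <= r -> measurable (cube x r).
Proof.
move=> r0; rewrite cubeE//.
exact: (@measurable_row_box R d (fun i => `[x ord0 i - r, x ord0 i + r]%classic)).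
Qed.

Lemma row_lebesgue_cube x (r : R) : 0 <= r ->
  row_lebesgue d (cube x r) = ((2 * r) ^+ d)%:E.
Proof.
move=> r0; rewrite cubeE//.
rewrite (@row_lebesgue_box R d (fun i => `[x ord0 i - r, x ord0 i + r]%classic))//.
transitivity (\prod_(i < d) (2 * r)%:E)%E.
  apply: eq_bigr => i _; rewrite lebesgue_measure_itv/= lte_fin.
  case: ifPn => [_|]; first by rewrite -EFinB; congr EFin; ring.
  rewrite -leNgt => h; congr EFin; lra.
by rewrite prodEFin prodr_const card_ord.
Qed.

Lemma bounded_row_set D : bounded_set D ->
  exists2 M : R, 0 < M & forall x, D x -> `|x| <= M.
Proof.
move=> [M [_ DM]]; exists (`|M| + 1); first by rewrite ltr_wpDl.
by move=> x Dx; apply: DM => //; rewrite (le_lt_trans (ler_norm M))// ltrDl.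
Qed.

Lemma bounded_row_lebesgue_lty D : measurable D -> bounded_set D ->
  (row_lebesgue d D < +oo)%E.
Proof.
move=> mD /bounded_row_set[M M0 DM].
apply: (@le_lt_trans _ _ (row_lebesgue d (cube 0 M))); last first.
  by rewrite row_lebesgue_cube ?ltW// ltry.
apply: le_measure; rewrite ?inE//; first by apply: measurable_cube; rewrite ltW.
by move=> x /DM; rewrite /cube/= subr0.
Qed.

Lemma open_cube_sub U x : open U -> U x ->
  exists2 r : R, 0 < r & cube x r `<=` U.
Proof.
move=> oU Ux; have /nbhs_ballP[e /= e0 xeU] : nbhs x U by exact: open_nbhs_nbhs.
exists (e / 2); first by rewrite divr_gt0.
move=> y yx; apply: xeU; rewrite -ball_normE/= distrC.
by apply: le_lt_trans yx _; rewrite ltr_pdivrMr// mulr2n mulrDr mulr1 ltrDl.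
Qed.

Lemma bounded_integrable_row D g (M : R) : measurable D -> bounded_set D ->
  measurable_fun D g -> (forall x, D x -> `|g x| <= M) ->
  (row_lebesgue d).-integrable D (EFin \o g).
Proof.
move=> mD bD mg gM; apply: measurable_bounded_integrable => //.
  exact: bounded_row_lebesgue_lty.
by exists M; split=> [|r Mr x Dx]; [exact: num_real|exact: le_trans (gM x Dx) (ltW Mr)].
Qed.

Lemma bounded_support_continuous_bounded g (M : R) : continuous g ->
  (forall x : Rd, M < `|x| -> g x = 0) -> exists C : R, forall x, `|g x| <= C.
Proof.
move=> cg gM.
have cK : compact (cube 0 `|M|).
  apply: bounded_closed_compact.
    exists `|M|; split; first exact: num_real.
    by move=> r Mr x; rewrite /cube/= subr0 => xM; rewrite (le_trans xM)// ltW.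
  rewrite (_ : cube 0 `|M| = (fun x : Rd => `|x|) @^-1` [set r | r <= `|M|]).
    by apply: closed_comp => [x _|]; [exact: norm_continuous|exact: closed_le].
  by apply/seteqP; split=> x; rewrite /cube/= subr0.
have [||c _ cmax] := @EVT_max_rV R d (fun x => `|g x|) _ _ cK.
- by exists 0; rewrite /cube/= subr0 normr0.
- by apply: continuous_subspaceT => x; apply: continuous_comp; [exact: cg|exact: norm_continuous].
exists `|g c| => x; have [xM|xM] := leP `|x| `|M|.
  by apply: cmax; rewrite inE /cube/= subr0.
by rewrite gM ?normr0// (le_lt_trans (ler_norm M)).
Qed.

End row_measurability.

(** * Integrals of partial derivatives *)

Section row_cons_calculus.
Context {R : realType}.
Implicit Types (d : nat) (t s : R).

Lemma row_consE0 d t (x : 'rV[R]_d) : row_cons (t, x) ord0 ord0 = t.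
Proof. exact: (congr1 fst (row_consK (t, x))). Qed.

Lemma row_consES d t (x : 'rV[R]_d) j : row_cons (t, x) ord0 (lift ord0 j) = x ord0 j.
Proof.
have := congr1 snd (row_consK (t, x)) => /= /(congr1 (fun y : 'rV_d => y ord0 j)).
by rewrite mxE => <-; congr (row_cons _ _ _); exact: val_inj.
Qed.

Lemma row_cons_eq d (y z : 'rV[R]_d.+1) : y ord0 ord0 = z ord0 ord0 ->
  (forall j, y ord0 (lift ord0 j) = z ord0 (lift ord0 j)) -> y = z.
Proof.
move=> yz0 yzS; apply/rowP => i.
by case: (unliftP ord0 i) => [j ->|->]; [exact: yzS|exact: yz0].
Qed.

Lemma row_cons_shift_head d s t (x : 'rV[R]_d) :
  s *: delta_mx ord0 ord0 + row_cons (t, x) = row_cons (s + t, x).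
Proof.
apply: row_cons_eq => [|j]; first by rewrite mxE !row_consE0 !mxE mulr1.
rewrite mxE !row_consES !mxE [lift _ _ == _]eq_sym (negbTE (neq_lift _ _)) andbF mulr0.
by rewrite add0r.
Qed.

Lemma row_cons_shift_tail d s t (x : 'rV[R]_d) j :
  s *: delta_mx ord0 (lift ord0 j) + row_cons (t, x) =
  row_cons (t, s *: delta_mx ord0 j + x).
Proof.
apply: row_cons_eq => [|k].
  by rewrite mxE !row_consE0 !mxE (negbTE (neq_lift _ _)) andbF mulr0 add0r.
by rewrite mxE !row_consES !mxE (inj_eq lift_inj).
Qed.

Lemma norm_row_cons_ge d t (x : 'rV[R]_d) :
  `|t| <= `|row_cons (t, x)| /\ `|x| <= `|row_cons (t, x)|.
Proof.
have /(row_norm_le _ (normr_ge0 _)) H := lexx `|row_cons (t, x)|.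
split; first by have := H ord0; rewrite row_consE0.
by apply/row_norm_le => // j; have := H (lift ord0 j); rewrite row_consES.
Qed.

Lemma continuous_row_cons_head d (x : 'rV[R]_d) :
  continuous (fun t : R => row_cons (t, x)).
Proof.
rewrite (_ : (fun _ => _) = (fun t : R => t *: delta_mx ord0 ord0 + row_cons (0, x))).
  by move=> t; apply: cvgD; [apply: cvgZl; exact: cvg_id|exact: cvg_cst].
by apply/funext => t; rewrite row_cons_shift_head addr0.
Qed.

Lemma continuous_row_cons_tail d t : continuous (fun x : 'rV[R]_d => row_cons (t, x)).
Proof.
move=> x; apply/(@cvgrPdist_le _ _ _ (nbhs x)) => e e0; near=> y.
apply/row_norm_le; first exact: ltW.
have : `|x - y| <= e by near: y; apply/nbhs_ballP; exists e => //= y; rewrite -ball_normE => /ltW.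
move=> /(row_norm_le _ (ltW e0)) xy i; case: (unliftP ord0 i) => [j ->|->].
  by have := xy j; rewrite !mxE -(row_consES t) -(row_consES t y) !mxE.
by rewrite mxE [X in _ + X]mxE !row_consE0 subrr normr0 ltW.
Unshelve. all: by end_near. Qed.

(** Stated on difference quotients, so that one rewriting transfers both derivability and the value
    of the derivative to the slice. *)
Lemma growth_row_cons_head d (h : 'rV[R]_d.+1 -> R) (x : 'rV[R]_d) t :
  (fun s => s^-1 *: (h (row_cons (s *: 1 + t, x)) - h (row_cons (t, x)))) =
  (fun s => s^-1 *: (h (s *: delta_mx ord0 ord0 + row_cons (t, x)) - h (row_cons (t, x)))).
Proof. by apply/funext => s; rewrite row_cons_shift_head [s *: 1]mulr1. Qed.

Lemma growth_row_cons_tail d (h : 'rV[R]_d.+1 -> R) (x : 'rV[R]_d) t j :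
  (fun s => s^-1 *: (h (row_cons (t, s *: delta_mx ord0 j + x)) - h (row_cons (t, x)))) =
  (fun s => s^-1 *: (h (s *: delta_mx ord0 (lift ord0 j) + row_cons (t, x)) - h (row_cons (t,
    x)))).
Proof. by apply/funext => s; rewrite row_cons_shift_tail. Qed.

Lemma partial_row_cons_tail d (h : 'rV[R]_d.+1 -> R) t j :
  partial j (fun x => h (row_cons (t, x))) =
  (fun x => partial (lift ord0 j) h (row_cons (t, x))).
Proof.
by apply/funext => x; rewrite /partial/derive -growth_row_cons_tail.
Qed.

Lemma vanish_partial d (h : 'rV[R]_d -> R) i (M : R) :
  (forall x : 'rV[R]_d, M < `|x| -> h x = 0) ->
  forall x : 'rV[R]_d, M < `|x| -> partial i h x = 0.
Proof.
move=> hM x Mx; rewrite /partial (@near_eq_derive _ _ _ _ (cst 0)) ?derive_cst//.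
near=> y; apply: hM; near: y.
exact: (cvgr_gt _ (@norm_continuous _ _ x) _ Mx).
Unshelve. all: by end_near. Qed.

Lemma bounded_support_integrable d (g : 'rV[R]_d -> R) (M C : R) :
  measurable_fun setT g -> (forall x, `|g x| <= C) ->
  (forall x : 'rV[R]_d, M < `|x| -> g x = 0) ->
  (row_lebesgue d).-integrable setT (EFin \o g).
Proof.
move=> mg gC gM; have M0 : 0 <= `|M| by [].
rewrite (_ : EFin \o g = (EFin \o g) \_ (cube 0 `|M|)).
  rewrite -integrable_mkcond; last exact: measurable_cube.
  apply: (@bounded_integrable_row _ _ _ _ C) => //; first exact: measurable_cube.
  - exists `|M|; split; first exact: num_real.
    by move=> r Mr x; rewrite /cube/= subr0 => /le_trans; apply; exact: ltW.
  - exact: measurable_funTS.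
apply/funext => x; rewrite patchE; case: ifPn => //.
rewrite notin_setE /cube/= subr0 => /negP; rewrite -ltNge => Mx.
by rewrite gM// (le_lt_trans (ler_norm M)).
Qed.

Lemma row_lebesgueS_integrable d (g : 'rV[R]_d.+1 -> R) :
  (row_lebesgue d.+1).-integrable setT (EFin \o g) ->
  (lebesgue_measure \x row_lebesgue d)%E.-integrable setT (EFin \o (g \o @row_cons R d)).
Proof.
move=> /integrableP[/measurable_EFinP mg gfin]; apply/integrableP.
have mc := @measurable_row_cons R d.
split; first by apply/measurable_EFinP; exact: measurableT_comp.
apply: le_lt_trans gfin.
have := @ge0_integral_pushforward _ _ (measurableTypeR R * 'rV[R]_d)%type _ R (@row_cons R d) mc
  (leb_prod (row_lebesgue d)) setT (fun x => `|(g x)%:E|)%E measurableT.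
rewrite preimage_setT => <- //=.
by apply/measurable_EFinP; exact: measurableT_comp.
Qed.

Lemma integral_row_lebesgueS d (g : 'rV[R]_d.+1 -> R) :
  (row_lebesgue d.+1).-integrable setT (EFin \o g) ->
  (\int[row_lebesgue d.+1]_x (g x)%:E =
   \int[lebesgue_measure \x row_lebesgue d]_z (g (row_cons z))%:E)%E.
Proof.
move=> ig; have mc := @measurable_row_cons R d.
have := @integral_pushforward _ _ (measurableTypeR R * 'rV[R]_d)%type _ R (@row_cons R d) mc
  (leb_prod (row_lebesgue d)) setT (EFin \o g).
rewrite preimage_setT => <- //=.
- exact: measurable_int ig.
- exact: row_lebesgueS_integrable.
Qed.

Lemma integral_derive_bounded_support (h : R -> R) (M : R) :
  (forall t, derivable h t 1) -> continuous (h^`())%classic ->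
  (forall t : R, M < `|t| -> h t = 0) ->
  (\int[lebesgue_measure]_t ((h^`())%classic t)%:E = 0)%E.
Proof.
move=> dh ch hM.
have hc : continuous h.
  by move=> t; apply/differentiable_continuous/derivable1_diffP.
pose N : R := `|M| + 1.
have N0 : 0 < N by rewrite ltr_wpDl.
have MN : M < N by rewrite (le_lt_trans (ler_norm M))// ltrDl.
have h'M (t : R) : M < `|t| -> h^`()%classic t = 0.
  move=> Mt; rewrite derive1E (@near_eq_derive _ _ _ _ (cst 0)) ?derive_cst//.
  near=> y; apply: hM; near: y.
  by exact: (cvgr_gt _ (@norm_continuous _ _ t) _ Mt).
transitivity (\int[lebesgue_measure]_(t in `[(- N)%R, N]) ((h^`())%classic t)%:E)%E.
  rewrite [RHS]integral_mkcond; apply: eq_integral => t _.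
  rewrite patchE; case: ifPn => //; rewrite notin_setE/= in_itv/= => /negP.
  by rewrite -ler_norml -ltNge => Nt; rewrite h'M// (lt_trans MN).
rewrite (@continuous_FTC2 _ _ h).
- by rewrite !hM ?normrN ?gtr0_norm// -EFinB subrr.
- by lra.
- exact: continuous_subspaceT.
- split => [t _||]; [exact: dh|apply: cvg_at_right_filter; exact: hc|apply: cvg_at_left_filter;
  exact: hc].
Unshelve. all: by end_near. Qed.

(** Induction on the dimension by Fubini. If [i] is the first axis, the inner integral runs along it
    and vanishes by the fundamental theorem of calculus; otherwise the first coordinate is frozen
    and the induction hypothesis applies to the slice. *)
Lemma integral_partial_eq0 d (i : 'I_d) (h : 'rV[R]_d -> R) (M C : R) :
  (forall x, derivable h x (delta_mx ord0 i)) ->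
  continuous (partial i h) -> (forall x, `|partial i h x| <= C) ->
  (forall x : 'rV[R]_d, M < `|x| -> h x = 0) ->
  (\int[row_lebesgue d]_x (partial i h x)%:E = 0)%E.
Proof.
elim: d i h => [[]//|d IH] i h dh ch hC hM.
have ih : (row_lebesgue d.+1).-integrable setT (EFin \o partial i h).
  apply: (@bounded_support_integrable _ _ M C) => //; last exact: vanish_partial.
  by apply: (continuous_row_measurable openT) => x _; exact: ch.
rewrite integral_row_lebesgueS//.
have {}ih := row_lebesgueS_integrable ih.
case: (unliftP ord0 i) => [j ij|i0].
  rewrite -(integral12_prod_meas1 ih); apply: integral0_eq => t _.
  rewrite /fubini_F /= -[RHS](IH j (fun x => h (row_cons (t, x)))).
  - by apply: eq_integral => x _; rewrite partial_row_cons_tail -ij.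
  - by move=> x; have := dh (row_cons (t, x)); rewrite /derivable ij growth_row_cons_tail.
  - rewrite partial_row_cons_tail -ij => x.
    by apply: continuous_comp; [exact: continuous_row_cons_tail|exact: ch].
  - by move=> x; rewrite partial_row_cons_tail -ij.
  - by move=> x Mx; apply: hM; rewrite (lt_le_trans Mx)// (norm_row_cons_ge t x).2.
rewrite -(integral21_prod_meas1 ih); apply: integral0_eq => x _.
rewrite /fubini_G /=.
have E t : (fun t => h (row_cons (t, x)))^`()%classic t = partial i h (row_cons (t, x)).
  by rewrite derive1E /partial/derive i0 -growth_row_cons_head.
under eq_integral do rewrite -E.
apply: (@integral_derive_bounded_support _ M).
- by move=> t; have := dh (row_cons (t, x)); rewrite /derivable i0 -growth_row_cons_head.
- rewrite (_ : _^`()%classic = (fun t => partial i h (row_cons (t, x)))); last exact/funext.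
  by move=> t; apply: continuous_comp; [exact: continuous_row_cons_head|exact: ch].
- by move=> t Mt; apply: hM; rewrite (lt_le_trans Mt)// (norm_row_cons_ge t x).1.
Qed.

End row_cons_calculus.

(** * Directional derivatives and Green's identity *)

Section directional_calculus.
Context {R : realType} {d : nat}.
Local Notation Rd := 'rV[R]_d.
Implicit Types (D K : set Rd) (x y : Rd).
Local Notation "''e_' i" := (delta_mx ord0 i : Rd) (at level 8, i at level 2).

(** Reduces directional derivatives to one variable, where the chain rule is at hand. *)
Lemma is_derive_slice (g : Rd -> R) x v (dg : R) :
  is_derive x v g dg <-> is_derive (0 : R) 1 (fun h : R => g (h *: v + x)) dg.
Proof.
have E : (fun h : R => h^-1 *: (g ((h *: 1 + 0) *: v + x) - g (0 *: v + x))) =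
         (fun h => h^-1 *: (g (h *: v + x) - g x)).
  by apply/funext => h; rewrite addr0 scale0r add0r [h *: 1]mulr1.
by split=> -[g1 g2]; split; move: g1 g2; rewrite /derivable /derive ?E.
Qed.

Lemma is_derive_comp (phi : R -> R) (u : Rd -> R) x v (du dphi : R) :
  is_derive x v u du -> is_derive (u x) 1 phi dphi ->
  is_derive x v (phi \o u) (dphi * du).
Proof.
move=> /is_derive_slice xu ph; apply/is_derive_slice.
apply: (@is_derive1_comp R phi (fun h => u (h *: v + x))).
by rewrite scale0r add0r.
Qed.

(** In contrast with [C2_on], the derivatives are given as data, so that sums and compositions carry
    explicit formulas from which a Laplacian can be read off. *)
Definition is_C2 D (g : Rd -> R) (g1 : 'I_d -> Rd -> R) (g2 : 'I_d -> 'I_d -> Rd -> R) : Prop :=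
  forall x, D x -> [/\ {for x, continuous g},
    forall i, is_derive x 'e_i g (g1 i x) /\ {for x, continuous (g1 i)} &
    forall i j, is_derive x 'e_j (g1 i) (g2 i j x) /\ {for x, continuous (g2 i j)}].

Lemma C2_on_is_C2 D g : C2_on D g ->
  is_C2 D g (fun i => partial i g) (fun i j => partial j (partial i g)).
Proof.
move=> gD x Dx; have [cg g1 g2] := gD x Dx; split => // [i|i j].
  by have [? ?] := g1 i; split => //; exact: derivableP.
by have [? ?] := g2 i j; split => //; exact: derivableP.
Qed.

Lemma is_C2_eq D g (g1 g1' : 'I_d -> Rd -> R) (g2 g2' : 'I_d -> 'I_d -> Rd -> R) :
  (forall i, g1 i =1 g1' i) ->
  (forall i j, g2 i j =1 g2' i j) -> is_C2 D g g1 g2 -> is_C2 D g g1' g2'.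
Proof.
move=> e1 e2.
have -> : g1' = g1 by apply/funext => i; apply/funext => x; rewrite e1.
by have -> : g2' = g2 by apply/funext => i; apply/funext => j; apply/funext => x; rewrite e2.
Qed.

Lemma is_C2_near_partial D g g1 g2 i x : open D -> is_C2 D g g1 g2 -> D x ->
  \forall y \near x, g1 i y = partial i g y.
Proof.
move=> oD gD Dx; near=> y; have Dy : D y by near: y; exact: open_nbhs_nbhs.
have [_ /(_ i)[? _] _] := gD y Dy.
by rewrite /partial derive_val.
Unshelve. all: by end_near. Qed.

(** [partial i g] is known to agree with [g1 i] only on [D]; since [D] is open they agree near [x],
    which is enough to differentiate once more. *)
Lemma is_C2_partial2 D g g1 g2 i j x : open D -> is_C2 D g g1 g2 -> D x ->
  partial j (partial i g) x = g2 i j x.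
Proof.
move=> oD gD Dx; have [_ _ /(_ i j)[? _]] := gD x Dx.
rewrite /partial -(@near_eq_derive _ _ _ (g1 i)) ?derive_val//.
exact: is_C2_near_partial gD Dx.
Qed.

Lemma is_C2_laplacian D g g1 g2 x : open D -> is_C2 D g g1 g2 -> D x ->
  laplacian g x = \sum_(i < d) g2 i i x.
Proof. by move=> oD gD Dx; apply: eq_bigr => i _; rewrite (is_C2_partial2 _ _ oD gD). Qed.

Lemma near_eq_continuous (g u : Rd -> R) x : (\forall y \near x, g y = u y) ->
  {for x, continuous g} -> {for x, continuous u}.
Proof.
move=> gu cg; rewrite /prop_for /continuous_at -(nbhs_singleton gu).
exact: cvg_trans (near_eq_cvg gu) cg.
Qed.

Lemma is_C2_C2_on D g g1 g2 : open D -> is_C2 D g g1 g2 -> C2_on D g.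
Proof.
move=> oD gD x Dx; have [cg dg ddg] := gD x Dx.
have n1 i := is_C2_near_partial i oD gD Dx.
split => // [i|i j].
  by split; [have [[]] := dg i|apply: near_eq_continuous (n1 i) _; have [] := dg i].
split.
  by apply: near_eq_derivable (n1 i) _; have [[]] := ddg i j.
apply: (@near_eq_continuous (g2 i j)); last by have [] := ddg i j.
near=> y; rewrite (is_C2_partial2 i j oD gD)//.
by near: y; exact: open_nbhs_nbhs.
Unshelve. all: by end_near. Qed.

Lemma is_C2_cst D (c : R) : is_C2 D (cst c) (fun _ => cst 0) (fun _ _ => cst 0).
Proof.
move=> x Dx; split=> [|i|i j]; first exact: cst_continuous.
  by split; [exact: is_derive_cst|exact: cst_continuous].
by split; [exact: is_derive_cst|exact: cst_continuous].
Qed.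

Lemma is_C2_lin D (c : R) g g1 g2 u u1 u2 : is_C2 D g g1 g2 -> is_C2 D u u1 u2 ->
  is_C2 D (fun x => c * g x + u x) (fun i x => c * g1 i x + u1 i x)
    (fun i j x => c * g2 i j x + u2 i j x).
Proof.
move=> gD uD x Dx; have [cg dg ddg] := gD x Dx; have [cu du ddu] := uD x Dx.
have C (a b : Rd -> R) : {for x, continuous a} -> {for x, continuous b} ->
    {for x, continuous (fun x => c * a x + b x)}.
  move=> ca cb; apply: (@continuousD _ _ _ (fun y => c * a y) b) => //.
  by apply: (@continuousM _ _ (cst c) a) => //; exact: cst_continuous.
have P v (a b : Rd -> R) da db : is_derive x v a da -> is_derive x v b db ->
    is_derive x v (fun x => c * a x + b x) (c * da + db).
  by move=> ? ?; apply: (@is_deriveD _ _ _ (c *: a) b).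
split=> [|i|i j]; first exact: C.
  by have [? ?] := dg i; have [? ?] := du i; split; [exact: P|exact: C].
by have [? ?] := ddg i j; have [? ?] := ddu i j; split; [exact: P|exact: C].
Qed.

Lemma is_C2_sum D (N : nat) (c : nat -> R) (f : nat -> Rd -> R)
    (f1 : nat -> 'I_d -> Rd -> R) (f2 : nat -> 'I_d -> 'I_d -> Rd -> R) :
  (forall n, is_C2 D (f n) (f1 n) (f2 n)) ->
  is_C2 D (fun x => \sum_(n < N) c n * f n x) (fun i x => \sum_(n < N) c n * f1 n i x)
    (fun i j x => \sum_(n < N) c n * f2 n i j x).
Proof.
move=> fD; elim: N => [|N IH].
  have E (F : nat -> Rd -> R) : (fun x => \sum_(n < 0) c n * F n x) = cst 0.
    by apply/funext => x; rewrite big_ord0.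
  rewrite E; apply: (is_C2_eq _ _ (@is_C2_cst D 0)) => [i x|i j x]; by rewrite big_ord0.
have E (F : nat -> Rd -> R) : (fun x => \sum_(n < N.+1) c n * F n x) =
    (fun x => c N * F N x + \sum_(n < N) c n * F n x).
  by apply/funext => x; rewrite big_ord_recr addrC.
rewrite E; apply: (is_C2_eq _ _ (is_C2_lin (c N) (fD N) IH)) => [i x|i j x];
  by rewrite big_ord_recr addrC.
Qed.

Lemma is_C2_comp D (phi phi1 phi2 : R -> R) u u1 u2 :
  (forall s : R, is_derive s 1 phi (phi1 s)) -> (forall s : R, is_derive s 1 phi1 (phi2 s)) ->
  continuous phi2 -> is_C2 D u u1 u2 ->
  is_C2 D (phi \o u) (fun i x => phi1 (u x) * u1 i x)
    (fun i j x => phi2 (u x) * u1 j x * u1 i x + phi1 (u x) * u2 i j x).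
Proof.
move=> d1 d2 c2 uD x Dx; have [cu du ddu] := uD x Dx.
have dc (f : R -> R) df : (forall s : R, is_derive s 1 f (df s)) -> continuous f.
  move=> fd s; apply/differentiable_continuous/derivable1_diffP.
  by have [] := fd s.
have c0 := dc _ _ d1; have c1 := dc _ _ d2.
have C (f : R -> R) : continuous f -> {for x, continuous (f \o u)}.
  by move=> cf; apply: continuous_comp => //; exact: cf.
split=> [|i|i j]; first exact: C.
- have [? ?] := du i; split; first exact: is_derive_comp.
  by apply: (@continuousM _ _ (phi1 \o u) (u1 i)) => //; exact: C.
- have [? ?] := du i; have [? ?] := du j; have [? ?] := ddu i j; split.
    have H := is_derive_comp (du j).1 (d2 (u x)).
    have -> : phi2 (u x) * u1 j x * u1 i x + phi1 (u x) * u2 i j x =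
      (phi1 \o u) x *: u2 i j x + u1 i x *: (phi2 (u x) * u1 j x).
      by rewrite addrC [_ *: (_ * _)]mulrC.
    exact: (@is_deriveM _ _ (phi1 \o u) (u1 i)).
  apply: (@continuousD _ _ _ (fun y => phi2 (u y) * u1 j y * u1 i y)
    (fun y => phi1 (u y) * u2 i j y)).
    apply: (@continuousM _ _ (fun y => phi2 (u y) * u1 j y) (u1 i)) => //.
    by apply: (@continuousM _ _ (phi2 \o u) (u1 j)) => //; exact: C.
  by apply: (@continuousM _ _ (phi1 \o u) (u2 i j)) => //; exact: C.
Qed.

End directional_calculus.

Lemma Rintegral_sum (R : realType) dsp (T : measurableType dsp) (mu : {measure set T -> \bar R})
    (D : set T) (I : Type) (s : seq I) (f : I -> T -> R) : measurable D ->
  (forall i, mu.-integrable D (EFin \o f i)) ->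
  \int[mu]_(x in D) (\sum_(i <- s) f i x) = \sum_(i <- s) \int[mu]_(x in D) f i x.
Proof.
move=> mD fD; rewrite /Rintegral.
under eq_integral do rewrite -sumEFin.
rewrite (@integral_sum _ _ _ mu D mD I (fun i => EFin \o f i) fD).
elim: s => [|i s IH]; first by rewrite !big_nil.
rewrite !big_cons fineD ?IH//; first exact: integrable_fin_num (fD i).
apply: (big_ind (fun x : \bar R => x \is a fin_num)) => // [x y|j _]; first by rewrite fin_numD
  => ->.
exact: integrable_fin_num (fD j).
Qed.

Section green.
Context {R : realType} {d : nat}.
Local Notation Rd := 'rV[R]_d.
Local Notation mu := (row_lebesgue d).
Implicit Types (D K : set Rd) (x y : Rd).
Local Notation "''e_' i" := (delta_mx ord0 i : Rd) (at level 8, i at level 2).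

Lemma near_vanish K (g : Rd -> R) x : closed K -> (forall x, ~ K x -> g x = 0) -> ~ K x ->
  \forall y \near x, cst 0 y = g y.
Proof.
move=> cK gK nKx; near=> y; rewrite gK//; near: y.
by apply: open_nbhs_nbhs; split => //; exact: closed_openC.
Unshelve. all: by end_near. Qed.

(** A point of [K] lies in [D], where [g] is continuous; near any other point [g] is identically
    0. *)
Lemma continuous_vanish D K (g : Rd -> R) : closed K -> K `<=` D ->
  (forall x, D x -> {for x, continuous g}) -> (forall x, ~ K x -> g x = 0) ->
  continuous g.
Proof.
move=> cK KD cg gK x; have [/KD /cg//|nKx] := pselect (K x).
by apply: near_eq_continuous (near_vanish cK gK nKx) _; exact: cst_continuous.
Qed.

Lemma continuous_vanish_integrable D K (g : Rd -> R) : open D -> bounded_set D ->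
  closed K -> K `<=` D ->
  (forall x, D x -> {for x, continuous g}) -> (forall x, ~ K x -> g x = 0) ->
  mu.-integrable setT (EFin \o g) /\ mu.-integrable D (EFin \o g).
Proof.
move=> oD bD cK KD cgD gK; have cg := continuous_vanish cK KD cgD gK.
have [M M0 DM] := bounded_row_set bD.
have gM (x : Rd) : M < `|x| -> g x = 0.
  by move=> Mx; apply: gK => /KD /DM; rewrite leNgt Mx.
have [C gC] := bounded_support_continuous_bounded cg gM.
have ig : mu.-integrable setT (EFin \o g).
  apply: bounded_support_integrable gC gM.
  by apply: (continuous_row_measurable openT) => x _; exact: cg.
by split => //; apply: integrableS ig => //; exact: open_row_measurable.
Qed.

(** The integrand is the divergence of a field supported in [K]. Only [B] has to vanish off [K],
    which lets [A] be a Gaussian or an eigenfunction. *)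
Lemma green D K (A B : Rd -> R) : open D -> bounded_set D -> closed K -> K `<=` D ->
  C2_on D A -> C2_on D B -> (forall x, ~ K x -> B x = 0) ->
  \int[mu]_(x in D) (A x * laplacian B x - laplacian A x * B x) = 0.
Proof.
move=> oD bD cK KD /C2_on_is_C2 AD /C2_on_is_C2 BD BK.
have [M M0 DM] := bounded_row_set bD.
have vK (g : Rd -> R) i : (forall x, ~ K x -> g x = 0) -> forall x, ~ K x -> partial i g x = 0.
  move=> gK x nKx.
  by rewrite /partial -(near_eq_derive _ (near_vanish cK gK nKx)) derive_cst.
(* [h i] is the i-th component of A grad B - B grad A. The cross terms cancel in its i-th derivative
   [k i], and off [K] it is locally 0, so it is differentiable on all of R^d even where [A] is
   not. *)
pose h i x := A x * partial i B x - partial i A x * B x.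
have hK i x : ~ K x -> h i x = 0.
  by move=> nKx; rewrite /h BK// (vK B)// !mulr0 subr0.
pose k i x := A x * partial i (partial i B) x - partial i (partial i A) x * B x.
have kK i x : ~ K x -> k i x = 0.
  by move=> nKx; rewrite /k BK// (vK (partial i B))// ?mulr0 ?subr0//; exact: vK.
have dh i x : is_derive x 'e_i (h i) (k i x).
  have [/KD Dx|nKx] := pselect (K x); last first.
    rewrite kK//; exact: near_eq_is_derive (near_vanish cK (hK i) nKx) _.
  have [_ A1 A2] := AD x Dx; have [_ B1 B2] := BD x Dx.
  have [dA _] := A1 i; have [ddA _] := A2 i i; have [dB _] := B1 i; have [ddB _] := B2 i i.
  have -> : k i x = (A x *: partial i (partial i B) x + partial i B x *: partial i A x) -
    (partial i A x *: partial i B x + B x *: partial i (partial i A) x).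
    by rewrite [B x *: _]mulrC [partial i B x *: _]mulrC addrKA.
  exact: (@is_deriveB _ _ _ (A * partial i B) (partial i A * B)).
have hk i : partial i (h i) = k i by apply/funext => x; rewrite /partial derive_val.
have ck i x : D x -> {for x, continuous (k i)}.
  move=> Dx; have [cA A1 A2] := AD x Dx; have [cB B1 B2] := BD x Dx.
  apply: (@continuousB _ _ _ (A * partial i (partial i B)) (partial i (partial i A) * B)).
    by have [_ c2B] := B2 i i; exact: (@continuousM _ _ A _ _ cA c2B).
  by have [_ c2A] := A2 i i; exact: (@continuousM _ _ _ B _ c2A cB).
have kI i := continuous_vanish_integrable oD bD cK KD (ck i) (kK i).
have k0 i : \int[mu]_x k i x = 0.
  have ckT := continuous_vanish cK KD (ck i) (kK i).
  have vM (g : Rd -> R) : (forall x, ~ K x -> g x = 0) -> forall x : Rd, M < `|x| -> g x = 0.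
    by move=> gK x Mx; apply: gK => /KD /DM; rewrite leNgt Mx.
  have [C kC] := bounded_support_continuous_bounded ckT (vM _ (kK i)).
  rewrite /Rintegral -hk (@integral_partial_eq0 _ _ _ _ M C)//.
  - by rewrite hk.
  - by move=> x; rewrite hk.
  - by apply: vM; exact: hK.
transitivity (\int[mu]_(x in D) \sum_(i < d) k i x).
  apply: eq_Rintegral => x _; rewrite /k sumrB -mulr_sumr -mulr_suml.
  by [].
rewrite Rintegral_sum; [|exact: open_row_measurable|by move=> i; have [] := kI i].
apply: big1 => i _; rewrite -[RHS](k0 i) Rintegral_mkcond; apply: eq_Rintegral => x _.
rewrite patchE; case: ifPn => //; rewrite notin_setE => nDx.
by rewrite kK// => /KD.
Qed.

End green.

(** * Test functions in time and space *)

Section pointwise_derivatives.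
Context {R : realType} {V : normedModType R}.
Implicit Types (x v : V) (f g : V -> R).

Lemma is_derive_mulf f g x v (df dg : R) : is_derive x v f df -> is_derive x v g dg ->
  is_derive x v (fun y => f y * g y) (f x * dg + g x * df).
Proof. exact: is_deriveM. Qed.

Lemma is_derive_powf f (n : nat) x v (df : R) : is_derive x v f df ->
  is_derive x v (fun y => f y ^+ n) (n%:R * f x ^+ n.-1 * df).
Proof.
move=> H; rewrite (_ : (fun _ => _) = f ^+ n); first exact: is_deriveX.
by apply/funext => y; rewrite exprfctE.
Qed.

End pointwise_derivatives.

(** * A truncated convex substitute for the square *)

Section positive_part.
Context {R : realType}.
Implicit Types (s t k : R).

Lemma continuous_max0 : continuous (fun s : R => Num.max s 0).
Proof.
move=> s; apply/cvgrPdist_le => e e0; near=> t.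
have : `|s - t| <= e by near: t; exact: cvgr_dist_le.
rewrite !ler_norml => /andP[h1 h2].
by case: (leP s 0) => h3; case: (leP t 0) => h4; apply/andP; split; lra.
Unshelve. all: by end_near. Qed.

(** [psi] is glued to 0 at the origin: there the quotient is that of [psi] on the right and 0 on the
    left, and both tend to [psi1 0 = 0]. *)
Lemma is_derive_max0 (psi psi1 : R -> R) :
  (forall s : R, 0 <= s -> is_derive s 1 psi (psi1 s)) -> psi 0 = 0 -> psi1 0 = 0 ->
  forall s : R, is_derive s 1 (fun s => psi (Num.max s 0)) (psi1 (Num.max s 0)).
Proof.
move=> dpsi psi0 psi10 s; have [s0|s0|->] := ltgtP s 0.
- rewrite psi10; apply: (@near_eq_is_derive _ _ _ (cst 0)).
  near=> t; rewrite max_r// ltW//; near: t; exact: lt_nbhsl.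
- have := dpsi s (ltW s0); apply: near_eq_is_derive.
  near=> t; rewrite max_l// ltW//; near: t; exact: lt_nbhsr.
have [d0 e0] := dpsi 0 (lexx _); rewrite psi10.
have H : h^-1 *: (psi (Num.max (h *: 1 + 0 : R) 0) - psi (Num.max 0 0)) @[h --> (0:R)^'] --> (0
  : R).
  apply/cvgr0Pnorm_le => e egt0.
  have /cvgr0Pnorm_le/(_ e egt0) : h^-1 *: (psi (h *: 1 + 0 : R) - psi 0) @[h --> (0:R)^'] -->
    (0 : R).
    have : h^-1 *: (psi (h *: 1 + 0 : R) - psi 0) @[h --> (0:R)^'] --> 'D_1 psi 0 by exact: d0.
    by rewrite e0 psi10.
  apply: filterS => h; rewrite maxxx psi0 !subr0 !addr0 [h *: 1]mulr1 => hh.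
  by have [h0|h0] := leP h 0; rewrite // psi0 scaler0 normr0 ltW.
split; first by apply/cvg_ex; exists 0.
exact: cvg_lim H.
Unshelve. all: by end_near. Qed.

(* A convex C^2 minorant of the square vanishing for [s <= k]. As [k] decreases
   to 0 it tends to the square of the positive part of [s]. *)
Definition cutsq k s : R := let z := Num.max (s - k) 0 in z ^+ 3 / (z + k).
(** First and second derivatives of [cutsq], read off from z^3 / (z + k) = z^2 - k z + k^2 - k^3 /
    (z + k). Both vanish at z = 0, so the truncation at [s = k] is still C^2. *)
Definition cutsq1 k s : R :=
  let z := Num.max (s - k) 0 in 2 * z - k + k ^+ 3 / (z + k) ^+ 2.
Definition cutsq2 k s : R := let z := Num.max (s - k) 0 in 2 - 2 * k ^+ 3 / (z + k) ^+ 3.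

Lemma is_derive_shiftr (f : R -> R) k s (df : R) :
  is_derive (s - k) 1 f df -> is_derive s 1 (fun s => f (s - k)) df.
Proof.
move=> H; rewrite -[df]mulr1; apply: (@is_derive1_comp R f (fun s => s - k)).
by rewrite -[X in is_derive _ _ _ X]subr0; apply: is_deriveB.
Qed.

Lemma is_derive_inv_pow k (n : nat) s : s + k != 0 ->
  is_derive s 1 (fun s => ((s + k) ^+ n)^-1) (- (n%:R * (s + k) ^- n.+1)).
Proof.
move=> sk.
have H : is_derive s 1 (fun s => (s + k) ^+ n) (n%:R * (s + k) ^+ n.-1).
  rewrite -[X in is_derive _ _ _ X]mulr1; apply: (@is_derive_powf _ _ (fun s => s + k)).
  by rewrite -[X in is_derive _ _ _ X]addr0; apply: is_deriveD.
have sn : (s + k) ^+ n != 0 by rewrite expf_neq0.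
split; first by apply: derivableV.
rewrite deriveV// derive_val [_ *: _]mulrC.
case: n {H} sn => [|n] sn; first by rewrite !mul0r oppr0.
by rewrite mulrN; congr (- _); rewrite /= !exprS; field; rewrite sk expf_neq0.
Qed.

Section cutsq_theory.
Variables (k : R) (k0 : 0 < k).

Lemma is_derive_cutsq s : is_derive s 1 (cutsq k) (cutsq1 k s).
Proof.
apply: (@is_derive_shiftr (fun s => (Num.max s 0) ^+ 3 / (Num.max s 0 + k))).
apply: (@is_derive_max0 (fun z => z ^+ 3 / (z + k))
          (fun z => 2 * z - k + k ^+ 3 / (z + k) ^+ 2)).
- move=> z z0; have zk : z + k != 0 by rewrite gt_eqF// ltr_wpDl.
  have dV := @is_derive_inv_pow k 1 z zk.
  have d3 : is_derive z 1 (fun z : R => z ^+ 3) (3 * z ^+ 2).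
    by rewrite -[X in is_derive _ _ _ X]mulr1; exact: (@is_derive_powf _ _ id).
  have H : is_derive z 1 (fun z : R => z ^+ 3 / (z + k)) _ := is_derive_mulf d3 dV.
  by apply: (is_derive_eq H); field.
- by rewrite expr0n/= mul0r.
- by rewrite mulr0 add0r add0r; field; rewrite gt_eqF.
Qed.

Lemma is_derive_cutsq1 s : is_derive s 1 (cutsq1 k) (cutsq2 k s).
Proof.
apply: (@is_derive_shiftr (fun s => 2 * Num.max s 0 - k + k ^+ 3 / (Num.max s 0 + k) ^+ 2)).
apply: (@is_derive_max0 (fun z => 2 * z - k + k ^+ 3 / (z + k) ^+ 2)
          (fun z => 2 - 2 * k ^+ 3 / (z + k) ^+ 3)).
- move=> z z0; have zk : z + k != 0 by rewrite gt_eqF// ltr_wpDl.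
  have dV := @is_derive_inv_pow k 2 z zk.
  have d1 : is_derive z 1 (fun z : R => 2 * z - k) 2.
    rewrite -[X in is_derive _ _ _ X]subr0; apply: is_deriveB.
    by rewrite -[X in is_derive _ _ _ X]mulr1; exact: (@is_deriveZ _ _ _ id).
  have H : is_derive z 1 (fun z : R => 2 * z - k + k ^+ 3 / (z + k) ^+ 2) _ :=
    is_deriveD d1 (is_deriveZ (k ^+ 3) dV).
  by apply: (is_derive_eq H); rewrite /GRing.scale/=; field.
- by rewrite mulr0 add0r add0r; field; rewrite gt_eqF.
- by rewrite add0r; field; rewrite gt_eqF.
Qed.

Lemma continuous_cutsq2 : continuous (cutsq2 k).
Proof.
move=> s; have zk : Num.max (s - k) 0 + k != 0.
  by rewrite gt_eqF// ltr_wpDl// le_max lexx orbT.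
rewrite /cutsq2 /continuous_at; apply: cvgB; first exact: cvg_cst.
apply: cvgM; first exact: cvg_cst.
apply: cvgV; first by rewrite expf_neq0.
apply: (@continuous_comp _ _ _ (fun s => Num.max (s - k) 0 + k) (fun x => x ^+ 3)); last exact:
  exprn_continuous.
apply: cvgD; last exact: cvg_cst.
apply: (@continuous_comp _ _ _ (fun s => s - k) (fun x => Num.max x 0)); last exact:
  continuous_max0.
by apply: cvgB; [exact: cvg_id|exact: cvg_cst].
Qed.

Lemma cutsq2_ge0 s : 0 <= cutsq2 k s.
Proof.
rewrite /cutsq2 subr_ge0; set z := Num.max _ _.
have z0 : 0 <= z by rewrite le_max lexx orbT.
have zk : 0 < z + k by rewrite ltr_wpDl.
rewrite ler_pdivrMr ?exprn_gt0// ler_pM2l//.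
by apply: lerXn2r; rewrite ?nnegrE ?lerDr//; exact: ltW.
Qed.

Lemma cutsq_ge0 s : 0 <= cutsq k s.
Proof.
rewrite /cutsq; set z := Num.max _ _.
have z0 : 0 <= z by rewrite le_max lexx orbT.
by rewrite divr_ge0 ?exprn_ge0// addr_ge0// ltW.
Qed.

Lemma cutsq_le s : cutsq k s <= s ^+ 2.
Proof.
rewrite /cutsq; set z := Num.max _ _.
have z0 : 0 <= z by rewrite le_max lexx orbT.
have zk : 0 < z + k by rewrite ltr_wpDl.
rewrite ler_pdivrMr//; apply: (@le_trans _ _ (z ^+ 2 * (z + k))).
  by rewrite exprSr ler_wpM2l ?exprn_ge0// lerDl ltW.
apply: ler_wpM2r; first exact: ltW.
rewrite -[s ^+ 2]real_normK ?num_real// lerXn2r ?nnegrE//.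
rewrite /z ge_max normr_ge0 andbT (le_trans _ (ler_norm s))//.
by rewrite gerBl ltW.
Qed.

Lemma cutsq_eq0 s : s <= k -> cutsq k s = 0.
Proof. by move=> sk; rewrite /cutsq max_r ?subr_le0// expr0n/= mul0r. Qed.

(** With [cutsq_le] this squeezes [cutsq k] to the square as [k] tends to 0, for positive [s]. *)
Lemma cutsq_lower s : 2 * k <= s -> (s - 2 * k) ^+ 2 <= cutsq k s.
Proof.
move=> sk; rewrite /cutsq max_l; last by move: k0; lra.
rewrite subrK ler_pdivlMr; last by move: k0 sk; lra.
have w0 : 0 <= s - 2 * k by rewrite subr_ge0.
(* With w = s - 2k the claim is w^2 (w + 2k) <= (w + k)^3, and the difference has only nonnegative
   terms. *)
rewrite -subr_ge0 (_ : _ - _ =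
  (s - 2 * k) ^+ 2 * k + 3 * (s - 2 * k) * k ^+ 2 + k ^+ 3); last by ring.
by rewrite !addr_ge0 ?mulr_ge0 ?exprn_ge0 // ltW.
Qed.

End cutsq_theory.
End positive_part.

(** * Radial functions and the Gaussian kernel *)

Section radial.
Context {R : realType} {d : nat}.
Local Notation Rd := 'rV[R]_d.
Implicit Types (x y z : Rd).
Local Notation "''e_' i" := (delta_mx ord0 i : Rd) (at level 8, i at level 2).

(** The Euclidean square, smooth and rotation invariant, in contrast with the sup norm of ['rV];
    [sqdist_le] and [sqdist_ge] compare the two. *)
Definition sqdist z y : R := dot (y - z) (y - z).

Lemma sqdistE z y : sqdist z y = \sum_(i < d) (y ord0 i - z ord0 i) ^+ 2.
Proof. by apply: eq_bigr => i _; rewrite !mxE expr2. Qed.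

Lemma sqdist_ge0 z y : 0 <= sqdist z y.
Proof. by rewrite sqdistE sumr_ge0// => i _; rewrite sqr_ge0. Qed.

Lemma sqdist_le z y (r : R) : `|y - z| <= r -> sqdist z y <= d%:R * r ^+ 2.
Proof.
move=> yz; have r0 : 0 <= r by exact: le_trans yz.
have /(row_norm_le _ r0) yzi := yz.
rewrite sqdistE -[X in X%:R * _]card_ord mulr_natl -sumr_const.
apply: ler_sum => i _; have := yzi i; rewrite !mxE => yi.
by rewrite -[X in X <= _]real_normK ?num_real// lerXn2r ?nnegrE.
Qed.

Lemma sqdist_ge z y (r : R) : 0 <= r -> sqdist z y <= r ^+ 2 -> `|y - z| <= r.
Proof.
move=> r0 yz; apply/row_norm_le => // i; rewrite !mxE -(@ler_pXn2r _ 2)// ?nnegrE//.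
rewrite real_normK ?num_real//; apply: le_trans yz; rewrite sqdistE.
by rewrite (bigD1 i)//= lerDl sumr_ge0// => j _; rewrite sqr_ge0.
Qed.

Lemma is_derive_coord z y (i j : 'I_d) :
  is_derive y 'e_j (fun y => y ord0 i - z ord0 i) (i == j)%:R.
Proof.
apply/is_derive_slice.
rewrite (_ : (fun _ => _) = (fun h : R => h * (i == j)%:R + (y ord0 i - z ord0 i))).
  rewrite -[X in is_derive _ _ _ X]addr0; apply: is_deriveD.
  rewrite (_ : (fun _ => _) = (i == j)%:R *: id); last by apply/funext => h; rewrite
    /GRing.scale/= mulrC.
  by rewrite -[X in is_derive _ _ _ X]mulr1; exact: (@is_deriveZ _ _ _ id).
by apply/funext => h; rewrite !mxE eqxx/= addrA.
Qed.

Lemma is_C2_sqdist D z : is_C2 D (sqdist z) (fun i y => 2 * (y ord0 i - z ord0 i))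
  (fun i j _ => 2 * (i == j)%:R).
Proof.
have cc i x : {for x, continuous (fun y : Rd => y ord0 i - z ord0 i)}.
  apply: (@continuousB _ _ _ (fun y : Rd => y ord0 i) (cst (z ord0 i))); last exact:
    cst_continuous.
  exact: coord_continuous.
have E : sqdist z = \sum_(i < d) (fun y : Rd => (y ord0 i - z ord0 i) ^+ 2).
  by apply/funext => y; rewrite sqdistE fct_sumE.
move=> x Dx; split => [|i|i j].
- rewrite E; apply: (big_ind (fun g : Rd -> R => {for x, continuous g})).
  + exact: cst_continuous.
  + by move=> f g cf cg; exact: continuousD.
  + move=> i _; apply: (@continuous_comp _ _ _ (fun y : Rd => y ord0 i - z ord0 i) (fun s => s
    ^+ 2)).
      exact: cc.
    exact: exprn_continuous.
- split; last by apply: (@continuousM _ _ (cst 2)) => //; exact: cst_continuous.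
  rewrite E.
  have H := @is_derive_sum R Rd R d (fun k y => (y ord0 k - z ord0 k) ^+ 2) x 'e_i
    (fun k => 2%:R * (x ord0 k - z ord0 k) ^+ 2.-1 * (k == i)%:R)
    (fun k => is_derive_powf 2 (is_derive_coord z x k i)).
  apply: (is_derive_eq H).
  rewrite (bigD1 i)//= big1 ?addr0 ?eqxx ?mulr1// => k /negbTE ->.
  by rewrite mulr0.
- split; last exact: cst_continuous.
  exact: (@is_deriveZ _ _ _ (fun y : Rd => y ord0 i - z ord0 i) 2 _ _ _ (is_derive_coord z x i
    j)).
Qed.

(** Serves twice: with an exponential for the Gaussian, and with a truncated polynomial for the
    bumps. *)
Lemma radial_C2 D (phi phi1 phi2 : R -> R) z : open D ->
  (forall s : R, is_derive s 1 phi (phi1 s)) -> (forall s : R, is_derive s 1 phi1 (phi2 s)) ->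
  continuous phi2 ->
  C2_on D (fun y => phi (sqdist z y)) /\
  forall y, D y -> laplacian (fun y => phi (sqdist z y)) y =
    4 * sqdist z y * phi2 (sqdist z y) + 2 * d%:R * phi1 (sqdist z y).
Proof.
move=> oD d1 d2 c2; have H := is_C2_comp d1 d2 c2 (@is_C2_sqdist D z).
split; first exact: is_C2_C2_on H.
move=> y Dy; rewrite (is_C2_laplacian oD H)// big_split/=; congr (_ + _).
  rewrite [in 4 * _]sqdistE mulr_sumr mulr_suml; apply: eq_bigr => i _.
  by rewrite -/(sqdist z y); ring.
under eq_bigr do rewrite eqxx mulr1.
by rewrite sumr_const card_ord -mulr_natl; ring.
Qed.

(* The Gaussian heat kernel up to the constant (4 pi)^(d/2). *)
Definition gauss z (t : R) y : R := expR (- (d%:R / 2) * ln t - sqdist z y / (4 * t)).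

Definition gauss_dt z t y : R := (- (d%:R / 2) / t + sqdist z y / (4 * t ^+ 2)) * gauss z t y.

Lemma gauss_C2 D z t : open D -> 0 < t -> C2_on D (gauss z t) /\
  forall y, D y -> laplacian (gauss z t) y = gauss_dt z t y.
Proof.
move=> oD t0; set c := - (d%:R / 2) * ln t; set b : R := - (4 * t)^-1.
have dl (s : R) : is_derive s 1 (fun s => c + b * s) b.
  rewrite -[X in is_derive _ _ _ X]add0r; apply: (@is_deriveD _ _ _ (cst c) (b *: id)).
  by rewrite -[X in is_derive _ _ _ X]mulr1; exact: (@is_deriveZ _ _ _ id).
(* The prefactor [a] makes the family stable under differentiation, so one statement gives both
   derivatives. *)
have dE (a : R) (s : R) : is_derive s 1 (fun s => a * expR (c + b * s)) (a * b * expR (c + b *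
  s)).
  have H := @is_derive1_comp R expR _ s _ _ (is_derive_expR _) (dl s).
  apply: (is_derive_eq (@is_deriveZ _ _ _ _ a _ _ _ H)).
  by rewrite /GRing.scale/=; ring.
have cE : continuous (fun s : R => 1 * b * b * expR (c + b * s)).
  by move=> s; apply/differentiable_continuous/derivable1_diffP; have [] := dE (1 * b * b) s.
have [C2 L] := radial_C2 z oD (dE 1) (dE (1 * b)) cE.
have E : (fun y => 1 * expR (c + b * sqdist z y)) = gauss z t.
  apply/funext => y; rewrite mul1r /gauss -/c; congr (expR (_ + _)).
  by rewrite /b mulNr mulrC.
rewrite E in C2 L; split=> // y Dy; rewrite L// /gauss_dt -E /b.
by field; rewrite gt_eqF.
Qed.

Lemma is_derive_gauss z y (t : R) : 0 < t -> is_derive t 1 (fun t => gauss z t y) (gauss_dt z t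
  y).
Proof.
move=> t0; have tn0 : t != 0 by rewrite gt_eqF.
have dV : is_derive t 1 (fun t : R => ((t + 0) ^+ 1)^-1) (- (1 * (t + 0) ^- 2)).
  by apply: is_derive_inv_pow; rewrite addr0.
have dL := is_derive1_ln t0.
have H := is_deriveD (is_deriveZ (- (d%:R / 2)) dL) (is_deriveZ (- (sqdist z y / 4)) dV).
have {}H := @is_derive1_comp R expR _ t _ _ (is_derive_expR _) H.
rewrite (_ : (fun t => gauss z t y) =
  expR \o ((- (d%:R / 2)) *: @ln R + - (sqdist z y / 4) *: (fun t : R => ((t + 0) ^+ 1)^-1)));
    last first.
  by apply/funext => s; rewrite /gauss/= !fctE/GRing.scale/= addr0 expr1 invfM; congr expR; ring.
apply: (is_derive_eq H); rewrite /gauss_dt /gauss /GRing.scale/= !fctE/= !addr0 expr1.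
rewrite /GRing.scale/= mulrC; congr (_ * _); first by field.
by congr expR; field.
Qed.

Lemma continuous_gauss z t : 0 < t -> continuous (gauss z t).
Proof. by move=> t0 y; have [/(_ y I)[]] := gauss_C2 z openT t0. Qed.

End radial.

(** * Orthonormal expansions in C_0(D) *)

Section C0_functions.
Context {R : realType} {d : nat} {D : set 'rV[R]_d}.
Local Notation Rd := 'rV[R]_d.
Local Notation mu := (row_lebesgue d).
Hypotheses (oD : open D) (bD : bounded_set D).
Implicit Types (x : Rd) (phi psi g : Rd -> R).

Lemma C0_lin (a : R) phi psi : C0 D phi -> C0 D psi -> C0 D (fun x => a * phi x + psi x).
Proof.
move=> [cphi phi0] [cpsi psi0]; split=> [x|x nDx]; last by rewrite phi0// psi0// mulr0 addr0.
apply: (@continuousD _ _ _ (fun x => a * phi x) psi); last exact: cpsi.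
by apply: (@continuousM _ _ (cst a) phi); [exact: cst_continuous|exact: cphi].
Qed.

Lemma C0_mul phi psi : C0 D phi -> C0 D psi -> C0 D (fun x => phi x * psi x).
Proof.
move=> [cphi phi0] [cpsi psi0]; split=> [x|x nDx]; last by rewrite phi0// mul0r.
by apply: (@continuousM _ _ phi psi); [exact: cphi|exact: cpsi].
Qed.

Lemma C0_cst0 : C0 D (cst 0).
Proof. by split=> // x; exact: cst_continuous. Qed.

Lemma C0_scale (a : R) phi : C0 D phi -> C0 D (fun x => a * phi x).
Proof.
move=> C0phi; rewrite (_ : (fun _ => _) = fun x => a * phi x + cst 0 x).
  exact: C0_lin C0phi C0_cst0.
by apply/funext => x; rewrite addr0.
Qed.

Lemma C0_sum (N : nat) (c : nat -> R) (f : nat -> Rd -> R) : (forall n, C0 D (f n)) ->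
  C0 D (fun x => \sum_(n < N) c n * f n x).
Proof.
move=> fC0; elim: N => [|N IH].
  by rewrite (_ : (fun _ => _) = cst 0); [exact: C0_cst0|apply/funext => x; rewrite big_ord0].
rewrite (_ : (fun _ => _) = (fun x => c N * f N x + \sum_(n < N) c n * f n x)).
  exact: C0_lin.
by apply/funext => x; rewrite big_ord_recr addrC.
Qed.

Lemma C0_bounded phi : C0 D phi -> exists2 C : R, 0 <= C & forall x, `|phi x| <= C.
Proof.
move=> [cphi phi0]; have [M M0 DM] := bounded_row_set bD.
have [||C phiC] := @bounded_support_continuous_bounded _ _ phi M => //.
  by move=> x Mx; apply: phi0 => /DM; rewrite leNgt Mx.
by exists C => //; exact: le_trans (phiC 0).
Qed.

Lemma C0_integrable phi : C0 D phi -> mu.-integrable D (EFin \o phi).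
Proof.
move=> phi0; have [C _ phiC] := C0_bounded phi0.
apply: (@bounded_integrable_row _ _ _ _ C) => //; first exact: open_row_measurable.
by apply: continuous_row_measurable => // x _; exact: phi0.1.
Qed.

Lemma dotL2_C phi psi : dotL2 D phi psi = dotL2 D psi phi.
Proof. by apply: eq_Rintegral => x _; rewrite mulrC. Qed.

Lemma dotL2_lin (a : R) phi psi g : C0 D phi -> C0 D psi -> C0 D g ->
  dotL2 D (fun x => a * phi x + psi x) g = a * dotL2 D phi g + dotL2 D psi g.
Proof.
move=> C0phi C0psi C0g; rewrite /dotL2 -RintegralZl; last 2 first.
- exact: open_row_measurable.
- exact: (C0_integrable (C0_mul C0phi C0g)).
rewrite -RintegralD; last 3 first.
- exact: open_row_measurable.
- exact: (C0_integrable (C0_scale a (C0_mul C0phi C0g))).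
- exact: (C0_integrable (C0_mul C0psi C0g)).
by apply: eq_Rintegral => x _; rewrite mulrDl mulrA.
Qed.

Lemma dotL2_0 g : dotL2 D (cst 0) g = 0.
Proof.
rewrite /dotL2 (_ : (fun x => cst 0 x * g x) = cst 0).
  by rewrite Rintegral_cst ?mul0r//; exact: open_row_measurable.
by apply/funext => x; rewrite mul0r.
Qed.

Lemma dotL2_sum (N : nat) (c : nat -> R) (f : nat -> Rd -> R) g :
  (forall n, C0 D (f n)) -> C0 D g ->
  dotL2 D (fun x => \sum_(n < N) c n * f n x) g = \sum_(n < N) c n * dotL2 D (f n) g.
Proof.
move=> fC0 C0g; elim: N => [|N IH].
  rewrite big_ord0 -[RHS](dotL2_0 g); congr (dotL2 _ _ _).
  by apply/funext => x; rewrite big_ord0.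
rewrite big_ord_recr/= -IH addrC -dotL2_lin//; last exact: C0_sum.
by congr (dotL2 _ _ _); apply/funext => x; rewrite big_ord_recr addrC.
Qed.

Lemma dotL2_ge0 phi : 0 <= dotL2 D phi phi.
Proof. by apply: Rintegral_ge0 => x _; rewrite -expr2 sqr_ge0. Qed.

Lemma C0_L2 phi : C0 D phi -> L2 D phi.
Proof.
move=> C0phi; split.
  by apply: continuous_row_measurable => // x _; exact: C0phi.1.
have /integrableP[_] := C0_integrable (C0_mul C0phi C0phi).
apply: le_lt_trans; rewrite le_eqVlt; apply/orP; left; apply/eqP.
by apply: eq_integral => x _ /=; rewrite expr2 ger0_norm// -expr2 sqr_ge0.
Qed.

Lemma dotL2_le_sup phi psi (C : R) : C0 D phi -> C0 D psi -> 
  (forall x, D x -> `|phi x * psi x| <= C) -> `|dotL2 D phi psi| <= C * fine (mu D).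
Proof.
move=> C0phi C0psi phipsi; have mD := open_row_measurable oD.
have i1 := C0_integrable (C0_mul C0phi C0psi).
apply: le_trans (le_normr_Rintegral mD i1) _.
rewrite -(Rintegral_cst mu mD); apply: le_Rintegral => //.
- by move/integrable_abse : i1.
- apply: (@bounded_integrable_row _ _ _ _ `|C|) => //.
Qed.

Section orthonormal.
Variables (f : nat -> Rd -> R) (fC0 : forall n, C0 D (f n))
  (f_on : forall m n, dotL2 D (f m) (f n) = (m == n)%:R).

Lemma dotL2_sum_basis (N : nat) (c : nat -> R) (m : nat) :
  dotL2 D (fun x => \sum_(n < N) c n * f n x) (f m) = if (m < N)%N then c m else 0.
Proof.
rewrite dotL2_sum//; under eq_bigr do rewrite f_on.
case: ifPn => [mN|mN].
  rewrite (bigD1 (Ordinal mN))//= eqxx mulr1 big1 ?addr0// => n.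
  by rewrite -val_eqE/= => /negbTE ->; rewrite mulr0.
apply: big1 => n _; rewrite (_ : (_ == _) = false) ?mulr0//.
by apply/eqP => nm; move: mN; rewrite -nm ltn_ord.
Qed.

Lemma parseval_sum (N : nat) (c : nat -> R) :
  let u x := \sum_(n < N) c n * f n x in dotL2 D u u = \sum_(n < N) c n ^+ 2.
Proof.
move=> u; rewrite {1}/u dotL2_sum//; last exact: C0_sum.
by apply: eq_bigr => n _; rewrite dotL2_C dotL2_sum_basis ltn_ord expr2.
Qed.

(** The squared norm of [g] minus its partial sum is nonnegative. *)
Lemma bessel (N : nat) g : C0 D g -> \sum_(n < N) dotL2 D g (f n) ^+ 2 <= dotL2 D g g.
Proof.
move=> C0g; pose c n := dotL2 D g (f n); pose u x := \sum_(n < N) c n * f n x.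
have C0u : C0 D u by exact: C0_sum.
have := dotL2_ge0 (fun x => - 1 * u x + g x).
have C0gu := C0_lin (- 1) C0u C0g.
rewrite dotL2_lin// ![dotL2 D _ (fun x => _ + _)]dotL2_C !dotL2_lin//.
have uu : dotL2 D u u = \sum_(n < N) c n ^+ 2 by exact: parseval_sum.
have gu : dotL2 D u g = \sum_(n < N) c n ^+ 2.
  by rewrite dotL2_sum//; apply: eq_bigr => n _; rewrite dotL2_C expr2.
by rewrite (dotL2_C g u) uu gu; rewrite -/c; set s := \sum_(n < N) _; lra.
Qed.

End orthonormal.
End C0_functions.

(** * Ultracontractivity of the Dirichlet heat semigroup *)

Section heat_comparison.
Context {R : realType} {d : nat} {D : set 'rV[R]_d}.
Local Notation Rd := 'rV[R]_d.
Local Notation mu := (row_lebesgue d).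
Implicit Types (x y : Rd) (a : nat -> R) (t s k : R).

Lemma continuous_laplacian (g : Rd -> R) x : C2_on D g -> D x ->
  {for x, continuous (laplacian g)}.
Proof.
move=> gD Dx; rewrite (_ : laplacian g = \sum_(i < d) partial i (partial i g)); last first.
  by apply/funext => y; rewrite fct_sumE.
apply: (big_ind (fun g : Rd -> R => {for x, continuous g})).
- exact: cst_continuous.
- by move=> u v cu cv; exact: continuousD.
- by move=> i _; have [_ _ /(_ i i)[]] := gD x Dx.
Qed.

Lemma laplacian_vanish K (g : Rd -> R) x : closed K -> (forall x, ~ K x -> g x = 0) ->
  ~ K x -> laplacian g x = 0.
Proof.
move=> cK gK nKx; apply: big1 => i _.
have vK (h : Rd -> R) : (forall x, ~ K x -> h x = 0) -> forall x, ~ K x -> partial i h x = 0.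
  by move=> hK z nKz; rewrite /partial -(near_eq_derive _ (near_vanish cK hK nKz)) derive_cst.
by apply: (vK) => //; exact: vK.
Qed.

Lemma cutsq1_bounded k s : 0 < k -> `|cutsq1 k s| <= 2 * `|s|.
Proof.
move=> k0; rewrite /cutsq1; set z := Num.max _ _.
have z0 : 0 <= z by rewrite le_max lexx orbT.
have zk : 0 < z + k by rewrite ltr_wpDl.
have zs : z <= `|s|.
  rewrite /z ge_max normr_ge0 andbT (le_trans _ (ler_norm s))//.
  by rewrite gerBl ltW.
have E : 2 * z - k + k ^+ 3 / (z + k) ^+ 2 = (2 * z ^+ 3 + 3 * k * z ^+ 2) / (z + k) ^+ 2.
  by field; rewrite gt_eqF.
rewrite E ger0_norm; last first.
  by rewrite divr_ge0 ?exprn_ge0 ?addr_ge0 ?mulr_ge0 ?exprn_ge0// ltW.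
rewrite -E; have : k ^+ 3 / (z + k) ^+ 2 <= k; last by move: zs; lra.
rewrite ler_pdivrMr ?exprn_gt0// exprS ler_pM2l// lerXn2r ?nnegrE ?lerDr//; exact: ltW.
Qed.

Lemma cutsq1_eq0 k s : 0 < k -> s <= k -> cutsq1 k s = 0.
Proof. by move=> k0 sk; rewrite /cutsq1 max_r ?subr_le0//; field; rewrite gt_eqF. Qed.

Hypotheses (oD : open D) (bD : bounded_set D).
Variables (lam : nat -> R) (f : nat -> Rd -> R).
Hypotheses (lam_ge0 : forall n, 0 <= lam n) (fC0 : forall n, C0 D (f n))
  (fC2 : forall n, C2_on D (f n))
  (f_eig : forall n x, D x -> - laplacian (f n) x = lam n * f n x).

Definition eigsum (N : nat) a t y : R := \sum_(n < N) (a n * expR (- lam n * t)) * f n y.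

(** These coefficients give the time derivative as well as the Laplacian of [eigsum]: their
    coincidence is the heat equation. *)
Let ddt a n := - lam n * a n.

Lemma eigsum_C0 N a t : C0 D (eigsum N a t).
Proof. exact: (@C0_sum _ _ _ N (fun n => a n * expR (- lam n * t)) f fC0). Qed.

Lemma eigsum_is_C2 N a t : is_C2 D (eigsum N a t)
  (fun i y => \sum_(n < N) (a n * expR (- lam n * t)) * partial i (f n) y)
  (fun i j y => \sum_(n < N) (a n * expR (- lam n * t)) * partial j (partial i (f n)) y).
Proof.
exact: (@is_C2_sum _ _ D N (fun n => a n * expR (- lam n * t)) f
  (fun n i => partial i (f n)) (fun n i j => partial j (partial i (f n)))
  (fun n => C2_on_is_C2 (fC2 n))).
Qed.

Lemma eigsum_laplacian N a t y : D y -> laplacian (eigsum N a t) y = eigsum N (ddt a) t y.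
Proof.
move=> Dy; rewrite (is_C2_laplacian oD (eigsum_is_C2 N a t))// exchange_big/=.
apply: eq_bigr => n _; rewrite -mulr_sumr -/(laplacian (f n) y).
by have /(congr1 -%R) := f_eig n Dy; rewrite opprK => ->; rewrite /ddt; ring.
Qed.

Lemma is_derive_expRM (b c t : R) : is_derive t 1 (fun t => c * expR (b * t)) (b * c * expR (b *
  t)).
Proof.
have dl : is_derive t 1 (fun t => b * t) b.
  by rewrite -[X in is_derive _ _ _ X]mulr1; exact: (@is_deriveZ _ _ _ id).
have H := @is_deriveZ _ _ _ _ c _ _ _ (@is_derive1_comp R expR _ t _ _ (is_derive_expR _) dl).
by apply: (is_derive_eq H); rewrite /GRing.scale/=; ring.
Qed.

Lemma is_derive_eigsum N a t y :
  is_derive t 1 (fun t => eigsum N a t y) (eigsum N (ddt a) t y).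
Proof.
have E : (fun t => eigsum N a t y) =
    \sum_(n < N) (fun t => f n y * (a n * expR (- lam n * t))).
  by apply/funext => s; rewrite fct_sumE; apply: eq_bigr => n _; rewrite mulrC.
rewrite E.
have H := @is_derive_sum R R R N (fun n t => f n y * (a n * expR (- lam n * t))) t 1
  (fun n => f n y * (- lam n * a n * expR (- lam n * t)))
  (fun n => @is_deriveZ _ _ _ (fun t => a n * expR (- lam n * t)) (f n y) _ _ _
              (is_derive_expRM (- lam n) (a n) t)).
apply: (is_derive_eq H); apply: eq_bigr => n _; rewrite /ddt; ring.
Qed.

(** Times down to -1 are allowed because differentiating under the integral at time 0 takes an open
    interval around 0; a finite sum also makes sense backwards in time. *)
Lemma eigsum_bounded N a : exists2 C : R, 0 <= C & forall t y, -1 <= t -> `|eigsum N a t y| <= C.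
Proof.
have /choice[C CP] : forall n, exists C : R, 0 <= C /\ forall y, `|f n y| <= C.
  by move=> n; have [C ? ?] := C0_bounded bD (fC0 n); exists C.
exists (\sum_(n < N) `|a n| * expR (lam n) * C n).
  by apply: sumr_ge0 => n _; rewrite !mulr_ge0 ?expR_ge0//; have [] := CP n.
move=> t y t1; apply: le_trans (ler_norm_sum _ _ _) _; apply: ler_sum => n _.
rewrite !normrM (ger0_norm (expR_ge0 _)); apply: ler_pM; rewrite ?mulr_ge0 ?expR_ge0//.
  rewrite ler_wpM2l// ler_expR mulNr -mulrN -[leRHS]mulr1 ler_wpM2l//.
  by rewrite lerNl.
by have [_] := CP n.
Qed.

Section energy.
Variables (N : nat) (a : nat -> R) (k T : R) (x : Rd) (k0 : 0 < k).
Local Notation u := (eigsum N a).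
Local Notation ut := (eigsum N (ddt a)).

(** Closed in R^d, and contained in [D] since [u] is 0 off [D] and [k > 0]. It supports [cutsq k] of
    [u], which removes all boundary terms. *)
Let K t : set Rd := [set y | k <= u t y].

Let cK t : closed (K t).
Proof.
rewrite (_ : K t = u t @^-1` [set r | k <= r])//.
by apply: closed_comp => [y _|]; [exact: (eigsum_C0 N a t).1|exact: closed_ge].
Qed.

Let KD t : K t `<=` D.
Proof.
move=> y Ky; apply: contrapT => nDy; move: Ky.
by rewrite /K/= (eigsum_C0 N a t).2// leNgt k0.
Qed.

Let nK t y : ~ K t y -> u t y <= k.
Proof. by move/negP; rewrite -ltNge => /ltW. Qed.

(** The Gaussian is run backwards in time: it spreads over R^d at time 0 and concentrates at [x] as
    [t] tends to [T]. *)
Definition heat_energy_density t y : R := gauss x (T - t) y * cutsq k (u t y).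
Local Notation e := heat_energy_density.

Let e_dt t y : R := gauss x (T - t) y * (cutsq1 k (u t y) * ut t y) -
  gauss_dt x (T - t) y * cutsq k (u t y).

Let is_derive_e t y : t < T -> is_derive t 1 (fun t => e t y) (e_dt t y).
Proof.
move=> tT; have Tt : 0 < T - t by rewrite subr_gt0.
have dT : is_derive t 1 (fun t : R => T - t) (- 1).
  by rewrite -[X in is_derive _ _ _ X]add0r; exact: (@is_deriveB _ _ _ (cst T) id).
have dG := @is_derive1_comp R (fun s => gauss x s y) _ t _ _ (is_derive_gauss x y Tt) dT.
have dW := @is_derive1_comp R (cutsq k) _ t _ _ (is_derive_cutsq k0 _) (is_derive_eigsum N a t y).
have H := is_derive_mulf dG dW.
by apply: (is_derive_eq H); rewrite /e_dt /=; ring.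
Qed.

Let c0 (phi phi1 : R -> R) : (forall s : R, is_derive s 1 phi (phi1 s)) -> continuous phi.
Proof.
by move=> H s; apply/differentiable_continuous/derivable1_diffP; have [] := H s.
Qed.

Let cu t (phi : R -> R) : continuous phi -> continuous (fun y => phi (u t y)).
Proof.
by move=> cphi y; apply: continuous_comp; [exact: (eigsum_C0 N a t).1|exact: cphi].
Qed.

Let cw t : continuous (fun y => cutsq k (u t y)).
Proof. exact: (cu (c0 (is_derive_cutsq k0))). Qed.

Lemma integrable_heat_energy t : t < T -> mu.-integrable D (EFin \o e t).
Proof.
move=> tT; have Tt : 0 < T - t by rewrite subr_gt0.
have [|y nKy|_ //] := continuous_vanish_integrable oD bD (@cK t) (@KD t) (g := e t).
  by move=> y _; apply: (@continuousM _ _ (gauss x (T - t))); [exact: continuous_gauss|exact: cw].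
by rewrite /e cutsq_eq0 ?mulr0//; exact: nK.
Qed.

Let C2w t : C2_on D (fun y => cutsq k (u t y)).
Proof.
apply: (is_C2_C2_on oD (is_C2_comp (is_derive_cutsq k0) (is_derive_cutsq1 k0)
  (continuous_cutsq2 k0) (eigsum_is_C2 N a t))).
Qed.

Let lap_w t y : D y ->
  cutsq1 k (u t y) * ut t y <= laplacian (fun y => cutsq k (u t y)) y.
Proof.
move=> Dy; rewrite -eigsum_laplacian//.
rewrite (is_C2_laplacian oD (is_C2_comp (is_derive_cutsq k0) (is_derive_cutsq1 k0)
  (continuous_cutsq2 k0) (eigsum_is_C2 N a t)))// big_split/= -mulr_sumr.
rewrite (is_C2_laplacian oD (eigsum_is_C2 N a t))// lerDr sumr_ge0// => i _.
by rewrite -mulrA mulr_ge0 ?cutsq2_ge0// -expr2 sqr_ge0.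
Qed.

Let energy_dt_le0 t : t < T -> \int[mu]_(y in D) e_dt t y <= 0.
Proof.
move=> tT; have Tt : 0 < T - t by rewrite subr_gt0.
have mD := open_row_measurable oD.
have [GC2 lapG] := gauss_C2 x oD Tt.
pose w y := cutsq k (u t y).
have wK y : ~ K t y -> w y = 0 by move=> nKy; rewrite /w cutsq_eq0//; exact: nK.
have GE : \int[mu]_(y in D) (gauss x (T - t) y * laplacian w y -
    laplacian (gauss x (T - t)) y * w y) = 0.
  exact: (green oD bD (@cK t) (@KD t) GC2 (@C2w t) wK).
have cG y : D y -> {for y, continuous (laplacian (gauss x (T - t)))} by exact:
  continuous_laplacian.
(* The 0 on the right is replaced by the Green integral, so that only a pointwise comparison of
   integrands remains. *)
rewrite -[leRHS]GE; apply: le_Rintegral => //.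
- have [|y nKy|_ //] := continuous_vanish_integrable oD bD (@cK t) (@KD t)
    (g := fun y => gauss x (T - t) y * (cutsq1 k (u t y) * ut t y) -
            laplacian (gauss x (T - t)) y * cutsq k (u t y)).
  + move=> y Dy; apply: (@continuousB _ _ _ (fun y => gauss x (T - t) y * (cutsq1 k (u t y) * ut
    t y))
      (fun y => laplacian (gauss x (T - t)) y * cutsq k (u t y))).
      apply: (@continuousM _ _ (gauss x (T - t))); first exact: continuous_gauss.
      apply: (@continuousM _ _ (fun y => cutsq1 k (u t y))); last exact: (eigsum_C0 N _ t).1.
      exact: (cu (c0 (is_derive_cutsq1 k0))).
    apply: (@continuousM _ _ (laplacian (gauss x (T - t)))); [exact: cG|exact: cw].
  + by rewrite -/(w y) wK// cutsq1_eq0 ?mulr0 ?mul0r ?mulr0 ?subr0//; exact: nK.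
  + apply: eq_integrable => // y; rewrite inE => Dy /=.
    by rewrite /e_dt lapG.
- have [|y nKy|_ //] := continuous_vanish_integrable oD bD (@cK t) (@KD t)
    (g := fun y => gauss x (T - t) y * laplacian w y - laplacian (gauss x (T - t)) y * w y).
  + move=> y Dy; apply: (@continuousB _ _ _ (fun y => gauss x (T - t) y * laplacian w y)
      (fun y => laplacian (gauss x (T - t)) y * w y)).
      apply: (@continuousM _ _ (gauss x (T - t))); first exact: continuous_gauss.
      exact: continuous_laplacian (@C2w t) Dy.
    apply: (@continuousM _ _ (laplacian (gauss x (T - t)))); [exact: cG|exact: cw].
  + by rewrite wK// (laplacian_vanish (@cK t) wK nKy) !mulr0 subr0.
- move=> y Dy; rewrite /e_dt lapG// lerB// ler_wpM2l ?expR_ge0//.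
  exact: lap_w.
Qed.

(** The domination for differentiating under the integral: for [t < T2] the Gaussian time [T - t]
    stays above [tau], away from the singularity. *)
Let e_dt_bounded T2 : T2 < T -> exists2 C : R, 0 <= C &
  forall t y, -1 <= t -> t < T2 -> D y -> `|e_dt t y| <= C.
Proof.
move=> T2T; have [M M0 DM] := bounded_row_set bD.
have [U U0 uU] := eigsum_bounded N a; have [V V0 uV] := eigsum_bounded N (ddt a).
pose tau := T - T2; have tau0 : 0 < tau by rewrite subr_gt0.
pose rho := d%:R * (M + `|x|) ^+ 2.
have rho0 : 0 <= rho by rewrite mulr_ge0// exprn_ge0// addr_ge0// ltW.
pose E := expR (- (d%:R / 2) * ln tau).
pose E' := (d%:R / 2 / tau + rho / (4 * tau ^+ 2)) * E.
have G t y : t < T2 -> gauss x (T - t) y <= E.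
  move=> tT2; have tt : tau < T - t by rewrite /tau ltrD2l ltrN2.
  have Tt : 0 < T - t by exact: lt_trans tt.
  rewrite ler_expR; apply: (@le_trans _ _ (- (d%:R / 2) * ln (T - t))).
    by rewrite gerBl divr_ge0 ?sqdist_ge0// mulr_ge0// ltW.
  by rewrite !mulNr lerN2 ler_wpM2l// ler_ln ?posrE// ltW.
have G' t y : t < T2 -> D y -> `|gauss_dt x (T - t) y| <= E'.
  move=> tT2 Dy; have tt : tau < T - t by rewrite /tau ltrD2l ltrN2.
  have Tt : 0 < T - t by exact: lt_trans tt.
  rewrite normrM [X in _ * X]ger0_norm ?expR_ge0//; apply: ler_pM => //; last exact: G.
    exact: expR_ge0.
  apply: le_trans (ler_normD _ _) _; apply: lerD.
    have dd : 0 <= d%:R / 2 :> R by rewrite divr_ge0.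
    rewrite normrM normrN (ger0_norm dd) ger0_norm ?invr_ge0 ?(ltW Tt)//.
    by rewrite ler_wpM2l// lef_pV2 ?posrE// ltW.
  rewrite ger0_norm ?divr_ge0 ?sqdist_ge0 ?mulr_ge0 ?exprn_ge0 ?(ltW Tt)//.
  apply: ler_pM; rewrite ?sqdist_ge0 ?invr_ge0 ?mulr_ge0 ?exprn_ge0 ?(ltW Tt)//.
    apply: sqdist_le; apply: le_trans (ler_normB _ _) _.
    by rewrite lerD2r DM.
  rewrite lef_pV2 ?posrE ?mulr_gt0 ?exprn_gt0// ler_pM2l//.
  by rewrite lerXn2r ?nnegrE ?(ltW tau0) ?(ltW Tt)// ltW.
exists (E * ((2 * U) * V) + E' * U ^+ 2).
  have E0 : 0 <= E by exact: expR_ge0.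
  have E'0 : 0 <= E'.
    apply: mulr_ge0 => //; apply: addr_ge0.
      by apply: divr_ge0; [rewrite divr_ge0|exact: ltW].
    by apply: divr_ge0 => //; apply: mulr_ge0 => //; rewrite exprn_ge0// ltW.
  apply: addr_ge0; apply: mulr_ge0 => //; last exact: exprn_ge0.
  by apply: mulr_ge0 => //; apply: mulr_ge0.
move=> t y t1 tT2 Dy; apply: le_trans (ler_normB _ _) _; apply: lerD.
  rewrite !normrM; apply: ler_pM; rewrite ?mulr_ge0//.
    by rewrite ger0_norm ?expR_ge0// G.
  apply: ler_pM; rewrite ?uV//.
  by apply: le_trans (cutsq1_bounded _ k0) _; rewrite ler_pM2l// uU.
rewrite normrM; apply: ler_pM; rewrite ?G'// ger0_norm ?cutsq_ge0//.
apply: le_trans (cutsq_le k0 _) _.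
by rewrite -[X in X <= _]real_normK ?num_real// lerXn2r ?nnegrE// uU.
Qed.

(* With [G] the Gaussian, [w = cutsq k o u] and [u] solving the heat equation, the
   time derivative is [\int (G * laplacian w - laplacian G * w)
   - \int G * cutsq2 k u * |grad u|^2]: the first term vanishes by Green, because [w]
   has compact support in [D], and the second has a sign by convexity. *)
Lemma heat_energy_nincr T1 : 0 <= T1 -> T1 < T ->
  \int[mu]_(y in D) e T1 y <= \int[mu]_(y in D) e 0 y.
Proof.
(* [T2] leaves room on both sides: [[0, T1]] lies in the open interval []-1, T2[], on which the
   bound is uniform. *)
move=> T10 T1T; pose T2 := (T1 + T) / 2.
have T12 : T1 < T2 by rewrite /T2; lra.
have T2T : T2 < T by rewrite /T2; lra.
have [C C0 eC] := e_dt_bounded T2T.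
have mD := open_row_measurable oD.
have intC : mu.-integrable D (EFin \o cst C).
  by apply: (@bounded_integrable_row _ _ _ _ `|C|) => //; exact: measurable_cst.
pose J t := \int[mu]_(y in D) e t y.
have inT t : `]-1, T2[%classic t -> -1 <= t /\ t < T2.
  by rewrite /= in_itv/= => /andP[/ltW].
have ie t : `]-1, T2[%classic t -> mu.-integrable D (EFin \o e t).
  by move=> /inT[_ tT2]; apply: integrable_heat_energy; exact: lt_trans T2T.
have de t y : `]-1, T2[%classic t -> D y -> derivable (e ^~ y) t 1.
  move=> /inT[_ tT2] _; by have [] := is_derive_e y (lt_trans tT2 T2T).
have pe t y : `]-1, T2[%classic t -> partial1of2 e t y = e_dt t y.
  move=> /inT[_ tT2]; have H := is_derive_e y (lt_trans tT2 T2T).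
  by rewrite partial1of2E derive_val.
have eb t y : `]-1, T2[%classic t -> D y -> `|partial1of2 e t y| <= cst C y.
  by move=> It Dy; rewrite pe//; have [? ?] := inT _ It; exact: eC.
have dJ t : `]-1, T2[%classic t -> derivable J t 1.
  by move=> It; exact: (derivable_under_integral mD It ie de (fun=> C0) intC eb).
have J' t : `]-1, T2[%classic t -> J^`()%classic t <= 0.
  move=> It; rewrite (differentiation_under_integral mD It ie de (fun=> C0) intC eb).
  rewrite (_ : Rintegral _ _ _ = \int[mu]_(y in D) e_dt t y).
    by apply: energy_dt_le0; have [_ tT2] := inT _ It; exact: lt_trans T2T.
  by apply: eq_Rintegral => y _; rewrite pe.
have sub t : t \in `[0, T1] -> `]-1, T2[%classic t.
  by rewrite /= !in_itv/= => /andP[t0 tT1]; apply/andP; split; lra.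
apply: (@ler0_derive1_nincr R J 0 T1) => // [t tI|t tI|].
- by apply/dJ/sub; exact: subset_itv_oo_cc.
- by apply/J'/sub; exact: subset_itv_oo_cc.
- by apply: derivable_within_continuous => t tI; exact/dJ/sub.
Qed.

End energy.
End heat_comparison.

Lemma Rintegral_ge_cst (R : realType) dsp (T : measurableType dsp) (mu : {measure set T -> \bar
  R})
    (D A : set T) (g : T -> R) (c m : R) : measurable D -> measurable A -> A `<=` D ->
  mu.-integrable D (EFin \o g) -> (forall x, D x -> 0 <= g x) -> mu A = m%:E ->
  0 <= c -> (forall x, A x -> c <= g x) -> c * m <= \int[mu]_(x in D) g x.
Proof.
move=> mD mA AD ig g0 muA c0 cg.
rewrite -lee_fin /Rintegral fineK; last exact: integrable_fin_num ig.
have /measurable_EFinP mg := measurable_int _ ig.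
apply: (@le_trans _ _ (\int[mu]_(x in A) (g x)%:E)%E).
  rewrite EFinM -muA -integral_cst//; apply: ge0_le_integral => //.
  - by apply/measurable_EFinP; exact: measurable_funS mg.
apply: ge0_subset_integral => //; exact/measurable_EFinP.
Qed.

Section ultracontractivity.
Context {R : realType} {d : nat} {D : set 'rV[R]_d}.
Local Notation Rd := 'rV[R]_d.
Local Notation mu := (row_lebesgue d).
Implicit Types (x y : Rd) (a : nat -> R) (t s k : R).
Hypotheses (oD : open D) (bD : bounded_set D).
Variables (lam : nat -> R) (f : nat -> Rd -> R).
Hypotheses (lam_ge0 : forall n, 0 <= lam n) (fC0 : forall n, C0 D (f n))
  (fC2 : forall n, C2_on D (f n))
  (f_on : forall m n, dotL2 D (f m) (f n) = (m == n)%:R)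
  (f_eig : forall n x, D x -> - laplacian (f n) x = lam n * f n x).
Local Notation u := (eigsum lam f).

(** Joint continuity is what compares the value at [(T, x)] with those on a small cube at a slightly
    earlier time. *)
Lemma continuous_eigsum N a (p : R * Rd) : {for p, continuous (fun p => u N a p.1 p.2)}.
Proof.
rewrite (_ : (fun p => _) = \sum_(n < N) (fun p : R * Rd => (a n * expR (- lam n * p.1)) * f n
  p.2)).
  apply: (big_ind (fun g : R * Rd -> R => {for p, continuous g})).
  - exact: cst_continuous.
  - by move=> g h cg ch; exact: continuousD.
  - move=> n _; apply: (@continuousM _ _ (fun p : R * Rd => a n * expR (- lam n * p.1)) (fun p
    => f n p.2)).
      apply: (@continuous_comp _ _ _ (fst : R * Rd -> R) (fun t => a n * expR (- lam n * t))).
        exact: cvg_fst.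
      by apply/differentiable_continuous/derivable1_diffP; have [] := is_derive_expRM (- lam n)
        (a n) p.1.
    apply: (@continuous_comp _ _ _ (snd : R * Rd -> Rd) (f n)); first exact: cvg_snd.
    exact: (fC0 n).1.
by apply/funext => q; rewrite fct_sumE.
Qed.

(** At time [s ^+ 2] the prefactor is s^(-d), and the exponent is at least -(d s^2) / (4 s^2) by
    [sqdist_le]. *)
Lemma gauss_diag_lower x y s : 0 < s -> `|y - x| <= s ->
  (s ^+ d)^-1 * expR (- d%:R / 4) <= gauss x (s ^+ 2) y.
Proof.
move=> s0 yx; have s20 : 0 < s ^+ 2 by rewrite exprn_gt0.
have -> : (s ^+ d)^-1 = expR (- (d%:R / 2) * ln (s ^+ 2)).
  rewrite -exprVn -{1}(lnK (x := s)) ?posrE// -expRN -expRM_natl lnXn//.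
  by congr expR; rewrite -mulr_natr; field.
rewrite -expRD ler_expR lerD2l mulNr lerN2 ler_pdivrMr ?mulr_gt0//.
apply: le_trans (sqdist_le yx) _.
by rewrite [leRHS](_ : _ = d%:R * s ^+ 2)//; field.
Qed.

(** The volume (2s)^d of the cube times the lower bound of the Gaussian on it; the powers of [s]
    cancel. *)
Let c : R := 2 ^+ d * expR (- d%:R / 4).

(* The energy is only evaluated on a cube of radius [s] around [x], at the time
   [T - s ^ 2]. This costs a constant factor but spares the normalization of the
   Gaussian and its convergence to the Dirac mass. *)
Let energy_lower N a k (T : R) x (e : R) : 0 < k -> 0 < T -> D x -> 0 < e ->
  exists T1 : R, [/\ 0 <= T1, T1 < T &
    c * (cutsq k (u N a T x) - e) <= \int[mu]_(y in D) heat_energy_density lam f N a k T x T1 y].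
Proof.
move=> k0 T0 Dx e0; set v := cutsq k (u N a T x).
have c0 : 0 <= c by rewrite mulr_ge0 ?exprn_ge0 ?expR_ge0.
have [ve|ve] := leP v e.
  exists 0; split => //; apply: (@le_trans _ _ 0); first by rewrite mulr_ge0_le0// subr_le0.
  by apply: Rintegral_ge0 => y _; rewrite mulr_ge0 ?expR_ge0 ?cutsq_ge0.
have cF : {for (T, x), continuous (fun p => cutsq k (u N a p.1 p.2))}.
  apply: (@continuous_comp _ _ _ (fun p => u N a p.1 p.2) (cutsq k)).
    exact: continuous_eigsum.
  by apply/differentiable_continuous/derivable1_diffP; have [] := is_derive_cutsq k0 (u N a T x).
have /cvgrPdist_le/(_ e e0) := cF.
move=> [[A B] /= [/nbhs_ballP[r1 /= r10 TA] /nbhs_ballP[r2 /= r20 xB]] AB].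
have [r3 r30 cD] := open_cube_sub oD Dx.
(* [s < 1] gives [s ^+ 2 < s], so that [s < T] and [s < r1] control the time shift [s ^+ 2]; [r2]
   and [r3] control the cube, for continuity and for inclusion in [D]. *)
pose m : R := Num.min (Num.min 1 (Num.min T r1)) (Num.min r2 r3).
have m0 : 0 < m by rewrite !lt_min ltr01 T0 r10 r20 r30.
pose s : R := m / 2; have s0 : 0 < s by rewrite divr_gt0.
have [s1 sT sr1 sr2 sr3] : [/\ s < 1, s < T, s < r1, s < r2 & s < r3].
  have : s < m by rewrite /s; lra.
  by rewrite /m !lt_min => /andP[/andP[-> /andP[-> ->]] /andP[-> ->]].
have s2s : s ^+ 2 < s by rewrite expr2 gtr_pMl.
have s20 : 0 < s ^+ 2 by rewrite exprn_gt0.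
exists (T - s ^+ 2); split; [lra|lra|].
have -> : c * (v - e) = ((s ^+ d)^-1 * expR (- d%:R / 4) * (v - e)) * (2 * s) ^+ d.
  have sd0 : s ^+ d != 0 by rewrite expf_neq0// gt_eqF.
  have gen (q p E w : R) : q != 0 -> p * E * w = q^-1 * E * w * (p * q) by move=> ?; field.
  by rewrite (exprMn d 2 s); exact: (gen _ _ _ _ sd0).
apply: (@Rintegral_ge_cst _ _ _ _ _ (cube x s)).
- exact: open_row_measurable.
- by apply: measurable_cube; exact: ltW.
- by move=> y; rewrite /cube/= => yx; apply: cD; exact: le_trans (ltW sr3).
- apply: (integrable_heat_energy oD bD) => //; lra.
- by move=> y _; rewrite mulr_ge0 ?expR_ge0 ?cutsq_ge0.
- by apply: row_lebesgue_cube; exact: ltW.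
- by rewrite !mulr_ge0 ?expR_ge0 ?invr_ge0 ?exprn_ge0 ?(ltW s0)// subr_ge0 ltW.
move=> y; rewrite /cube/= => yx; rewrite /heat_energy_density subKr.
apply: ler_pM.
- by rewrite mulr_ge0 ?expR_ge0 ?invr_ge0 ?exprn_ge0 ?(ltW s0).
- by rewrite subr_ge0 ltW.
- exact: gauss_diag_lower.
have : `|v - cutsq k (u N a (T - s ^+ 2) y)| <= e.
  apply: (AB (T - s ^+ 2, y)); split => /=.
    by apply: TA; rewrite -ball_normE/= subKr gtr0_norm//; lra.
  by apply: xB; rewrite -ball_normE/= distrC; exact: le_lt_trans sr2.
by rewrite ler_norml => /andP[_]; lra.
Qed.

(** At time 0 the Gaussian is at most T^(-d/2) and [cutsq k] is at most the square, whose integral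
    is given by Parseval. *)
Let energy_upper N a k (T : R) x : 0 < k -> 0 < T ->
  \int[mu]_(y in D) heat_energy_density lam f N a k T x 0 y <=
  expR (- (d%:R / 2) * ln T) * \sum_(n < N) a n ^+ 2.
Proof.
move=> k0 T0.
have E0 : 0 <= expR (- (d%:R / 2) * ln T) by exact: expR_ge0.
have u0 y : u N a 0 y = \sum_(n < N) a n * f n y.
  by apply: eq_bigr => n _; rewrite mulr0 expR0 mulr1.
have C0u : C0 D (fun y => \sum_(n < N) a n * f n y) by exact: C0_sum.
have <- := parseval_sum oD bD fC0 f_on N a.
rewrite /dotL2 -RintegralZl; last 2 first.
- exact: open_row_measurable.
- exact: (C0_integrable oD bD (C0_mul C0u C0u)).
apply: le_Rintegral.
- exact: open_row_measurable.
- exact: (integrable_heat_energy oD bD).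
- exact: (C0_integrable oD bD (C0_scale _ (C0_mul C0u C0u))).
move=> y Dy; rewrite /heat_energy_density subr0; apply: ler_pM.
- exact: expR_ge0.
- exact: cutsq_ge0.
- by rewrite ler_expR gerBl divr_ge0 ?sqdist_ge0// mulr_ge0// ltW.
- by rewrite -u0 -expr2; exact: cutsq_le.
Qed.

Let ultracontractive_pos N a (T : R) x : 0 < T -> D x -> 0 <= u N a T x ->
  c * (u N a T x) ^+ 2 <= expR (- (d%:R / 2) * ln T) * \sum_(n < N) a n ^+ 2.
Proof.
move=> T0 Dx v0; set v := u N a T x in v0 *; set B := (X in _ <= X).
have c0 : 0 < c by rewrite mulr_gt0 ?exprn_gt0 ?expR_gt0.
have H k : 0 < k -> c * cutsq k v <= B.
  move=> k0; apply/ler_addgt0Pr => e e0.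
  have ce0 : 0 < e / c by rewrite divr_gt0.
  have [T1 [T10 T1T low]] := energy_lower N a k0 T0 Dx ce0.
  have nincr := heat_energy_nincr oD bD lam_ge0 fC0 fC2 f_eig N a x k0 T10 T1T.
  have := le_trans low (le_trans nincr (energy_upper N a x k0 T0)).
  rewrite -/v -/B mulrBr lerBlDr => /le_trans; apply.
  by rewrite lerD2l mulrCA divff ?gt_eqF// mulr1.
have [->|vn0] := eqVneq v 0.
  rewrite expr0n mulr0 /B mulr_ge0 ?expR_ge0// sumr_ge0// => n _; exact: sqr_ge0.
have vgt0 : 0 < v by rewrite lt_neqAle eq_sym vn0.
apply/ler_addgt0Pr => e e0.
(* The first bound makes [cutsq_lower] applicable; the second keeps its loss, the cross term
   [4 * c * v * k], below [e]. *)
pose k := Num.min (v / 2) (e / (4 * c * v)).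
have k0 : 0 < k by rewrite lt_min !divr_gt0 ?mulr_gt0.
have kv : 2 * k <= v.
  have : k <= v / 2 by rewrite ge_min lexx.
  lra.
have ke : 4 * c * v * k <= e.
  have : k <= e / (4 * c * v) by rewrite ge_min lexx orbT.
  by rewrite ler_pdivlMr ?mulr_gt0// mulrC.
have := H k k0; have := ler_wpM2l (ltW c0) (cutsq_lower k0 kv).
have -> : c * (v - 2 * k) ^+ 2 = c * v ^+ 2 - 4 * c * v * k + 4 * (c * k ^+ 2) by ring.
have : 0 <= c * k ^+ 2 by rewrite mulr_ge0 ?sqr_ge0 ?ltW.
by move: ke; lra.
Qed.

(** The L^2 to sup-norm bound of the heat semigroup, with a constant depending on [d] alone. As
    [cutsq] sees only positive values, a negative [u] is handled by changing the sign of [a]. *)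
Theorem ultracontractive N a (T : R) x : 0 < T -> D x ->
  2 ^+ d * expR (- d%:R / 4) * (u N a T x) ^+ 2 <=
  expR (- (d%:R / 2) * ln T) * \sum_(n < N) a n ^+ 2.
Proof.
move=> T0 Dx; have [v0|v0] := leP 0 (u N a T x); first exact: ultracontractive_pos.
have E : u N (fun n => - a n) T x = - u N a T x.
  by rewrite -sumrN; apply: eq_bigr => n _; rewrite !mulNr.
have := @ultracontractive_pos N (fun n => - a n) T x T0 Dx.
rewrite E sqrrN; under eq_bigr do rewrite sqrrN.
by apply; rewrite oppr_ge0 ltW.
Qed.

End ultracontractivity.

(** * Spectral bounds *)

Section spectral_bounds.
Context {R : realType} {d : nat} {D : set 'rV[R]_d}.
Local Notation Rd := 'rV[R]_d.
Local Notation mu := (row_lebesgue d).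
Implicit Types (x y : Rd) (t s : R).
Hypotheses (oD : open D) (bD : bounded_set D).
Variables (lam : nat -> R) (f : nat -> Rd -> R).
Hypothesis eig : dirichlet_eigensystem D lam f.

Lemma lam_nd m n : (m <= n)%N -> lam m <= lam n.
Proof.
have [[_ l01] lS _ _] := eig.
move=> /subnK <-; elim: (n - m)%N => // k IH; rewrite addSn; apply: le_trans IH _.
by case: (k + m)%N => [|p]; [exact: ltW|exact: lS].
Qed.

Lemma lam_gt0 n : 0 < lam n.
Proof. by have [[l0 _] _ _ _] := eig; apply: lt_le_trans l0 (lam_nd _). Qed.

Lemma eig_C0 n : C0 D (f n). Proof. by have [_ _ _ /(_ n)[]] := eig. Qed.

Lemma eig_orthonormal m n : dotL2 D (f m) (f n) = (m == n)%:R.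
Proof. by have [_ _ [_ -> _] _] := eig. Qed.

Lemma expR_lnV (c t : R) : 0 < t -> expR (c * ln t^-1) = expR (- c * ln t).
Proof. by move=> t0; rewrite lnV ?posrE// mulrN mulNr. Qed.

Let C1 : R := (2 ^+ d * expR (- d%:R / 4))^-1.

Let C1_ge0 : 0 <= C1.
Proof. by rewrite invr_ge0 mulr_ge0 ?exprn_ge0 ?expR_ge0. Qed.

Lemma heat_diag_bound N t x : 0 < t ->
  \sum_(n < N) expR (- 2 * lam n * t) * f n x ^+ 2 <= C1 * expR (- (d%:R / 2) * ln t).
Proof.
move=> t0; have [Dx|nDx] := pselect (D x); last first.
  rewrite big1; first by rewrite mulr_ge0 ?expR_ge0.
  by move=> n _; rewrite (eig_C0 n).2// expr0n/= mulr0.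
have [_ _ _ fE] := eig.
have := @ultracontractive _ _ _ oD bD lam f (fun n => ltW (lam_gt0 n)) eig_C0
  (fun n => let: And3 a _ _ := fE n in a) eig_orthonormal
  (fun n => let: And3 _ _ c := fE n in c) N (fun n => expR (- lam n * t) * f n x) t x t0 Dx.
have sq n : expR (- 2 * lam n * t) = expR (- lam n * t) ^+ 2.
  by rewrite -expRM_natl; congr expR; ring.
(* The value at [x] and the sum of squared coefficients are now the same number [S], and a bound of
   [S ^+ 2] by a multiple of [S] can be divided by [S]. *)
have -> : eigsum lam f N (fun n => expR (- lam n * t) * f n x) t x =
    \sum_(n < N) expR (- 2 * lam n * t) * f n x ^+ 2.
  by apply: eq_bigr => n _; rewrite sq; ring.
have -> : \sum_(n < N) (expR (- lam n * t) * f n x) ^+ 2 =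
    \sum_(n < N) expR (- 2 * lam n * t) * f n x ^+ 2.
  by apply: eq_bigr => n _; rewrite sq exprMn.
set S := \sum_(n < N) _; set E := expR (- (d%:R / 2) * ln t) => H.
have [S0|S0] := leP S 0; first by apply: le_trans S0 _; rewrite mulr_ge0 ?expR_ge0.
move: H; rewrite expr2 mulrA ler_pM2r// => H.
by rewrite /C1 mulrC ler_pdivlMr ?mulr_gt0 ?exprn_gt0 ?expR_gt0// mulrC.
Qed.

(** Trades lam_n^(d/2) for a natural power, at the cost of a constant depending on [lam 0];
    polynomial control is all that is wanted. *)
Let expR_ln_lam n : expR (d%:R / 2 * ln (lam n)) <= expR (- (d%:R / 2) * ln (lam 0)) * lam n ^+ d.
Proof.
have l0 := lam_gt0 0; have ln0 := lam_gt0 n.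
rewrite -{2}(lnK (x := lam n)) ?posrE// -expRM_natl -expRD ler_expR.
have : ln (lam 0) <= ln (lam n) by rewrite ler_ln ?posrE// lam_nd.
move=> /(ler_wpM2l (_ : 0 <= d%:R / 2 :> R))-/(_ (divr_ge0 (ler0n _ _) (ler0n _ _))).
lra.
Qed.

(** Only the last term of [heat_diag_bound] is kept; at time 1 / lam_n its exponential is e^(-2). *)
Lemma eigenfunction_bound : exists2 C : R, 0 <= C & forall n x, f n x ^+ 2 <= C * lam n ^+ d.
Proof.
exists (expR 2 * C1 * expR (- (d%:R / 2) * ln (lam 0))); first by rewrite !mulr_ge0 ?expR_ge0.
move=> n x; have l0 := lam_gt0 n.
have := @heat_diag_bound n.+1 (lam n)^-1 x; rewrite invr_gt0 => /(_ l0).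
rewrite big_ord_recr/= => /(le_trans _)-/(_ (expR (- 2 * lam n / lam n) * f n x ^+ 2)).
rewrite lerDr sumr_ge0 => [/(_ isT)|m _]; last by rewrite mulr_ge0 ?expR_ge0 ?sqr_ge0.
rewrite expR_lnV// opprK mulfK ?gt_eqF// expRN mulrC ler_pdivrMr ?expR_gt0// => /le_trans; apply.
rewrite [leLHS](_ : _ = expR 2 * C1 * expR (d%:R / 2 * ln (lam n))); last by ring.
rewrite -[leRHS]mulrA; apply: ler_wpM2l; first by rewrite mulr_ge0 ?expR_ge0.
exact: expR_ln_lam.
Qed.

(** Integrated over [D], [heat_diag_bound] bounds a partial heat trace, in which each of the first n
    + 1 terms is at least e^(-2) at time 1 / lam_n. *)
Lemma eigenvalue_growth : exists2 C : R, 0 <= C & forall n, n.+1%:R <= C * lam n ^+ d.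
Proof.
have mD := open_row_measurable oD; set m := fine (mu D).
have m0 : 0 <= m by rewrite fine_ge0.
exists (expR 2 * (C1 * m) * expR (- (d%:R / 2) * ln (lam 0))).
  by rewrite !mulr_ge0 ?expR_ge0.
move=> n; have l0 := lam_gt0 n; set t := (lam n)^-1.
have t0 : 0 < t by rewrite invr_gt0.
have If k : mu.-integrable D (EFin \o (fun x => expR (- 2 * lam k * t) * (f k x * f k x))).
  by apply: (C0_integrable oD bD); apply: C0_scale; apply: C0_mul; exact: eig_C0.
have H : \sum_(k < n.+1) expR (- 2 * lam k * t) <= C1 * expR (- (d%:R / 2) * ln t) * m.
  have -> : \sum_(k < n.+1) expR (- 2 * lam k * t) =
      \int[mu]_(x in D) \sum_(k < n.+1) expR (- 2 * lam k * t) * (f k x * f k x).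
    rewrite Rintegral_sum//; apply: eq_bigr => k _; rewrite RintegralZl//.
      by have := eig_orthonormal k k; rewrite eqxx /dotL2 => ->; rewrite mulr1.
    by apply: (C0_integrable oD bD); apply: C0_mul; exact: eig_C0.
  rewrite -(Rintegral_cst mu mD); apply: le_Rintegral => //.
  - rewrite (_ : EFin \o _ = (fun x => \sum_(k < n.+1) (expR (- 2 * lam k * t) * (f k x * f k
    x))%:E)%E).
      by apply: integrable_sum => // k _; exact: If.
    by apply/funext => x; rewrite sumEFin.
  - by apply: (@bounded_integrable_row _ _ _ _ `|C1 * expR (- (d%:R / 2) * ln t)|) => //; exact:
    measurable_cst.
  - by move=> x Dx; under eq_bigr do rewrite -expr2; exact: heat_diag_bound.
have : \sum_(k < n.+1) expR (- 2) <= \sum_(k < n.+1) expR (- 2 * lam k * t).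
  apply: ler_sum => k _; rewrite ler_expR !mulNr lerN2 -[leRHS]mulr1 -mulrA ler_pM2l//.
  by rewrite ler_pdivrMr// mul1r lam_nd// -ltnS ltn_ord.
move=> /le_trans/(_ H); rewrite sumr_const card_ord -[_ *+ _]mulr_natr expRN.
rewrite mulrC ler_pdivrMr ?expR_gt0// /t expR_lnV// opprK => /le_trans; apply.
rewrite [leLHS](_ : _ = expR 2 * (C1 * m) * expR (d%:R / 2 * ln (lam n))); last by ring.
rewrite -[leRHS]mulrA; apply: ler_wpM2l; first by rewrite !mulr_ge0 ?expR_ge0.
exact: expR_ln_lam.
Qed.

Lemma pow_expR_bounded (k : nat) t : 0 < t ->
  exists2 C : R, 0 <= C & forall s, 0 <= s -> s ^+ k * expR (- s * t) <= C.
Proof.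
move=> t0; have [k0|k0] := posnP k.
  exists 1 => // s s0; rewrite k0 expr0 mul1r -expR0 ler_expR mulNr oppr_le0.
  by rewrite mulr_ge0// ltW.
exists (k`!%:R / t ^+ k); first by rewrite divr_ge0 ?exprn_ge0// ltW.
move=> s s0; rewrite ler_pdivlMr ?exprn_gt0// mulNr expRN mulrAC -exprMn.
rewrite ler_pdivrMr ?expR_gt0//.
have st0 : 0 <= s * t by rewrite mulr_ge0// ltW.
have := expR_ge1Dxn k.-1 st0; rewrite prednK// => H.
rewrite -ler_pdivrMl ?ltr0n ?fact_gt0// mulrC.
by apply: le_trans H; rewrite lerDr.
Qed.

(** Index and eigenfunction are converted into powers of [lam n], namely [d * k] and [d], which the
    exponential absorbs. The factor [1 + f n x ^+ 2] dominates both |f n x| and its square. *)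
Lemma heat_coef_decay (k : nat) t : 0 < t -> exists2 C : R, 0 <= C &
  forall n x, n.+1%:R ^+ k * expR (- lam n * t) * (1 + f n x ^+ 2) <= C.
Proof.
move=> t0; have [C2 C20 fC] := eigenfunction_bound; have [C3 C30 gC] := eigenvalue_growth.
have [C4 C40 eC] := pow_expR_bounded (d * k + d) t0.
have l0 := lam_gt0 0.
exists (C3 ^+ k * ((lam 0 ^+ d)^-1 + C2) * C4).
  by rewrite !mulr_ge0 ?exprn_ge0 ?addr_ge0 ?invr_ge0 ?exprn_ge0// ltW.
move=> n x; have ln0 := lam_gt0 n.
apply: (@le_trans _ _ ((C3 * lam n ^+ d) ^+ k * expR (- lam n * t) *
    (((lam 0 ^+ d)^-1 + C2) * lam n ^+ d))).
  apply: ler_pM; rewrite ?mulr_ge0 ?exprn_ge0 ?expR_ge0 ?addr_ge0 ?sqr_ge0//.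
    rewrite ler_wpM2r ?expR_ge0// lerXn2r ?nnegrE ?mulr_ge0 ?exprn_ge0 ?(ltW ln0)//.
  rewrite mulrDl lerD// mulrC ler_pdivlMr ?exprn_gt0// mul1r.
  by rewrite lerXn2r ?nnegrE ?(ltW ln0) ?(ltW l0)// lam_nd.
rewrite [leLHS](_ : _ = C3 ^+ k * ((lam 0 ^+ d)^-1 + C2) *
  (lam n ^+ (d * k + d) * expR (- lam n * t))); last by rewrite exprD exprM exprMn; ring.
apply: ler_wpM2l; last by apply: eC; exact: ltW.
by rewrite mulr_ge0 ?exprn_ge0 ?addr_ge0 ?invr_ge0 ?exprn_ge0// ltW.
Qed.

Lemma dyadic_scale (l : R) : exists j : nat, l < 4 ^+ j.+1 /\ (j = 0%N \/ 4 ^+ j <= l).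
Proof.
have ex : exists j : nat, l < 4 ^+ j.+1 :> R.
  have [n ln] : exists n : nat, `|l| < n%:R.
    by exists (Num.truncn `|l|).+1; exact: truncnS_gt.
  exists n; apply: le_lt_trans (ler_norm l) (lt_le_trans ln _).
  by rewrite -natrX ler_nat (leq_trans (ltnW (ltn_expl n (isT : 1 < 4)%N)))// leq_pexp2l.
exists (ex_minn ex); case: ex_minnP => -[|j] lj jmin; split=> //; [by left|right].
by rewrite leNgt; apply/negP => /jmin; rewrite ltnn.
Qed.

(* [lam n ^ - b] is dominated by the heat weight at the dyadic time [4 ^ - j]
   comparable to [1 / lam n], whence a geometric series in [j]. *)
Lemma weighted_diag_bound (b : R) : d%:R / 2 < b -> exists C : R,
  forall N x, \sum_(n < N) lam n `^ (- b) * f n x ^+ 2 <= C.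
Proof.
move=> db; have l0 := lam_gt0 0.
have b0 : 0 <= b by apply: ltW (le_lt_trans _ db); exact: divr_ge0.
(* e^8 pays for the heat weight, since lam_n / 4^j <= 4; the maximum covers scale [j = 0], where no
   lower bound on [lam n] beyond [lam 0] is known. *)
pose A : R := expR 8 * Num.max 1 (lam 0 `^ (- b)).
have A0 : 0 <= A by rewrite mulr_ge0 ?expR_ge0// le_max ler01.
pose L : R := ln 4; have L0 : 0 < L by rewrite ln_gt0// ltr1n.
pose q := expR (- (b - d%:R / 2) * L).
have q1 : q < 1 by rewrite expR_lt1 mulNr oppr_lt0 mulr_gt0// subr_gt0.
have q0 : 0 < q by exact: expR_gt0.
pose w (j : nat) := expR (- b * (j%:R * L)).
have powE (l c : R) : 0 < l -> l `^ c = expR (c * ln l) by move=> lp; rewrite /powR gt_eqF.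
have key n : exists j : nat, lam n `^ (- b) <= A * (w j * expR (- 2 * lam n * (4 ^+ j)^-1)).
  have ln0 := lam_gt0 n; have [j [lj jl]] := dyadic_scale (lam n); exists j.
  have j40 : 0 < (4 ^+ j : R) by rewrite exprn_gt0.
  have e8 : 1 <= expR 8 * expR (- 2 * lam n * (4 ^+ j)^-1).
    rewrite -expRD -[X in X <= _]expR0 ler_expR.
    have : lam n / 4 ^+ j <= 4 by rewrite ler_pdivrMr// -exprS ltW.
    lra.
  have mw : lam n `^ (- b) <= Num.max 1 (lam 0 `^ (- b)) * w j.
    rewrite /w; case: jl => [->|jl].
      rewrite mul0r mulr0 expR0 mulr1 le_max; apply/orP; right.
      rewrite !powE// ler_expR !mulNr lerN2 ler_wpM2l// ler_ln ?posrE// lam_nd//.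
    apply: (@le_trans _ _ (1 * w j)); last by rewrite ler_wpM2r ?expR_ge0// le_max lexx.
    rewrite mul1r powE// ler_expR !mulNr lerN2 ler_wpM2l//.
    rewrite /L mulr_natl -lnXn//; rewrite ler_ln ?posrE//.
  apply: le_trans mw _; rewrite /A; set M := Num.max _ _.
  have M0 : 0 <= M by rewrite /M le_max ler01.
  rewrite [leRHS](_ : _ = (expR 8 * expR (- 2 * lam n * (4 ^+ j)^-1)) * (M * w j)); last by ring.
  by rewrite ler_peMl// mulr_ge0// expR_ge0.
have {key}/choice[j jP] := key.
exists (A * C1 / (1 - q)) => N x.
(* Enough scales to contain the one chosen for each [n < N]. Summing over all of them only enlarges
   the sum and allows the two sums to be exchanged. *)
pose M := (\max_(n < N) j n).+1.
apply: (@le_trans _ _ (\sum_(n < N) \sum_(i < M) A * (w i * expR (- 2 * lam n * (4 ^+ i)^-1)) *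
  f n x ^+ 2)).
  apply: ler_sum => n _; rewrite -mulr_suml ler_wpM2r ?sqr_ge0//.
  have jM : (j n < M)%N by rewrite ltnS (leq_bigmax n).
  apply: le_trans (jP n) _; rewrite (bigD1 (Ordinal jM))//= lerDl sumr_ge0// => i _.
  by rewrite !mulr_ge0 ?expR_ge0.
rewrite exchange_big/=.
apply: (@le_trans _ _ (\sum_(i < M) A * C1 * q ^+ i)).
  apply: ler_sum => i _.
  have i40 : 0 < (4 ^+ i : R)^-1 by rewrite invr_gt0 exprn_gt0.
  rewrite (_ : \sum_(n < N) _ = A * w i * \sum_(n < N) expR (- 2 * lam n * (4 ^+ i)^-1) * f n x
    ^+ 2); last first.
    by rewrite mulr_sumr; apply: eq_bigr => n _; ring.
  apply: le_trans (ler_wpM2l _ (heat_diag_bound N x i40)) _.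
    by rewrite mulr_ge0// expR_ge0.
  rewrite expR_lnV ?exprn_gt0// opprK le_eqVlt; apply/orP; left; apply/eqP.
  rewrite /q -expRM_natl /w lnXn// -/L.
  rewrite [LHS](_ : _ = A * C1 * (expR (- b * (i%:R * L)) * expR (d%:R / 2 * (L *+ i)))); last
    by ring.
  by rewrite -expRD; congr (_ * expR _); rewrite -mulr_natl; ring.
rewrite -mulr_sumr ler_wpM2l ?mulr_ge0//.
rewrite -[leRHS]mul1r ler_pdivlMr ?subr_gt0// mulrC.
have := subrX1 q M; rewrite -[1 - q]opprB mulNr => <-.
by rewrite opprB gerBl exprn_ge0// ltW.
Qed.

End spectral_bounds.

(** * The heat kernel in S(D) and the norm of the noise *)

Section inverse_square_series.
Context {R : realType}.
Implicit Types (u : nat -> R) (C : R).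

(** Telescoping: 1 / (m+1)^2 <= 2 (1 / (m+1) - 1 / (m+2)). *)
Lemma inv_sq_tail u C (N m : nat) : (forall n, n.+1%:R ^+ 2 * `|u n| <= C) -> (N <= m)%N ->
  \sum_(N <= n < m) `|u n| <= 2 * C * (N.+1%:R^-1 - m.+1%:R^-1).
Proof.
move=> uC; elim: m => [|m IH]; first by rewrite leqn0 => /eqP ->; rewrite big_geq// subrr mulr0.
rewrite leq_eqVlt => /predU1P[->|]; first by rewrite big_geq// subrr mulr0.
rewrite ltnS => Nm; rewrite big_nat_recr//=.
have m0 : 0 < m.+1%:R :> R by [].
have um : `|u m| <= C / m.+1%:R ^+ 2 by rewrite ler_pdivlMr ?exprn_gt0// mulrC.
apply: le_trans (lerD (IH Nm) um) _.
have C0 : 0 <= C by apply: le_trans (uC 0%N); rewrite mulr_ge0.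
rewrite -subr_ge0.
have E : m.+2%:R = m.+1%:R + 1 :> R by rewrite -natr1.
rewrite [X in 0 <= X](_ : _ = C * (m.+1%:R - 1) / (m.+1%:R ^+ 2 * m.+2%:R)).
  by rewrite divr_ge0 ?mulr_ge0 ?exprn_ge0// subr_ge0 ler1n.
by rewrite E; field; rewrite !gt_eqF// addr_gt0.
Qed.

Lemma inv_sq_series u C : (forall n, n.+1%:R ^+ 2 * `|u n| <= C) ->
  cvgn (series u) /\ forall N, `|limn (series u) - series u N| <= 2 * C / N.+1%:R.
Proof.
move=> uC; have C0 : 0 <= C by apply: le_trans (uC 0%N); rewrite mulr_ge0.
have tail N m : (N <= m)%N -> \sum_(N <= n < m) `|u n| <= 2 * C / N.+1%:R.
  move=> Nm; apply: le_trans (inv_sq_tail uC Nm) _; apply: ler_wpM2l; first exact: mulr_ge0.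
  by rewrite gerBl.
have cu : cvgn (series u).
  suff : cvgn (series (fun n => `|u n|)) by exact: normed_cvg.
  apply: nondecreasing_is_cvgn.
    by apply/nondecreasing_seqP => n; rewrite /series/= big_nat_recr//= lerDl.
  by exists (2 * C / 1) => _ [n _ <-]; exact: tail.
split=> // N.
have cN : `|series u m - series u N| @[m --> \oo] --> `|limn (series u) - series u N|.
  by apply: cvg_norm; apply: cvgB => //; exact: cvg_cst.
rewrite -(cvg_lim _ cN)//; apply: limr_le; first by apply/cvg_ex; eexists; exact: cN.
near=> m; have Nm : (N <= m)%N by near: m; exact: nbhs_infty_ge.
rewrite sub_series_geq//; apply: le_trans (ler_norm_sum _ _ _) _; exact: tail.
Unshelve. all: by end_near. Qed.

Lemma nonneg_series_cvg u C : (forall n, 0 <= u n) -> (forall N, \sum_(n < N) u n <= C) ->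
  cvgn (series u) /\ limn (series u) <= C.
Proof.
move=> u0 uC.
have cu : cvgn (series u).
  apply: nondecreasing_is_cvgn.
    by apply/nondecreasing_seqP => n; rewrite /series/= big_nat_recr//= lerDl.
  by exists C => _ [n _ <-]; rewrite /series/= big_mkord.
by split=> //; apply: limr_le => //; apply: nearW => n; rewrite /series/= big_mkord.
Qed.

Lemma series_cvg_le u N : (forall n, 0 <= u n) -> cvgn (series u) ->
  \sum_(n < N) u n <= limn (series u).
Proof.
move=> u0 cu; rewrite -(big_mkord xpredT u).
apply: (nondecreasing_cvgn_le _ cu).
by apply/nondecreasing_seqP => n; rewrite /series/= big_nat_recr//= lerDl.
Qed.

End inverse_square_series.

Section eigenfunction_expansion.
Context {R : realType} {d : nat} {D : set 'rV[R]_d}.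
Local Notation Rd := 'rV[R]_d.
Local Notation mu := (row_lebesgue d).
Implicit Types (x y : Rd) (t s : R).
Hypotheses (oD : open D) (bD : bounded_set D).
Variables (lam : nat -> R) (f : nat -> Rd -> R).
Hypothesis eig : dirichlet_eigensystem D lam f.
Let fC0 := eig_C0 eig.
Let fon := eig_orthonormal eig.

Section expansion.
Variables (c : nat -> R) (C : R).
Hypothesis cC : forall n y, n.+1%:R ^+ 2 * `|c n * f n y| <= C.

Definition expansion y : R := limn (series (fun n => c n * f n y)).

Lemma expansion_tail N y : `|expansion y - \sum_(n < N) c n * f n y| <= 2 * C / N.+1%:R.
Proof.
have [_ /(_ N)] := inv_sq_series (fun n => cC n y).
by rewrite [series _ N]/series/= big_mkord.
Qed.

(** [cC] is uniform in [y], so the partial sums converge uniformly and continuity passes to the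
    limit. *)
Lemma expansion_C0 : C0 D expansion.
Proof.
have C0' : 0 <= C by apply: le_trans (cC 0%N 0); rewrite mulr_ge0.
split=> [x|x nDx]; last first.
  rewrite /expansion (_ : series _ = cst 0) ?lim_cst//.
  apply/funext => n; rewrite /series/= big1// => i _.
  by rewrite (fC0 i).2// mulr0.
apply/(@cvgrPdist_le _ _ _ (nbhs x)) => e e0.
have [N Ne] : exists N : nat, 2 * C / N.+1%:R <= e / 3.
  have [N] : exists N : nat, 2 * C * (3 / e) < N%:R.
    by exists (Num.truncn (2 * C * (3 / e))).+1; exact: truncnS_gt.
  move=> H; exists N; rewrite ler_pdivrMr// -ler_pdivrMl ?divr_gt0// invf_div mulrC.
  by apply: le_trans (ltW H) _; rewrite ler_nat.
have [cS _] := C0_sum N c fC0.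
have e30 : 0 < e / 3 by rewrite divr_gt0.
have /cvgrPdist_le/(_ _ e30) H := cS x.
near=> y.
have h1 := le_trans (expansion_tail N x) Ne.
have h2 := le_trans (expansion_tail N y) Ne.
have h3 : `|\sum_(n < N) c n * f n x - \sum_(n < N) c n * f n y| <= e / 3 by near: y.
by move: h1 h2 h3; rewrite !ler_norml => /andP[? ?] /andP[? ?] /andP[? ?]; apply/andP; split; lra.
Unshelve. all: by end_near. Qed.

(** Uniform convergence on a set of finite measure lets the integral be taken term by term, up to an
    error below any [e]. *)
Lemma expansion_coef m : dotL2 D expansion (f m) = c m.
Proof.
have [B B0 fB] := C0_bounded bD (fC0 m).
apply/eqP; rewrite -subr_eq0 -normr_le0; apply/ler_addgt0Pr => e e0; rewrite add0r.
set V := fine (mu D); have V0 : 0 <= V by rewrite fine_ge0.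
have C0' : 0 <= C by apply: le_trans (cC 0%N 0); rewrite mulr_ge0.
have [N [mN Ne]] : exists N : nat, (m < N)%N /\ 2 * C / N.+1%:R * B * V <= e.
  have [N] : exists N : nat, 2 * C * B * V / e < N%:R.
    by exists (Num.truncn (2 * C * B * V / e)).+1; exact: truncnS_gt.
  move=> H; exists (maxn N m.+1); split; first exact: leq_maxr.
  rewrite [leLHS](_ : _ = 2 * C * B * V / (maxn N m.+1).+1%:R); last by ring.
  have H' : N%:R <= (maxn N m.+1).+1%:R :> R by rewrite ler_nat leqW// leq_maxl.
  move: H; rewrite ltr_pdivrMr// => H; rewrite ler_pdivrMr//.
  by apply: le_trans (ltW H) _; rewrite mulrC ler_pM2l.
have C0S := C0_sum N c fC0.
have E : c m = dotL2 D (fun x => \sum_(n < N) c n * f n x) (f m).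
  by rewrite (dotL2_sum_basis oD bD fC0 fon) mN.
have C0e := expansion_C0.
have C0d := C0_lin (- 1) C0S C0e.
rewrite {1}E.
have -> : dotL2 D expansion (f m) - dotL2 D (fun x => \sum_(n < N) c n * f n x) (f m) =
    dotL2 D (fun x => - 1 * (\sum_(n < N) c n * f n x) + expansion x) (f m).
  by rewrite (dotL2_lin oD bD)// mulN1r addrC.
apply: le_trans Ne; apply: (dotL2_le_sup oD bD) => // x Dx.
rewrite normrM; apply: ler_pM => //.
by rewrite mulN1r addrC expansion_tail.
Qed.

End expansion.

Lemma heat_coef_bound t x : 0 < t -> exists C : R,
  forall n y, n.+1%:R ^+ 2 * `|(expR (- lam n * t) * f n x) * f n y| <= C.
Proof.
move=> t0; have t20 : 0 < t / 2 by rewrite divr_gt0.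
have [C C0' CP] := heat_coef_decay oD bD eig 1 t20.
exists (C * C) => n y.
have sq z : `|f n z| <= 1 + f n z ^+ 2.
  rewrite -(real_normK (num_real (f n z))); have := sqr_ge0 (`|f n z| - 1); nra.
(* Half of the time absorbs [f n x], the other half [f n y]. *)
have e0 : expR (- lam n * t) = expR (- lam n * (t / 2)) * expR (- lam n * (t / 2)).
  by rewrite -expRD; congr expR; field.
rewrite !normrM (ger0_norm (expR_ge0 _)) e0.
rewrite [leLHS](_ : _ = (n.+1%:R ^+ 1 * expR (- lam n * (t / 2)) * `|f n x|) *
  (n.+1%:R ^+ 1 * expR (- lam n * (t / 2)) * `|f n y|)); last by ring.
by apply: ler_pM; rewrite ?mulr_ge0 ?expR_ge0//; apply: le_trans (CP n _);
  rewrite ler_wpM2l// mulr_ge0 ?expR_ge0.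
Qed.

Lemma heat_kernel_C0 t x : 0 < t -> C0 D (heat_kernel lam f t x).
Proof. by move=> t0; have [C /expansion_C0] := heat_coef_bound x t0. Qed.

Lemma heat_kernel_coef t x n : 0 < t ->
  dotL2 D (heat_kernel lam f t x) (f n) = expR (- lam n * t) * f n x.
Proof. by move=> t0; have [C /expansion_coef] := heat_coef_bound x t0. Qed.

Lemma S_space_heat_kernel t x : 0 < t -> S_space D f (heat_kernel lam f t x).
Proof.
move=> t0; split; first exact: heat_kernel_C0.
(* One power of the index more than required leaves a factor 1 / (n + 1) that tends to 0. *)
move=> k; have [C C0' CP] := heat_coef_decay oD bD eig k.+1 t0.
apply: (@squeeze_cvgr _ _ _ _ (cst 0) (fun n => C * harmonic n)).
- apply: nearW => n; rewrite mulr_ge0//=.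
  rewrite heat_kernel_coef// ler_pdivlMr// mulrAC -exprSr.
  apply: le_trans (CP n x); rewrite normrM ger0_norm ?expR_ge0// mulrA ler_wpM2l ?mulr_ge0
    ?expR_ge0//.
  rewrite -(real_normK (num_real (f n x))); have := sqr_ge0 (`|f n x| - 1); nra.
- exact: cvg_cst.
- by rewrite -[X in _ --> X](mulr0 C); apply: cvgM; [exact: cvg_cst|exact: cvg_harmonic].
Qed.

Lemma S_space_cst0 : S_space D f (cst 0).
Proof.
split; first exact: C0_cst0.
move=> k; rewrite (_ : (fun _ => _) = cst 0); first exact: cvg_cst.
by apply/funext => n; rewrite (dotL2_0 oD) normr0 mulr0.
Qed.

Lemma S_space_lin (a : R) phi psi : S_space D f phi -> S_space D f psi ->
  S_space D f (fun x => a * phi x + psi x).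
Proof.
move=> [C0phi dphi] [C0psi dpsi]; split; first exact: C0_lin.
move=> k; apply: (@squeeze_cvgr _ _ _ _ (cst 0)
  (fun n => `|a| * (n.+1%:R ^+ k * `|dotL2 D phi (f n)|) + n.+1%:R ^+ k * `|dotL2 D psi (f n)|)).
- apply: nearW => n; rewrite mulr_ge0//= (dotL2_lin oD bD)//.
  rewrite mulrCA -mulrDr ler_wpM2l// -normrM; exact: ler_normD.
- exact: cvg_cst.
- rewrite -[X in _ --> X]addr0 -[X in _ --> X + _](mulr0 `|a|).
  by apply: cvgD => //; apply: cvgM => //; exact: cvg_cst.
Qed.

(** [dotH] is a [limn], meaningful only once convergence is known; it follows from Bessel, as the
    weights are at most that of [lam 0]. *)
Lemma dotH_series alpha phi : 0 <= alpha -> C0 D phi ->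
  cvgn (series (fun n => lam n `^ (- alpha) * dotL2 D phi (f n) * dotL2 D phi (f n))) /\
  0 <= dotH D lam f alpha phi phi.
Proof.
move=> a0 C0phi; have l0 := lam_gt0 eig 0.
have w0 n : 0 <= lam n `^ (- alpha) * dotL2 D phi (f n) * dotL2 D phi (f n).
  by rewrite -mulrA mulr_ge0 ?powR_ge0// -expr2 sqr_ge0.
have [|c _] := @nonneg_series_cvg R _ (lam 0 `^ (- alpha) * dotL2 D phi phi) w0.
  move=> N; apply: (@le_trans _ _ (lam 0 `^ (- alpha) * \sum_(n < N) dotL2 D phi (f n) ^+ 2)).
    rewrite mulr_sumr; apply: ler_sum => n _; rewrite -mulrA -expr2 ler_wpM2r ?sqr_ge0//.
    have ln0 := lam_gt0 eig n.
    rewrite /powR !gt_eqF// ler_expR !mulNr lerN2 ler_wpM2l// ler_ln ?posrE//.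
    exact: (lam_nd eig).
  rewrite ler_wpM2l ?powR_ge0//; exact: (bessel oD bD fC0 fon).
split=> //; rewrite /dotH; apply: le_trans (series_cvg_le 0 w0 c).
by rewrite big_ord0.
Qed.

End eigenfunction_expansion.

(** * Time integral of the squared norm, and measurability in time *)

Section noise_norm.
Context {R : realType} {d : nat} {D : set 'rV[R]_d}.
Local Notation Rd := 'rV[R]_d.
Implicit Types (x y : Rd) (s : R).
Hypotheses (oD : open D) (bD : bounded_set D).
Variables (lam : nat -> R) (f : nat -> Rd -> R).
Hypothesis eig : dirichlet_eigensystem D lam f.
Variables (alpha : R) (H : completeNormedModType R) (iota : (Rd -> R) -> H).
Hypotheses (alpha0 : 0 < alpha) (Hc : is_completion D lam f alpha iota).

Lemma iota_norm phi : S_space D f phi -> `|iota phi| ^+ 2 = dotH D lam f alpha phi phi.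
Proof.
move=> Sphi; have [_ -> // _] := Hc; rewrite sqr_sqrtr//.
by have [] := dotH_series oD bD eig (ltW alpha0) Sphi.1.
Qed.

Lemma iota_lin (a : R) phi psi : S_space D f phi -> S_space D f psi ->
  iota (fun x => a * phi x + psi x) = a *: iota phi + iota psi.
Proof. by move=> ? ?; have [-> //] := Hc. Qed.

Lemma iota0 : iota (cst 0) = 0.
Proof.
apply/eqP; rewrite -normr_eq0 -sqrf_eq0; apply/eqP.
rewrite (iota_norm (S_space_cst0 oD f)) /dotH (_ : series _ = cst 0) ?lim_cst//.
by apply/funext => n; rewrite /series/= big1// => i _; rewrite (dotL2_0 oD) mulr0.
Qed.

Section fixed_point.
Variables (t : R) (x : Rd) (t0 : 0 < t).

Lemma p_kernel_in s : 0 < s -> s < t -> p_kernel lam f t x s = heat_kernel lam f (t - s) x.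
Proof.
move=> s0 st; apply/funext => y; rewrite /p_kernel indicE mem_set ?mulr1//=.
by rewrite in_itv/= s0.
Qed.

Lemma p_kernel_out s : t <= s -> p_kernel lam f t x s = cst 0.
Proof.
move=> ts; apply/funext => y; rewrite /p_kernel indicE memNset ?mulr0//=.
by rewrite in_itv/= [s < t]ltNge ts andbF.
Qed.

Lemma S_space_p_kernel s : 0 < s -> S_space D f (p_kernel lam f t x s).
Proof.
move=> s0; have [ts|st] := leP t s; first by rewrite p_kernel_out//; exact: S_space_cst0.
by rewrite p_kernel_in//; apply: (S_space_heat_kernel oD bD eig); rewrite subr_gt0.
Qed.

Let h s := iota (p_kernel lam f t x s).

(** The n-th term of the squared H^alpha norm of [p_kernel] for [0 < s < t]. *)
Definition noise_weight n s : R := lam n `^ (- alpha) * (expR (- 2 * lam n * (t - s)) * f n x ^+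
  2).

Lemma noise_weight_ge0 n s : 0 <= noise_weight n s.
Proof. by apply: mulr_ge0; [exact: powR_ge0|apply: mulr_ge0; [exact: expR_ge0|exact: sqr_ge0]].
  Qed.

Lemma norm_h s : 0 < s -> s < t ->
  ((`|h s| ^+ 2)%:E = \sum_(n <oo) (noise_weight n s)%:E)%E.
Proof.
move=> s0 st; have ts0 : 0 < t - s by rewrite subr_gt0.
have E n : lam n `^ (- alpha) * dotL2 D (p_kernel lam f t x s) (f n) *
    dotL2 D (p_kernel lam f t x s) (f n) = noise_weight n s.
  rewrite p_kernel_in// (heat_kernel_coef oD bD eig)// /noise_weight.
  have -> : expR (- 2 * lam n * (t - s)) = expR (- lam n * (t - s)) ^+ 2.
    by rewrite -expRM_natl; congr expR; ring.
  by ring.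
rewrite /h iota_norm; last exact: S_space_p_kernel.
have [cv _] := dotH_series oD bD eig (ltW alpha0) (S_space_p_kernel s0).1.
move: cv; rewrite /dotH; under eq_fun do rewrite E; move=> cv.
rewrite -EFin_lim//; congr (limn _); apply/funext => N.
by rewrite /series/= sumEFin.
Qed.

Lemma integral_noise_weight n :
  (\int[lebesgue_measure]_(s in `]0%R, t[) (noise_weight n s)%:E =
   (lam n `^ (- alpha) * f n x ^+ 2 * ((1 - expR (- 2 * lam n * t)) / (2 * lam n)))%:E)%E.
Proof.
have ln0 := lam_gt0 eig n.
pose c := lam n `^ (- alpha) * f n x ^+ 2 * expR (- 2 * lam n * t).
have wE : noise_weight n = (fun s => c * expR (2 * lam n * s)).
  apply/funext => s; rewrite /noise_weight /c -[RHS]mulrA -expRD mulrA mulrAC.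
  by congr (_ * expR _); ring.
have dw (a s : R) : is_derive s 1 (fun s => a * expR (2 * lam n * s)) (2 * lam n * a * expR (2 *
  lam n * s)).
  exact: is_derive_expRM.
have cw : continuous (noise_weight n).
  by rewrite wE => s; apply/differentiable_continuous/derivable1_diffP; have [] := dw c s.
have mw : measurable_fun setT (EFin \o noise_weight n).
  by apply/measurable_EFinP; exact: continuous_measurable_fun.
rewrite integral_itv_obnd_cbnd; last exact: measurable_funTS.
rewrite integral_itv_bndo_bndc; last exact: measurable_funTS.
pose F s := c / (2 * lam n) * expR (2 * lam n * s).
have FC : continuous F.
  by move=> s; apply/differentiable_continuous/derivable1_diffP; have [] := dw (c / (2 * lam n))
    s.
rewrite (@continuous_FTC2 _ _ F)//.
- rewrite -EFinB /F; congr EFin; rewrite mulr0 expR0.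
  have e1 : expR (- 2 * lam n * t) * expR (2 * lam n * t) = 1.
    by rewrite -expRD -[RHS]expR0; congr expR; ring.
  rewrite /c.
  rewrite [LHS](_ : _ = lam n `^ (- alpha) * f n x ^+ 2 *
     (expR (- 2 * lam n * t) * expR (2 * lam n * t) - expR (- 2 * lam n * t)) / (2 * lam n));
       last by ring.
  by rewrite e1 -[LHS]mulrA.
- exact: continuous_subspaceT.
- split => [s _||].
  + by have [] := dw (c / (2 * lam n)) s.
  + by apply: cvg_at_right_filter; exact: FC.
  + by apply: cvg_at_left_filter; exact: FC.
- move=> s _; rewrite derive1E wE.
  have dF := dw (c / (2 * lam n)) s; rewrite -[LHS]/('D_1 (fun s => c / (2 * lam n) * expR (2 *
    lam n * s)) s).
  by rewrite derive_val; field; rewrite gt_eqF.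
Qed.

Lemma integral_norm_h :
  (\int[lebesgue_measure]_(s in `]0%R, +oo[) (`|h s| ^+ 2)%:E =
   \sum_(n <oo) (lam n `^ (- alpha) * f n x ^+ 2 * ((1 - expR (- 2 * lam n * t)) / (2 * lam
     n)))%:E)%E.
Proof.
transitivity (\int[lebesgue_measure]_(s in `]0%R, t[) (`|h s| ^+ 2)%:E)%E.
  rewrite [LHS]integral_mkcond [RHS]integral_mkcond; apply: eq_integral => s _.
  rewrite !patchE; case: ifPn => [|nA].
    rewrite inE/= in_itv/= andbT => s0; case: ifPn => // nst.
    have ts : t <= s by move: nst; rewrite notin_setE/= in_itv/= s0/= => /negP; rewrite -leNgt.
    by rewrite /h p_kernel_out// iota0 normr0 expr0n.
  case: ifPn => //; rewrite inE/= in_itv/= => /andP[s0 _].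
  by move: nA; rewrite notin_setE/= in_itv/= s0.
transitivity (\int[lebesgue_measure]_(s in `]0%R, t[) \sum_(n <oo) (noise_weight n s)%:E)%E.
  by apply: eq_integral => s; rewrite inE/= in_itv/= => /andP[s0 st]; exact: norm_h.
rewrite integral_nneseries//.
- by apply: eq_eseriesr => n _; exact: integral_noise_weight.
- move=> n; apply/measurable_EFinP; apply: measurable_funTS; apply: continuous_measurable_fun.
  rewrite (_ : noise_weight n = (fun s => lam n `^ (- alpha) * f n x ^+ 2 *
      expR (- 2 * lam n * t) * expR (2 * lam n * s))).
    move=> s; apply/differentiable_continuous/derivable1_diffP.
    by have [] := is_derive_expRM (2 * lam n) (lam n `^ (- alpha) * f n x ^+ 2 * expR (- 2 * lam
      n * t)) s.
  apply/funext => s; rewrite /noise_weight -[RHS]mulrA -expRD mulrA mulrAC.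
  by congr (_ * expR _); ring.
- by move=> n s _; rewrite lee_fin noise_weight_ge0.
Qed.

(** The factor 1 - e^(-2 lam_n t) lies between its value at [n = 0], which is positive, and 1, so
    the time [t] drops out of the criterion. *)
Lemma integral_norm_h_lty :
  (\int[lebesgue_measure]_(s in `]0%R, +oo[) (`|h s| ^+ 2)%:E < +oo)%E <->
  exists C : R, forall N, \sum_(n < N) lam n `^ (- (1 + alpha)) * f n x ^+ 2 <= C.
Proof.
rewrite integral_norm_h.
pose v n := lam n `^ (- alpha) * f n x ^+ 2 * ((1 - expR (- 2 * lam n * t)) / (2 * lam n)).
rewrite -[X in (X < _)%E]/(\sum_(n <oo) (v n)%:E)%E.
have v0 n : 0 <= v n.
  have ln0 := lam_gt0 eig n.
  apply: mulr_ge0; first by apply: mulr_ge0; [exact: powR_ge0|exact: sqr_ge0].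
  apply: divr_ge0; last by rewrite mulr_ge0// ltW.
  by rewrite subr_ge0 expR_le1 !mulNr oppr_le0 !mulr_ge0// ltW.
have vE n : v n = 2^-1 * (1 - expR (- 2 * lam n * t)) * (lam n `^ (- (1 + alpha)) * f n x ^+ 2).
  have ln0 := lam_gt0 eig n.
  have -> : lam n `^ (- (1 + alpha)) = (lam n)^-1 * lam n `^ (- alpha).
    rewrite -(powR_inv1 (ltW ln0)) -powRD ?opprD//.
    by apply/implyP => _; rewrite gt_eqF.
  by rewrite /v; field; rewrite gt_eqF.
have w0 n : 0 <= lam n `^ (- (1 + alpha)) * f n x ^+ 2 by rewrite mulr_ge0 ?powR_ge0 ?sqr_ge0.
split=> [vy|[C hC]].
- have [r ve] : exists r : R, (\sum_(n <oo) (v n)%:E = r%:E)%E.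
    exists (fine (\sum_(n <oo) (v n)%:E)%E); rewrite fineK// ge0_fin_numE//.
    by apply: nneseries_ge0 => n _ _; rewrite lee_fin.
  pose c := 2^-1 * (1 - expR (- 2 * lam 0 * t)).
  have c0 : 0 < c.
    by rewrite mulr_gt0// subr_gt0 expR_lt1 !mulNr oppr_lt0 !mulr_gt0// (lam_gt0 eig).
  exists (r / c) => N; rewrite ler_pdivlMr// -lee_fin -ve.
  have vE0 n : (0 <= n)%N -> xpredT n -> (0 <= (v n)%:E)%E by move=> _ _; rewrite lee_fin.
  apply: le_trans (nneseries_lim_ge N vE0).
  rewrite sumEFin lee_fin big_mkord mulr_suml; apply: ler_sum => n _.
  rewrite vE mulrC ler_wpM2r// /c ler_wpM2l// lerB// ler_expR !mulNr lerN2 -!mulrA.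
  by rewrite ler_wpM2l// ler_wpM2r ?(ltW t0)// (lam_nd eig).
- apply: (@le_lt_trans _ _ C%:E); last exact: ltry.
  apply: lime_le; first by apply: is_cvg_nneseries => n _ _; rewrite lee_fin.
  apply: nearW => N; rewrite sumEFin lee_fin big_mkord; apply: le_trans (hC N).
  apply: ler_sum => n _; rewrite vE -[leRHS]mul1r ler_wpM2r//.
  by have := expR_ge0 (- 2 * lam n * t); lra.
Qed.

Lemma expR_decay_lipschitz (l a b c : R) : 0 <= l -> c <= a -> c <= b ->
  `|expR (- l * a) - expR (- l * b)| <= l * `|a - b| * expR (- l * c).
Proof.
move=> l0; wlog ab : a b / a <= b => [W ca cb|ca cb].
  have [ab|ba] := leP a b; first exact: W.
  by rewrite distrC [`|a - b|]distrC; apply: W => //; exact: ltW.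
rewrite ger0_norm; last by rewrite subr_ge0 ler_expR !mulNr lerN2 ler_wpM2l.
rewrite ler0_norm ?subr_le0// opprB.
have -> : expR (- l * b) = expR (- l * a) * expR (- l * (b - a)).
  by rewrite -expRD; congr expR; ring.
rewrite -[X in X - _]mulr1 -mulrBr mulrC; apply: ler_pM.
- by rewrite subr_ge0 expR_le1 mulNr oppr_le0 mulr_ge0// subr_ge0.
- exact: expR_ge0.
- by have := expR_ge1Dx (- l * (b - a)); lra.
- by rewrite ler_expR !mulNr lerN2 ler_wpM2l.
Qed.

(** At distance [c] from the singular time [t] the heat factor e^(-lam_n c) damps the factor [lam n]
    produced by a time difference. This yields continuity, then measurability, of [h]. *)
Lemma h_lipschitz (c : R) : 0 < c -> exists2 C : R, 0 <= C &
  forall s s', 0 < s -> s < t - c -> 0 < s' -> s' < t - c -> `|h s - h s'| ^+ 2 <= C * `|s - s'|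
    ^+ 2.
Proof.
move=> c0; have l0 := lam_gt0 eig 0.
have [C1 C10 H1] := heat_coef_decay oD bD eig 2 c0.
have [C2 C20 H2] := pow_expR_bounded 2 c0.
pose A := lam 0 `^ (- alpha) * C2 * C1.
have A0 : 0 <= A by rewrite !mulr_ge0// powR_ge0.
exists (2 * A); first exact: mulr_ge0.
move=> s s' s0 sc s'0 s'c.
have st : s < t by apply: lt_trans sc _; rewrite gtrBl.
have s't : s' < t by apply: lt_trans s'c _; rewrite gtrBl.
have S1 := S_space_p_kernel s0; have S2 := S_space_p_kernel s'0.
pose psi y : R := - 1 * p_kernel lam f t x s' y + p_kernel lam f t x s y.
have Spsi : S_space D f psi := S_space_lin oD bD eig (- 1) S2 S1.
have -> : h s - h s' = iota psi by rewrite /psi iota_lin// scaleN1r addrC.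
rewrite iota_norm//.
have co n : dotL2 D psi (f n) = (expR (- lam n * (t - s)) - expR (- lam n * (t - s'))) * f n x.
  rewrite (dotL2_lin oD bD (- 1) S2.1 S1.1 (eig_C0 eig n)).
  rewrite !p_kernel_in// !(heat_kernel_coef oD bD eig) ?subr_gt0//.
  by rewrite mulN1r mulrBl addrC.
pose w n := lam n `^ (- alpha) * dotL2 D psi (f n) * dotL2 D psi (f n).
have wb n : n.+1%:R ^+ 2 * `|w n| <= A * `|s - s'| ^+ 2.
  have ln0 := lam_gt0 eig n.
  have := @expR_decay_lipschitz (lam n) (t - s) (t - s') c (ltW ln0).
  rewrite (_ : t - s - (t - s') = - (s - s')); last by ring.
  rewrite normrN => hl.
  have ct : c <= t - s by lra.
  have ct' : c <= t - s' by lra.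
  have {ct ct'}hl := hl ct ct'.
  have -> : `|w n| = lam n `^ (- alpha) * (`|expR (- lam n * (t - s)) - expR (- lam n * (t -
    s'))| ^+ 2 * f n x ^+ 2).
    rewrite /w co !normrM ger0_norm ?powR_ge0//.
    by rewrite -(real_normK (num_real (f n x))); ring.
  have la : lam n `^ (- alpha) <= lam 0 `^ (- alpha).
    rewrite /powR !gt_eqF// ler_expR !mulNr lerN2 ler_wpM2l ?(ltW alpha0)// ler_ln ?posrE//.
    exact: (lam_nd eig).
  have hl2 : `|expR (- lam n * (t - s)) - expR (- lam n * (t - s'))| ^+ 2 <=
      (lam n * `|s - s'| * expR (- lam n * c)) ^+ 2.
    by rewrite lerXn2r ?nnegrE ?mulr_ge0 ?expR_ge0 ?(ltW ln0).
  apply: (@le_trans _ _ (n.+1%:R ^+ 2 * (lam 0 `^ (- alpha) *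
      ((lam n * `|s - s'| * expR (- lam n * c)) ^+ 2 * f n x ^+ 2)))).
    apply: ler_wpM2l; first exact: exprn_ge0.
    apply: ler_pM => //; first exact: powR_ge0.
      by apply: mulr_ge0; [exact: exprn_ge0|exact: sqr_ge0].
    by apply: ler_wpM2r => //; exact: sqr_ge0.
  (* The squared exponential is shared: one factor bounds [lam n ^+ 2], the other the index and the
     eigenfunction. *)
  rewrite [leLHS](_ : _ = lam 0 `^ (- alpha) * (lam n ^+ 2 * expR (- lam n * c)) *
    (n.+1%:R ^+ 2 * expR (- lam n * c) * f n x ^+ 2) * `|s - s'| ^+ 2); last by ring.
  rewrite ler_wpM2r ?exprn_ge0// /A; apply: ler_pM.
  - by rewrite !mulr_ge0 ?powR_ge0 ?exprn_ge0 ?expR_ge0 ?(ltW ln0).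
  - by apply: mulr_ge0; [rewrite mulr_ge0 ?exprn_ge0 ?expR_ge0|exact: sqr_ge0].
  - by rewrite ler_wpM2l ?powR_ge0//; apply: H2; exact: ltW.
  - apply: le_trans (H1 n x); rewrite ler_wpM2l ?mulr_ge0 ?exprn_ge0 ?expR_ge0//.
    by rewrite lerDr.
have [_ /(_ 0%N)] := inv_sq_series wb.
rewrite [series _ 0%N]/series/= big_geq// subr0 divr1 => /(le_trans (ler_norm _)).
by rewrite mulrA.
Qed.

Lemma h_continuous s : 0 < s -> s < t -> {for s, continuous h}.
Proof.
move=> s0 st; pose c := (t - s) / 2; have c0 : 0 < c by rewrite divr_gt0// subr_gt0.
have [C C0' HC] := h_lipschitz c0.
have sc : s < t - c by rewrite /c; lra.
apply/(@cvgrPdist_le _ _ _ (nbhs s)) => e e0.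
pose del := e / (C + 1).
have C1 : 0 < C + 1 by rewrite ltr_wpDl.
have del0 : 0 < Num.min del e by rewrite lt_min divr_gt0.
near=> s'.
have s'0 : 0 < s' by near: s'; exact: lt_nbhsr.
have s'c : s' < t - c by near: s'; exact: lt_nbhsl.
have sd : `|s - s'| <= e / Num.sqrt (C + 1).
  near: s'; apply: cvgr_dist_le; first exact: cvg_id.
  by rewrite divr_gt0// sqrtr_gt0.
rewrite -(@ler_pXn2r _ 2)// ?nnegrE ?(ltW e0)//.
apply: le_trans (HC _ _ s0 sc s'0 s'c) _.
apply: (@le_trans _ _ (C * (e / Num.sqrt (C + 1)) ^+ 2)).
  by rewrite ler_wpM2l// lerXn2r ?nnegrE ?divr_ge0 ?sqrtr_ge0 ?(ltW e0).
rewrite expr_div_n sqr_sqrtr ?(ltW C1)// mulrCA ler_piMr ?exprn_ge0 ?(ltW e0)//.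
by rewrite ler_pdivrMr// mul1r lerDl.
Unshelve. all: by end_near. Qed.

(** [h] is continuous on []0, t[] and 0 from [t] on, so a preimage is an open set together with all
    or nothing of [[t, +oo[]. *)
Lemma h_measurable :
  measurable_fun (`]0, +oo[ : set R) (h : R -> g_sigma_algebraType (@open H)).
Proof.
apply: (@measurability _ _ R (g_sigma_algebraType (@open H)) _ _ (@open H)) => //.
move=> _ [U oU <-].
have -> : `]0, +oo[%classic `&` h @^-1` U =
    (`]0, t[%classic `&` h @^-1` U) `|` (`[t, +oo[%classic `&` h @^-1` U).
  apply/seteqP; split=> s /=; rewrite !in_itv/= ?andbT.
    by move=> [s0 Us]; have [st|ts] := ltP s t; [left; rewrite s0|right].
  by move=> [[/andP[s0 _] Us]|[ts Us]]; split => //; exact: lt_le_trans ts.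
apply: measurableU.
  apply: open_measurable; rewrite openE => s /=; rewrite in_itv/= => -[/andP[s0 st] Us].
  near=> s'; split; last first.
    near: s'; apply: (h_continuous s0 st); exact: open_nbhs_nbhs.
  by rewrite /= in_itv/=; apply/andP; split; near: s'; [exact: lt_nbhsr|exact: lt_nbhsl].
have [U0|nU0] := pselect (U 0).
  rewrite (_ : _ `&` _ = `[t, +oo[%classic); first exact: measurable_itv.
  apply/seteqP; split=> s /=; first by case.
  by move=> ts; split=> //; rewrite /h p_kernel_out ?iota0//; move: ts; rewrite in_itv/= andbT.
rewrite (_ : _ `&` _ = set0)// -subset0 => s /= [ts].
by rewrite /h p_kernel_out ?iota0//; move: ts; rewrite in_itv/= andbT.
Unshelve. all: by end_near. Qed.

(** Membership in S(D) and measurability always hold, so square integrability alone decides. *)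
Lemma p_in_HalphaE : p_in_Halpha D lam f iota t x <->
  exists C : R, forall N, \sum_(n < N) lam n `^ (- (1 + alpha)) * f n x ^+ 2 <= C.
Proof.
rewrite -integral_norm_h_lty; split=> [[_ [_]] //|hy].
by split=> [s s0|]; [exact: S_space_p_kernel|split; [exact: h_measurable|exact: hy]].
Qed.

End fixed_point.
End noise_norm.

(** * Divergence at and below the critical exponent *)

Section bump.
Context {R : realType} {d : nat}.
Local Notation Rd := 'rV[R]_d.
Local Notation mu := (row_lebesgue d).
Implicit Types (p r : {poly R}) (x y : Rd) (e : R).

(** The order of vanishing of [p] at 0 is the smoothness across the sphere of radius [e]. Up to
    scaling, the Laplacian acts on such functions through an operator on polynomials, so its powers
    need no higher derivatives on R^d. *)
Definition bump p x e y : R := p.[Num.max (1 - sqdist x y / e ^+ 2) 0].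

(* The Laplacian of [p(1 - |y - x|^2)] is [(radial_laplacian p)(1 - |y - x|^2)]. *)
Definition radial_laplacian p : {poly R} :=
  (4 *: (1 - 'X)) * p^`()^`() - (2 * d%:R) *: p^`().

Definition vanish_order (k : nat) p : Prop := exists r, p = r * 'X^k.

Lemma vanish_order_deriv k p : vanish_order k.+1 p -> vanish_order k p^`().
Proof.
move=> [r ->]; exists (r^`() * 'X + r *+ k.+1).
by rewrite derivM derivXn /= mulrDl exprS mulrA mulrnAl mulrnAr.
Qed.

Lemma vanish_order_le j k p : (j <= k)%N -> vanish_order k p -> vanish_order j p.
Proof.
by move=> jk [r ->]; exists (r * 'X^(k - j)); rewrite -mulrA -exprD subnK.
Qed.

Lemma vanish_order_radial k p : vanish_order k.+2 p -> vanish_order k (radial_laplacian p).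
Proof.
move=> vp; have v1 := vanish_order_deriv vp.
have [r2 E2] := vanish_order_deriv v1; have [r1 E1] := vanish_order_le (leqnSn k) v1.
exists ((4 *: (1 - 'X)) * r2 - (2 * d%:R) *: r1).
by rewrite /radial_laplacian E2 E1 mulrBl mulrA; congr (_ - _); rewrite scalerAl.
Qed.

Lemma vanish_order_horner k p : vanish_order k.+1 p -> p.[0] = 0.
Proof. by move=> [r ->]; rewrite hornerM hornerXn expr0n mulr0. Qed.

Lemma bump_continuous p x e : continuous (bump p x e).
Proof.
move=> y; apply: (@continuous_comp Rd R R (fun y => Num.max (1 - sqdist x y / e ^+ 2) 0) (horner
  p)).
  apply: (@continuous_comp Rd R R (fun y => 1 - sqdist x y / e ^+ 2) (fun s => Num.max s 0)).
    apply: (@continuousB R R Rd (cst 1) (fun y => sqdist x y / e ^+ 2)); first exact: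
      cst_continuous.
    apply: (@continuousM R Rd (sqdist x) (cst (e ^+ 2)^-1)); last exact: cst_continuous.
    by have [] := @is_C2_sqdist R d setT x y I.
  exact: continuous_max0.
exact: continuous_horner.
Qed.

Lemma bump_vanish k p x e y : 0 < e -> vanish_order k.+1 p -> ~ (sqdist x y <= e ^+ 2) ->
  bump p x e y = 0.
Proof.
move=> e0 vp /negP; rewrite -ltNge => ye.
rewrite /bump max_r; first exact: vanish_order_horner vp.
by rewrite subr_le0 ler_pdivlMr ?exprn_gt0// mul1r ltW.
Qed.

Lemma bump_bounded p : exists2 C : R, 0 <= C & forall x e y, `|bump p x e y| <= C.
Proof.
exists (\sum_(i < size p) `|p`_i|); first exact: sumr_ge0.
move=> x e y; rewrite /bump; set z := Num.max _ _.
have z0 : 0 <= z by rewrite le_max lexx orbT.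
have z1 : z <= 1.
  by rewrite ge_max ler01 andbT gerBl divr_ge0 ?sqdist_ge0// sqr_ge0.
rewrite horner_coef; apply: le_trans (ler_norm_sum _ _ _) _; apply: ler_sum => i _.
by rewrite normrM ler_piMr// ger0_norm ?exprn_ge0// exprn_ile1.
Qed.

Lemma bump_laplacian p x e : 0 < e -> vanish_order 3 p ->
  C2_on setT (bump p x e) /\
  forall y, laplacian (bump p x e) y = e ^- 2 * bump (radial_laplacian p) x e y.
Proof.
move=> e0 v3; have v2 := vanish_order_deriv v3; have v1 := vanish_order_deriv v2.
pose a : R := e ^- 2; have a0 : 0 < a by rewrite invr_gt0 exprn_gt0.
have key (q : {poly R}) (s : R) : q.[0] = 0 -> q^`().[0] = 0 ->
    is_derive s 1 (fun s => q.[Num.max (1 - s * a) 0]) (- a * q^`().[Num.max (1 - s * a) 0]).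
  move=> q0 q'0.
  have dm := @is_derive_max0 R (horner q) (horner q^`()) (fun s _ => is_derive_poly q s) q0 q'0
    (1 - s * a).
  have dl : is_derive s 1 (fun s : R => 1 - s * a) (- a).
    rewrite -[X in is_derive _ _ _ X]add0r; apply: (@is_deriveB R R R (cst 1) (fun s : R => s *
      a)).
    rewrite (_ : (fun s => s * a) = a *: id); last by apply/funext => h; rewrite /GRing.scale/=
      mulrC.
    by rewrite -[X in is_derive _ _ _ X]mulr1; exact: (@is_deriveZ _ _ _ id).
  have H := @is_derive1_comp R (fun s => q.[Num.max s 0]) (fun s => 1 - s * a) s _ _ dm dl.
  by apply: (is_derive_eq H); rewrite mulrC.
have p00 := vanish_order_horner v3; have p10 := vanish_order_horner v2; have p20 :=
  vanish_order_horner v1.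
pose phi1 (s : R) := - a * p^`().[Num.max (1 - s * a) 0].
pose phi2 (s : R) := - a * (- a * p^`()^`().[Num.max (1 - s * a) 0]).
have d1 (s : R) := key p s p00 p10.
have d2 (s : R) : is_derive s 1 phi1 (phi2 s) by exact: (is_deriveZ (- a) (key _ s p10 p20)).
have c2 : continuous phi2.
  move=> s; apply: (@continuousM R R (cst (- a)) (fun s => - a * p^`()^`().[Num.max (1 - s * a)
    0])).
    exact: cst_continuous.
  apply: (@continuousM R R (cst (- a)) (fun s => p^`()^`().[Num.max (1 - s * a) 0])).
    exact: cst_continuous.
  apply: (@continuous_comp R R R (fun s => Num.max (1 - s * a) 0) (horner p^`()^`())).
    apply: (@continuous_comp R R R (fun s => 1 - s * a) (fun s => Num.max s 0)).
      apply: (@continuousB R R R (cst 1) (fun s => s * a)); first exact: cst_continuous.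
      apply: (@continuousM R R id (cst a)); last exact: cst_continuous.
      exact: cvg_id.
    exact: continuous_max0.
  exact: continuous_horner.
have [C2 lapE] := radial_C2 x openT d1 d2 c2.
split; first exact: C2.
move=> y; rewrite [LHS](lapE y I) /phi1 /phi2 /bump -/a.
set z := Num.max _ _.
have -> : (radial_laplacian p).[z] = 4 * (1 - z) * p^`()^`().[z] - 2 * d%:R * p^`().[z].
  by rewrite /radial_laplacian !hornerE.
have [sa|sa] := leP (1 - sqdist x y * a) 0.
  have -> : z = 0 by rewrite /z max_r.
  by rewrite p10 p20; ring.
(* Where the truncation is inactive the squared distance is recovered from [z], turning the radial
   formula into a polynomial in [z]. *)
have -> : sqdist x y = a^-1 * (1 - z).
  by rewrite /z max_l ?(ltW sa)//; field; rewrite gt_eqF.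
by field; rewrite gt_eqF.
Qed.

End bump.

Lemma Rintegral_le_cst (R : realType) dsp (T : measurableType dsp) (mu : {measure set T -> \bar
  R})
    (D A : set T) (g : T -> R) (c m : R) : measurable D -> measurable A -> A `<=` D ->
  mu.-integrable D (EFin \o g) -> (forall x, ~ A x -> g x = 0) -> mu A = m%:E ->
  (forall x, A x -> g x <= c) -> \int[mu]_(x in D) g x <= c * m.
Proof.
move=> mD mA AD ig g0 muA gc.
have -> : \int[mu]_(x in D) g x = \int[mu]_(x in A) g x.
  rewrite Rintegral_mkcond [RHS]Rintegral_mkcond; congr Rintegral; apply/funext => x.
  rewrite !patchE; case: ifPn => xD; case: ifPn => //.
    by rewrite notin_setE => /g0.
  by rewrite inE => /AD; rewrite notin_setE in xD.
have -> : m = fine (mu A) by rewrite muA.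
rewrite -Rintegral_cst//; apply: le_Rintegral => //.
  exact: integrableS ig.
apply/integrableP; split; first exact: measurable_cst.
by rewrite integral_cst// muA -EFinM ltry.
Qed.

Section lower_bound.
Context {R : realType} {d : nat} {D : set 'rV[R]_d}.
Local Notation Rd := 'rV[R]_d.
Local Notation mu := (row_lebesgue d).
Implicit Types (x y : Rd).
Hypotheses (oD : open D) (bD : bounded_set D).
Variables (lam : nat -> R) (f : nat -> Rd -> R).
Hypothesis eig : dirichlet_eigensystem D lam f.
Let fC0 := eig_C0 eig.
Let fon := eig_orthonormal eig.

(** Completeness of the basis gives a zero L^2 norm. Were psi(x) nonzero, |psi| would exceed half of
    |psi(x)| on a small cube of positive measure. *)
Lemma C0_coef_eq0 psi : C0 D psi -> (forall n, dotL2 D psi (f n) = 0) ->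
  forall x, D x -> psi x = 0.
Proof.
move=> C0psi psi0 x Dx; have mD := open_row_measurable oD.
have [_ _ [_ _ /(_ psi (C0_L2 oD bD C0psi)) cv] _] := eig.
have I0 : (\int[mu]_(y in D) ((psi y) ^+ 2)%:E = 0)%E.
  apply: (cvg_unique _ _ cv) => //; apply: cvg_near_cst; apply: nearW => N.
  apply: eq_integral => y _; rewrite big1 ?subr0// => n _.
  by rewrite psi0 mul0r.
apply: contrapT => /eqP px; pose c := `|psi x| / 2.
have c0 : 0 < c by rewrite divr_gt0 ?normr_gt0.
have /cvgrPdist_le/(_ c c0)/nbhs_ballP[r /= r0 rB] := C0psi.1 x.
have [r' r'0 cD] := open_cube_sub oD Dx.
pose s := Num.min r r' / 2.
have m0 : 0 < Num.min r r' by rewrite lt_min r0.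
have s0 : 0 < s by rewrite divr_gt0.
have [sr sr'] : s < r /\ s < r'.
  by apply/andP; rewrite -lt_min /s; lra.
suff : c ^+ 2 * (2 * s) ^+ d <= \int[mu]_(y in D) (psi y ^+ 2).
  have cs : 0 < c ^+ 2 * (2 * s) ^+ d.
    by apply: mulr_gt0; apply: exprn_gt0 => //; apply: mulr_gt0.
  by rewrite /Rintegral I0 => /(lt_le_trans cs); rewrite ltxx.
apply: (@Rintegral_ge_cst _ _ _ _ _ (cube x s)) => //.
- by apply: measurable_cube; exact: ltW.
- by move=> y; rewrite /cube/= => yx; apply: cD; exact: le_trans yx (ltW sr').
- have := C0_integrable oD bD (C0_mul C0psi C0psi).
  by congr (is_true (_.-integrable _ _)); apply/funext => y /=; rewrite expr2.
- by move=> y _; exact: sqr_ge0.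
- by apply: row_lebesgue_cube; exact: ltW.
- by apply: exprn_ge0; exact: ltW.
move=> y yx; have yr : ball x r y by rewrite -ball_normE/= distrC; exact: le_lt_trans yx sr.
have := rB y yr; rewrite /= -[psi y ^+ 2]real_normK ?num_real// => h.
rewrite lerXn2r ?nnegrE ?(ltW c0)//.
have := ler_distD (psi x) 0 (psi y); rewrite !sub0r !normrN.
have := ler_normB (psi x - psi y) (- psi y).
rewrite opprK subrK normrN; move: h; rewrite /c; lra.
Qed.

Section centered.
Variables (x : Rd) (r0 : R) (r00 : 0 < r0) (r0D : cube x r0 `<=` D).

Section scale.
Variables (e : R) (e0 : 0 < e) (er : e <= r0).

Let K : set Rd := [set y | sqdist x y <= e ^+ 2].

Let cK : closed K.
Proof.
rewrite (_ : K = sqdist x @^-1` [set s | s <= e ^+ 2])//.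
apply: closed_comp => [y _|]; last exact: closed_le.
by have [] := @is_C2_sqdist R d setT x y I.
Qed.

Let Kcube : K `<=` cube x e.
Proof. by move=> y Ky; apply: sqdist_ge Ky; exact: ltW. Qed.

Let KD : K `<=` D.
Proof. by move=> y /Kcube ye; apply: r0D; exact: le_trans ye er. Qed.

Lemma bump_C0 k p : vanish_order k.+1 p -> C0 D (bump p x e).
Proof.
move=> vp; split; first exact: bump_continuous.
by move=> y nDy; apply: bump_vanish vp _ => // /KD.
Qed.

(** Green's identity moves the Laplacian onto [f n]; the factor [e ^+ 2] undoes the scaling of
    [bump_laplacian]. *)
Lemma bump_coef p n : vanish_order 3 p ->
  dotL2 D (bump (@radial_laplacian R d p) x e) (f n) =
  - (e ^+ 2 * lam n) * dotL2 D (bump p x e) (f n).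
Proof.
move=> v3; have mD := open_row_measurable oD.
have [_ _ _ /(_ n)[fC2 _ fE]] := eig.
have [BC2 lapB] := bump_laplacian x e0 v3.
have C2D : C2_on D (bump p x e) by move=> y _; exact: BC2.
have BK y : ~ K y -> bump p x e y = 0 by exact: (bump_vanish e0 v3).
have CB := bump_C0 v3; have CL := bump_C0 (vanish_order_radial v3).
have := green oD bD cK KD fC2 C2D BK.
have -> : \int[mu]_(y in D) (f n y * laplacian (bump p x e) y - laplacian (f n) y * bump p x e
  y) =
    dotL2 D (fun y => e ^- 2 * bump (@radial_laplacian R d p) x e y + lam n * bump p x e y) (f n).
  apply: eq_Rintegral => y; rewrite inE => Dy; rewrite lapB -[laplacian (f n) y]opprK fE//; ring.
rewrite (dotL2_lin oD bD) ?(C0_scale _)//; last exact: C0_scale.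
have -> : dotL2 D (fun y => lam n * bump p x e y) (f n) = lam n * dotL2 D (bump p x e) (f n).
  rewrite (_ : (fun _ => _) = fun y => lam n * bump p x e y + cst 0 y).
    by rewrite (dotL2_lin oD bD)// ?dotL2_0 ?addr0//; exact: C0_cst0.
  by apply/funext => y; rewrite addr0.
have e20 : e ^+ 2 != 0 by rewrite expf_neq0// gt_eqF.
move=> H; apply: (mulfI (_ : e ^- 2 != 0)); first by rewrite invr_eq0.
apply/eqP; rewrite -subr_eq0; apply/eqP; rewrite -[RHS]H; field.
by rewrite gt_eqF.
Qed.

(** Each Laplacian costs two orders of vanishing; the one left over makes the last bump vanish on
    the sphere, hence continuous with support in [D]. *)
Lemma bump_coef_iter (m : nat) p n : vanish_order (m.*2 + 1) p ->
  vanish_order 1 (iter m (@radial_laplacian R d) p) /\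
  dotL2 D (bump (iter m (@radial_laplacian R d) p) x e) (f n) =
  (- (e ^+ 2 * lam n)) ^+ m * dotL2 D (bump p x e) (f n).
Proof.
elim: m p => [|m IH] p vp; first by rewrite /= expr0 mul1r.
have v3 : vanish_order 3 p by apply: vanish_order_le vp; rewrite doubleS addn1 !ltnS.
have [] := IH (@radial_laplacian R d p).
  by apply: vanish_order_radial; rewrite doubleS !addSn in vp.
rewrite -iterSr => v1 ->; split=> //.
by rewrite bump_coef// (exprSr _ m) mulrA.
Qed.

Lemma bump_norm (C : R) k p : (forall y, `|bump p x e y| <= C) -> vanish_order k.+1 p ->
  dotL2 D (bump p x e) (bump p x e) <= C ^+ 2 * (2 * e) ^+ d.
Proof.
move=> pC vp; have CB := bump_C0 vp.
apply: (@Rintegral_le_cst _ _ _ _ _ (cube x e)).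
- exact: open_row_measurable.
- by apply: measurable_cube; exact: ltW.
- by move=> y ye; apply: r0D; exact: le_trans ye er.
- exact: (C0_integrable oD bD (C0_mul CB CB)).
- by move=> y nye; rewrite (bump_vanish e0 vp) ?mul0r// => /Kcube.
- by apply: row_lebesgue_cube; exact: ltW.
move=> y _; rewrite -expr2 -[X in X <= _]real_normK ?num_real//.
by rewrite lerXn2r ?nnegrE// (le_trans _ (pC y)).
Qed.

End scale.
End centered.
End lower_bound.

(** * Bounded weighted norms against convergence of S(x) *)

Section critical_divergence.
Context {R : realType} {d : nat} {D : set 'rV[R]_d}.
Local Notation Rd := 'rV[R]_d.
Implicit Types (x y : Rd).
Hypotheses (oD : open D) (bD : bounded_set D) (d_gt0 : (0 < d)%N).
Variables (lam : nat -> R) (f : nat -> Rd -> R).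
Hypothesis eig : dirichlet_eigensystem D lam f.
Let fC0 := eig_C0 eig.
Let fon := eig_orthonormal eig.

(** Interpolates the real exponent [b] between the integer exponents 0 and [k], for which Bessel's
    inequality gives bounds. *)
Lemma powR_le_1Dexp (z b : R) (k : nat) : 0 < z -> 0 <= b -> b <= k%:R ->
  z `^ b <= 1 + z ^+ k.
Proof.
move=> z0 b0 bk; have [z1|z1] := leP z 1.
  apply: (@le_trans _ _ 1); last by rewrite lerDl exprn_ge0// ltW.
  rewrite -(powRr0 z); apply: ger_powR => //; by rewrite z0.
apply: (@le_trans _ _ (z ^+ k)); last by rewrite lerDr.
by rewrite -powR_mulrn ?(ltW z0)//; apply: ler_powR => //; exact: ltW.
Qed.

(** Summed with suitable weights [w], this does the work of Cauchy-Schwarz without square roots. *)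
Lemma weighted_am_gm (a b w : R) : 0 < w -> `|a * b| <= (w * a ^+ 2 + w^-1 * b ^+ 2) / 2.
Proof.
move=> w0; rewrite normrM -(real_normK (num_real a)) -(real_normK (num_real b)).
have := sqr_ge0 (w * `|a| - `|b|) => H.
rewrite ler_pdivlMr// -subr_ge0.
rewrite [X in 0 <= X](_ : _ = w^-1 * (w * `|a| - `|b|) ^+ 2); last by field; rewrite gt_eqF.
by rewrite mulr_ge0// invr_ge0 ltW.
Qed.

Section at_point.
Variables (b : R) (b0 : 0 < b) (bd : b <= d%:R / 2) (x : Rd) (Dx : D x).

Let k : nat := (Num.truncn b).+1.
(** [k] exceeds [b], for the weighted sum. The part [5 * d] is for pointwise convergence: squaring
    (n+1)^2 |c_n f_n| costs lam_n^(4d) for the index and lam_n^d for the eigenfunction. *)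
Let m : nat := (5 * d + k)%N.
Let p : {poly R} := 'X^(m.*2 + 3).
Let Lp : {poly R} := iter m (@radial_laplacian R d) p.

Let p_order : vanish_order (m.*2 + 1) p.
Proof. by exists 'X^2; rewrite -exprD; congr ('X^_); rewrite addnCA. Qed.

Let p_order1 : vanish_order 1 p.
Proof. by apply: vanish_order_le p_order; rewrite addn1. Qed.

(* [c] lists the coefficients of a bump of height 1 at [x] and width [e]. Its
   squared norm with weight [lam n ^ b] scales like [e ^ (d - 2 b)], hence stays
   bounded even in the critical case [b = d / 2]. *)
Lemma test_function_bounds : exists B1 B : R, [/\ 0 <= B1, 0 <= B &
  exists2 r : R, 0 < r & forall e : R, 0 < e -> e <= r -> exists c : nat -> R,
  [/\ forall N, \sum_(n < N) c n ^+ 2 <= B1 * e,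
      forall N, \sum_(n < N) lam n `^ b * c n ^+ 2 <= B &
      (fun N => \sum_(n < N) c n * f n x) @ \oo --> (1 : R)]].
Proof.
have [r0 r00 r0D] := open_cube_sub oD Dx.
have [C1 C10 pC] := @bump_bounded R d p; have [C2 C20 LpC] := @bump_bounded R d Lp.
pose B1 := C1 ^+ 2 * 2 ^+ d; pose B2 := C2 ^+ 2 * 2 ^+ d.
have B10 : 0 <= B1 by rewrite mulr_ge0// exprn_ge0.
have B20 : 0 <= B2 by rewrite mulr_ge0// exprn_ge0.
exists B1, (B1 + B2); split=> //; first exact: addr_ge0.
exists (Num.min r0 1); first by rewrite lt_min r00 ltr01.
move=> e e0; rewrite le_min => /andP[er e1].
pose c n := dotL2 D (bump p x e) (f n).
have Cg : C0 D (bump p x e) := bump_C0 r0D e0 er p_order1.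
have LpO : vanish_order 1 Lp by have [] := bump_coef_iter oD bD eig r0D e0 er 0%N p_order.
have CLg : C0 D (bump Lp x e) := bump_C0 r0D e0 er LpO.
have ed0 : 0 < e ^+ d by rewrite exprn_gt0.
have sum1 N : \sum_(n < N) c n ^+ 2 <= B1 * e ^+ d.
  apply: le_trans (bessel oD bD fC0 fon N Cg) _.
  apply: le_trans (bump_norm oD bD r0D e0 er (pC x e) p_order1) _.
  by rewrite exprMn mulrA.
have sum2 N : \sum_(n < N) (e ^+ 2 * lam n) ^+ m.*2 * c n ^+ 2 <= B2 * e ^+ d.
  apply: (@le_trans _ _ (dotL2 D (bump Lp x e) (bump Lp x e))).
    apply: le_trans (bessel oD bD fC0 fon N CLg); rewrite le_eqVlt; apply/orP; left; apply/eqP.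
    apply: eq_bigr => n _; have [_ ->] := bump_coef_iter oD bD eig r0D e0 er n p_order.
    by move: (e ^+ 2 * lam n) => z; rewrite exprMn (exprAC _ m 2) sqrrN -mul2n exprM.
  apply: le_trans (bump_norm oD bD r0D e0 er (LpC x e) LpO) _.
  by rewrite exprMn mulrA.
have sum3 N : \sum_(n < N) lam n `^ b * c n ^+ 2 <= B1 + B2.
  have e20 : 0 < e ^+ 2 by rewrite exprn_gt0.
  have eb0 : 0 < (e ^+ 2) `^ b by rewrite powR_gt0.
  (* Here the hypothesis [b <= d / 2] enters, together with [e <= 1]. *)
  have eb : e ^+ d <= (e ^+ 2) `^ b.
    have -> : e ^+ d = (e ^+ 2) `^ (d%:R / 2).
      rewrite -powR_mulrn ?(ltW e0)// -(powR_mulrn 2 (ltW e0)) -powRrM.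
      by congr (_ `^ _); field.
    by apply: ger_powR => //; rewrite e20/= exprn_ile1// ltW.
  rewrite -(ler_pM2l eb0); apply: (@le_trans _ _ ((B1 + B2) * e ^+ d)); last first.
    by rewrite mulrC ler_wpM2r// addr_ge0.
  rewrite mulrDl; apply: le_trans (lerD (sum1 N) (sum2 N)).
  rewrite mulr_sumr -big_split/=; apply: ler_sum => n _.
  have ln0 := lam_gt0 eig n.
  rewrite mulrA -powRM ?(ltW e20) ?(ltW ln0)// -{2}[c n ^+ 2]mul1r -mulrDl.
  apply: ler_wpM2r; first exact: sqr_ge0.
  apply: powR_le_1Dexp; [exact: mulr_gt0|exact: ltW|].
  apply: (@le_trans _ _ k%:R); first by apply: ltW; exact: truncnS_gt.
  by rewrite ler_nat -addnn /m; apply: leq_trans (leq_addl _ _); exact: leq_addl.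
exists c; split=> // [N|].
  apply: le_trans (sum1 N) _; apply: ler_wpM2l => //.
  (* e^d <= e, because [0 < d] and [e <= 1]. *)
  by rewrite -(prednK d_gt0) exprS ler_piMr ?(ltW e0)// exprn_ile1// ltW.
have [Cf Cf0 fb] := eigenfunction_bound oD bD eig.
have [Cg' Cg0 gb] := eigenvalue_growth oD bD eig.
have l0 := lam_gt0 eig 0.
pose j := (m.*2 - 5 * d)%N.
have mj : (m.*2 = 5 * d + j)%N by rewrite /j subnKC// -addnn /m -addnA leq_addr.
(* This bound may blow up as [e] tends to 0: it serves only the convergence of the series at fixed
   [e]. *)
pose Q := Cg' ^+ 4 * Cf * ((lam 0 ^+ j)^-1 * ((e ^+ 2) ^+ m.*2)^-1 * (B2 * e ^+ d)).
have Xb n y : n.+1%:R ^+ 2 * `|c n * f n y| <= 1 + Q.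
  have ln0 := lam_gt0 eig n.
  set X := _ * _; have X0 : 0 <= X by rewrite mulr_ge0.
  suff XQ : X ^+ 2 <= Q by have := sqr_ge0 (X - 1); move: XQ; nra.
  have -> : X ^+ 2 = n.+1%:R ^+ 4 * (c n ^+ 2 * f n y ^+ 2).
    by rewrite /X exprMn -exprM real_normK ?num_real// (exprMn 2 (c n)).
  have c2 : lam n ^+ m.*2 * c n ^+ 2 <= ((e ^+ 2) ^+ m.*2)^-1 * (B2 * e ^+ d).
    rewrite ler_pdivlMl ?exprn_gt0 ?exprn_gt0//; apply: le_trans (sum2 n.+1).
    rewrite big_ord_recr/= mulrA -exprMn lerDr sumr_ge0// => i _.
    apply: mulr_ge0; last exact: sqr_ge0.
    by apply: exprn_ge0; apply: mulr_ge0; [exact: sqr_ge0|exact: ltW (lam_gt0 eig i)].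
  have c3 : lam n ^+ (5 * d) * c n ^+ 2 <=
      (lam 0 ^+ j)^-1 * (((e ^+ 2) ^+ m.*2)^-1 * (B2 * e ^+ d)).
    rewrite ler_pdivlMl ?exprn_gt0//; apply: le_trans c2.
    rewrite mulrA mj exprD [lam n ^+ (5 * d) * _]mulrC.
    apply: ler_wpM2r; first exact: sqr_ge0.
    apply: ler_wpM2r; first by apply: exprn_ge0; exact: ltW.
    by rewrite lerXn2r ?nnegrE ?(ltW l0) ?(ltW ln0)// (lam_nd eig).
  apply: (@le_trans _ _ ((Cg' * lam n ^+ d) ^+ 4 * (c n ^+ 2 * (Cf * lam n ^+ d)))).
    apply: ler_pM; [exact: exprn_ge0|by apply: mulr_ge0; exact: sqr_ge0| |].
      by rewrite lerXn2r ?nnegrE// mulr_ge0// exprn_ge0// ltW.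
    by apply: ler_wpM2l; [exact: sqr_ge0|exact: fb].
  have E : lam n ^+ (5 * d) = (lam n ^+ d) ^+ 5 by rewrite mulnC exprM.
  rewrite [leLHS](_ : _ = Cg' ^+ 4 * Cf * (lam n ^+ (5 * d) * c n ^+ 2)); last first.
    by rewrite E; ring.
  rewrite /Q -(mulrA (lam 0 ^+ j)^-1); apply: ler_wpM2l => //.
  by rewrite mulr_ge0// exprn_ge0.
(* The sum of the series has the coefficients of the bump, hence equals it on [D]; this turns an L^2
   expansion into one valid at the point [x]. *)
pose h := expansion f c.
have Ch : C0 D h := expansion_C0 eig Xb.
have hc n : dotL2 D h (f n) = c n := expansion_coef oD bD eig Xb n.
have diff0 : -1 * h x + bump p x e x = 0.
  apply: (C0_coef_eq0 oD bD eig (C0_lin (- 1) Ch Cg)) => // n.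
  by rewrite (dotL2_lin oD bD (- 1) Ch Cg (fC0 n)) hc mulN1r addNr.
have bx : bump p x e x = 1.
  rewrite /bump /sqdist subrr (_ : dot 0 0 = 0); last first.
    by rewrite /dot big1// => i _; rewrite !mxE mulr0.
  by rewrite mul0r subr0 max_l// /p hornerXn expr1n.
have hx : h x = 1 by move: diff0; rewrite bx mulN1r addrC => /subr0_eq ->.
rewrite -hx; apply/cvgrPdist_le => eta eta0; near=> N.
apply: le_trans (expansion_tail Xb N x) _.
have Q0 : 0 <= 1 + Q by apply: le_trans (Xb 0%N x); rewrite mulr_ge0.
rewrite ler_pdivrMr// [leRHS]mulrC -ler_pdivrMr//.
apply: (@le_trans _ _ N%:R); last by rewrite ler_nat.
by near: N; exact: nbhs_infty_ger.
Unshelve. all: by end_near. Qed.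

(* Split [1 = \sum_n c n * f n x] at some [N0]: as [e] tends to 0 the head tends
   to 0 since [c] does so in l^2, and the tail is small by Cauchy-Schwarz, uniformly
   in [e], if the weighted sum of the [f n x ^+ 2] converges. *)
Lemma weighted_diag_unbounded (S : R) :
  ~ (forall N, \sum_(n < N) lam n `^ (- b) * f n x ^+ 2 <= S).
Proof.
move=> SN; pose w n := lam n `^ (- b) * f n x ^+ 2.
have w0 n : 0 <= w n by apply: mulr_ge0; [exact: powR_ge0|exact: sqr_ge0].
have [B1 [B [B10 B0 [r r0 test]]]] := test_function_bounds.
(* Chosen so that [th * B] is at most 1/2; a tail of size [th / 4] then contributes at most 1/4
   after division by [th]. *)
pose th := (2 * (B + 1))^-1; have B1p : 0 < B + 1 by rewrite ltr_wpDl.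
have th0 : 0 < th by rewrite invr_gt0 mulr_gt0.
have [N0 tail] : exists N0 : nat, forall M, (N0 <= M)%N -> \sum_(N0 <= n < M) w n <= th / 4.
  have [cw _] := nonneg_series_cvg w0 SN.
  have th40 : 0 < th / 4 by rewrite divr_gt0.
  have /cvgrPdist_le/(_ _ th40)[N0 _ /(_ N0 (leqnn _))/=] := cw.
  move=> H; exists N0 => M NM.
  rewrite -sub_series_geq//; apply: le_trans H; apply: le_trans (ler_norm _).
  apply: lerB => //; rewrite [series w M]/series/= big_mkord; exact: series_cvg_le.
pose F := \sum_(n < N0) f n x ^+ 2.
have F0 : 0 <= F by apply: sumr_ge0 => n _; exact: sqr_ge0.
have [K K0 FK] : exists2 K : R, 0 < K & 4 * F <= K.
  by exists (4 * (F + 1)); [rewrite mulr_gt0// ltr_wpDl|lra].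
(* [N0], and with it [F] and [K], is fixed before [e], which can therefore make [K * (B1 * e)]
   small. *)
pose e := Num.min r (4 * K * (B1 + 1))^-1.
have B11 : 0 < B1 + 1 by rewrite ltr_wpDl.
have e0 : 0 < e by rewrite lt_min r0 invr_gt0 !mulr_gt0.
have er : e <= r by rewrite ge_min lexx.
have eK : K * (B1 * e) <= 1 / 4.
  have : e <= (4 * K * (B1 + 1))^-1 by rewrite ge_min lexx orbT.
  rewrite -[X in _ <= X]mul1r ler_pdivlMr ?mulr_gt0// => H.
  rewrite ler_pdivlMr//; apply: le_trans H.
  rewrite [leRHS](_ : _ = K * (B1 * e) * 4 + 4 * (K * e)); last by ring.
  by rewrite lerDl mulr_ge0// mulr_ge0// ltW.
have [c [c1 c2 cv]] := test e e0 er.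
have q0 : 0 < 1 / 8 :> R by rewrite divr_gt0.
have /cvgrPdist_le/(_ _ q0)[M1 _ HM1] := cv.
pose M := maxn N0 M1.
have NM : (N0 <= M)%N by exact: leq_maxl.
have := HM1 M (leq_maxr _ _); rewrite /= => close.
have split_sum : \sum_(n < M) c n * f n x =
    \sum_(n < N0) c n * f n x + \sum_(N0 <= n < M) c n * f n x.
  by rewrite -(big_mkord xpredT (fun n => c n * f n x)) (@big_cat_nat _ _ _ N0 0%N M)//=
    big_mkord.
have part1 : `|\sum_(n < N0) c n * f n x| <= 1 / 4.
  apply: le_trans (ler_norm_sum _ _ _) _.
  apply: (@le_trans _ _ (\sum_(n < N0) (K * c n ^+ 2 + K^-1 * f n x ^+ 2) / 2)).
    by apply: ler_sum => n _; exact: weighted_am_gm.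
  rewrite -mulr_suml big_split/= -!mulr_sumr -/F.
  have h1 : K * \sum_(n < N0) c n ^+ 2 <= 1 / 4.
    by apply: le_trans eK; apply: ler_wpM2l; [exact: ltW|exact: c1].
  have h2 : K^-1 * F <= 1 / 4.
    by rewrite mulrC ler_pdivrMr//; lra.
  by rewrite ler_pdivrMr//; lra.
have part2 : `|\sum_(N0 <= n < M) c n * f n x| <= 3 / 8.
  apply: le_trans (ler_norm_sum _ _ _) _.
  apply: (@le_trans _ _ (\sum_(N0 <= n < M) (th * (lam n `^ b * c n ^+ 2) + th^-1 * w n) / 2)).
    apply: ler_sum => n _.
    have lb0 : 0 < lam n `^ b by rewrite powR_gt0// (lam_gt0 eig).
    have := @weighted_am_gm (c n) (f n x) (th * lam n `^ b) (mulr_gt0 th0 lb0).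
    by rewrite /w powRN invfM !mulrA.
  rewrite -mulr_suml big_split/= -!mulr_sumr.
  have h1 : th * \sum_(N0 <= n < M) lam n `^ b * c n ^+ 2 <= 1 / 2.
    apply: (@le_trans _ _ (th * B)); last first.
      by rewrite /th mulrC ler_pdivrMr ?mulr_gt0//; lra.
    apply: ler_wpM2l; first exact: ltW.
    apply: le_trans (c2 M); rewrite -(big_mkord xpredT (fun n => lam n `^ b * c n ^+ 2)).
    rewrite (@big_cat_nat _ _ _ N0 0%N M)//= lerDr; apply: sumr_ge0 => n _.
    by apply: mulr_ge0; [exact: powR_ge0|exact: sqr_ge0].
  have h2 : th^-1 * \sum_(N0 <= n < M) w n <= 1 / 4.
    rewrite mulrC ler_pdivrMr//; apply: le_trans (tail M NM) _.
    by rewrite mul1r mulrC.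
  by rewrite ler_pdivrMr//; lra.
(* Head 1/4, tail 3/8 and truncation error 1/8 add up to 3/4, less than the value 1. *)
move: close; rewrite split_sum ler_norml => /andP[_].
by move: part1 part2; rewrite !ler_norml => /andP[_ h1] /andP[_ h2]; lra.
Qed.

End at_point.
End critical_divergence.

Theorem theorem1p1 (R : realType) (d : nat) (D : set 'rV[R]_d)
    (lam : nat -> R) (f : nat -> 'rV[R]_d -> R) (alpha : R)
    (H : completeNormedModType R) (iota : ('rV[R]_d -> R) -> H)
    (d_gt0 : (0 < d)%N)
    (alpha_gt0 : 0 < alpha)
    (D_domain : bounded_lipschitz_domain D)
    (lam_f : dirichlet_eigensystem D lam f)
    (H_completion : is_completion D lam f alpha iota) :
  (forall (t : R) (x : 'rV[R]_d), 0 < t -> D x ->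
     p_in_Halpha D lam f iota t x)
  <-> d%:R / 2 - 1 < alpha.
Proof.
have [[x0 Dx0] oD _ bD _] := D_domain.
split=> [hp|da t x t0 Dx].
  rewrite ltNge; apply/negP => ad.
  (* The sum diverges at every point of [D], so any [x0] will do, at time 1. *)
  have [S SN] := (p_in_HalphaE oD bD lam_f alpha_gt0 H_completion x0 ltr01).1
    (hp 1 x0 ltr01 Dx0).
  have b0 : 0 < 1 + alpha by rewrite addr_gt0.
  have bd : 1 + alpha <= d%:R / 2 by lra.
  exact: (weighted_diag_unbounded oD bD d_gt0 lam_f b0 bd Dx0 SN).
have db : d%:R / 2 < 1 + alpha by lra.
have [C HC] := weighted_diag_bound oD bD lam_f db.
by apply/(p_in_HalphaE oD bD lam_f alpha_gt0 H_completion x t0); exists C => N.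
Qed.
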